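(* Let $\Omega\subset\mathbb{R}^2$ be a connected bounded open set with Lipschitz boundary and let $u\in W^{1,1}(\Omega;\mathbb{S}^1)$. Then $$\overline{\overline{\mathcal A}}(u,\Omega)=\int_\Omega\sqrt{1+|\nabla u|^2}\,dx .$$
   Context: $\mathbb{S}^1$ is the unit circle of $\mathbb{R}^2$ and $W^{1,1}(\Omega;\mathbb{S}^1)=\{u\in W^{1,1}(\Omega;\mathbb{R}^2):|u|=1\text{ a.e. in }\Omega\}$. For an open set $A\subseteq\Omega$ and $v\in C^1(A;\mathbb{R}^2)$, $\mathcal A(v,A)=\int_A\sqrt{1+|\nabla v|^2+|Jv|^2}\,dx$, where $|\nabla v|$ is the Frobenius norm and $Jv$ the Jacobian determinant of $v$. For $u\in L^1(A;\mathbb{R}^2)$, the relaxed area is $$\overline{\mathcal A}(u,A)=\inf\Big\{\liminf_{k\to+\infty}\mathcal A(v_k,A): v_k\in C^1(A;\mathbb{R}^2),\ v_k\to u\text{ in }L^1(A;\mathbb{R}^2)\Big\}.$$ The countably subadditive interior envelope is defined, for $V\subseteq\Omega$, by $$\overline{\overline{\mathcal A}}(u,V)=\inf\Big\{\sum_{k=1}^{+\infty}\overline{\mathcal A}(u,A_k): A_k\subseteq\Omega\text{ open},\ \bigcup_{k=1}^{+\infty}A_k\supseteq V\Big\}.$$ *)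

(* Defs.v *)
From HB Require Import structures.
From mathcomp Require Import all_boot all_order all_algebra.
From mathcomp Require Import all_classical all_reals all_analysis.

Set Implicit Arguments.
Unset Strict Implicit.
Unset Printing Implicit Defensive.

Import Order.TTheory GRing.Theory Num.Theory.
Import numFieldNormedType.Exports.

Local Open Scope classical_set_scope.
Local Open Scope ring_scope.

(* The plane is R * R: its topology is the Euclidean one, but the library norm
   `|x| on it is the max norm, hence enorm below. *)
Notation plane R := (R * R)%type.

Notation leb2 R := ((@lebesgue_measure R) \x (@lebesgue_measure R))%E.

Section Plane.
Variable R : realType.
Implicit Types (x : plane R) (A Omega V : set (plane R)).
Implicit Types (phi : plane R -> R) (u v : plane R -> plane R).

Definition enorm x : R := Num.sqrt (x.1 ^+ 2 + x.2 ^+ 2).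

Definition circle : set (plane R) := [set x | enorm x = 1].

Definition coord2 (i : 'I_2) x : R := if i == 0 then x.1 else x.2.

Definition basis2 (j : 'I_2) : plane R := if j == 0 then (1, 0) else (0, 1).

Definition partial (j : 'I_2) phi x : R := 'D_(basis2 j) phi x.

Definition frobenius (M : 'M[R]_2) : R :=
  Num.sqrt (\sum_(i < 2) \sum_(j < 2) M i j ^+ 2).

Definition grad v x : 'M[R]_2 :=
  \matrix_(i, j) partial j (coord2 i \o v) x.

(* Functions on an open set A are represented by total functions whose values
   outside A are irrelevant. *)
Definition C1 A v : Prop :=
  forall x, A x ->
    differentiable v x /\
    forall i j : 'I_2, {for x, continuous (partial j (coord2 i \o v))}.

Definition L1 A v : Prop :=
  forall i : 'I_2, (leb2 R).-integrable A (EFin \o (coord2 i \o v)).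

Definition cvg_L1 A (v_ : nat -> plane R -> plane R) u : Prop :=
  (fun k => \int[leb2 R]_(x in A) (enorm (v_ k x - u x))%:E)%E @ \oo --> 0%E.

Definition smooth phi : Prop :=
  forall (s : seq 'I_2) x, differentiable (foldr partial phi s) x.

Definition test_function Omega phi : Prop :=
  [/\ smooth phi,
      compact (closure [set x | phi x != 0]) &
      closure [set x | phi x != 0] `<=` Omega].

Definition is_weak_grad Omega u (G : plane R -> 'M[R]_2) : Prop :=
  forall i j : 'I_2,
    (leb2 R).-integrable Omega (fun x => (G x i j)%:E) /\
    forall phi, test_function Omega phi ->
      \int[leb2 R]_(x in Omega) (coord2 i (u x) * partial j phi x) =
      - \int[leb2 R]_(x in Omega) (G x i j * phi x).

Definition W11 Omega u : Prop := L1 Omega u /\ exists G, is_weak_grad Omega u G.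

Definition W11_circle Omega u : Prop :=
  W11 Omega u /\ {ae leb2 R, forall x, Omega x -> circle (u x)}.

(* A representative of the weak gradient, which is unique up to a.e. equality;
   the default value is used only if u is not in W11 Omega. *)
Definition weak_grad Omega u : plane R -> 'M[R]_2 :=
  xget (fun=> 0) [set G | is_weak_grad Omega u G].

(* Near each boundary point, in the coordinates of some positively oriented
   orthonormal frame (a, a^perp), Omega is the strict subgraph of a Lipschitz
   function. *)
Definition lipschitz_boundary Omega : Prop :=
  forall p, (closure Omega `\` interior Omega) p ->
    exists (a : plane R) (g : R -> R),
      [/\ circle a,
          [lipschitz g t | t in [set: R]] &
          \forall x \near p,
            Omega x <-> a.1 * x.2 - a.2 * x.1 < g (a.1 * x.1 + a.2 * x.2)].

Definition area v A : \bar R :=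
  (\int[leb2 R]_(x in A)
     (Num.sqrt (1 + frobenius (grad v x) ^+ 2 + (\det (grad v x)) ^+ 2))%:E)%E.

Definition relaxed_area u A : \bar R :=
  ereal_inf [set l | exists v_ : nat -> plane R -> plane R,
    [/\ forall k, C1 A (v_ k) /\ L1 A (v_ k),
        cvg_L1 A v_ u &
        l = limn_einf (fun k => area (v_ k) A)]].

Definition area_envelope Omega u V : \bar R :=
  ereal_inf [set s | exists A_ : nat -> set (plane R),
    [/\ forall k, open (A_ k) /\ A_ k `<=` Omega,
        V `<=` \bigcup_k A_ k &
        s = (\sum_(0 <= k <oo) relaxed_area u (A_ k))%E]].

End Plane.

(* Main.v *)
(* Write [f = sqrt (1 + |grad u|^2)].  Lower bound: if [v_k] tends to [u] in L^1,
   then for a fixed mollifier the gradients of the mollified [v_k] converge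
   uniformly to the mollification of [grad u], so Jensen's inequality bounds the
   area of [v_k] from below; letting the mollifier concentrate gives
   [int_A f <= relaxed_area u A], and the integral is countably subadditive.

   Upper bound: a mollification of [u] leaves the circle, so it is composed with
   [z |-> - conj q (z - a)^2 / |z - a|^2], [a = (1 + d) q], [|q| = 1].  This map
   has values in the circle, which kills the Jacobian; on the circle it moves
   points little away from [q], and it stretches tangent vectors by at most
   [1 + P_a], with [P_a] the Poisson kernel of pole [a].  Since [u] is tangent
   to the circle ([u . d_j u = 0] almost everywhere), the relaxed area of [u] on
   [A] is at most the integral of [(1 + P_a(u)) f].  For [N] poles spread over a
   half circle the sum of the kernels is O(N) everywhere and O(1) on the opposite
   half circle; so if [u] takes values in that opposite half circle on [E], some
   pole gives [relaxed_area u A <= int_A f + C int_(A \ E) f] as [N] grows.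
   Finally [Omega] splits into countably many pieces on which [u_1] has a fixed
   sign, and by outer regularity each piece has an open neighbourhood with
   arbitrarily small excess. *)
Require Import Defs.
From HB Require Import structures.
From mathcomp Require Import all_boot all_order all_algebra.
From mathcomp Require Import all_classical all_reals all_analysis.
From mathcomp Require Import measurable_realfun ring lra.
Set Implicit Arguments.
Unset Strict Implicit.
Unset Printing Implicit Defensive.
Import Order.TTheory GRing.Theory Num.Theory.
Import numFieldNormedType.Exports.
Local Open Scope classical_set_scope.
Local Open Scope ring_scope.

(** * Measurability in the plane *)

(** Plain mollification cannot give the upper bound: the Jacobian is quadratic in the gradient,
    which is only integrable. On the other hand the closed disc has no retraction onto the circle,
    so any correction must misbehave somewhere on the circle; the pole marks that place. The pole
    lies outside the disc at distance [d = 1/N], so all estimates for the corrected map hold with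
    constants in [1/d] and [1/d^2]; [N] is fixed first and the mollification radius afterwards. One
    kernel [P_a] controls two costs: the stretching of tangent vectors and, through
    [|F(z) - z|^2 <= 2 d P_a(z)], the displacement. Since [f >= 1], a bound on the integral of
    [P_a(u) f] therefore also yields [L^1] closeness. The spacing of the poles, about [1/(2N)],
    matches the width [1/N] of a kernel of height O([N]), so the mean of the kernels is bounded; the
    constant obtained is [C = 192]. This excess survives on a given open set and is harmless only
    because the envelope allows each piece its own open set and its own pole. The open sets also
    keep a positive distance to the complement of [Omega], so that mollification of the extension by
    zero commutes with the weak gradient. *)

Section plane_measurability.
Variable R : realType.
Implicit Types (U E : set (plane R)).

Lemma plane_ballE (x : plane R) e y :
  ball x e y <-> `|x.1 - y.1| < e /\ `|x.2 - y.2| < e.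
Proof. by []. Qed.

Lemma measurable_plane_ball (x : plane R) e : measurable (ball x e).
Proof.
have -> : ball x e = ball x.1 e `*` ball x.2 e by [].
by apply: measurableX; apply: open_measurable; exact: ball_open.
Qed.

(** The sigma-algebra of [plane R] is the product one. Max-norm balls are rectangles, and those with
    rational centre and radius [1/(n+1)] form a countable base. *)
Lemma open_measurable_plane U : open U -> measurable U.
Proof.
move=> oU.
pose B (q : rat * rat * nat) : set (plane R) :=
  ball (ratr q.1.1 : R, ratr q.1.2 : R) q.2.+1%:R^-1.
pose F q := if `[< B q `<=` U >] then B q else set0.
have -> : U = \bigcup_q F q.
  apply/seteqP; split=> [x Ux|x [q _]]; last first.
    by rewrite /F; case: asboolP => // BU Bx; exact: BU.
  have /nbhs_ballP[e /= e0 eU] : nbhs x U by exact: open_nbhs_nbhs.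
  have [n [ne n0]] : exists n, n.+1%:R^-1 < e / 2 /\ 0 < n.+1%:R^-1 :> R.
    have [n _ /(_ n (leqnn _))] :=
      near_infty_natSinv_lt (PosNum (divr_gt0 e0 (ltr0n R 2))).
    by exists n; split => //; rewrite invr_gt0.
  have [d dE] : exists d, d = n.+1%:R^-1 :> R by exists n.+1%:R^-1.
  rewrite -dE in ne n0.
  have /rat_in_itvoo[p /itvP p1] : x.1 - d < x.1 + d by lra.
  have /rat_in_itvoo[q /itvP q1] : x.2 - d < x.2 + d by lra.
  have pn : `|ratr p - x.1| < d by rewrite distrC ltr_distlC !p1.
  have qn : `|ratr q - x.2| < d by rewrite distrC ltr_distlC !q1.
  exists (p, q, n) => //; rewrite /F; case: asboolP => //; last first.
    case=> y; rewrite /B/= -dE plane_ballE/= => -[y1 y2]; apply: eU.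
    rewrite plane_ballE; split.
      rewrite -(subrKA (ratr p)) (le_lt_trans (ler_normD _ _))//.
      by rewrite distrC; lra.
    rewrite -(subrKA (ratr q)) (le_lt_trans (ler_normD _ _))//.
    by rewrite distrC; lra.
  by rewrite /B/= -dE plane_ballE.
apply: countable_bigcupT_measurable => // q; rewrite /F; case: asboolP => // _.
exact: measurable_plane_ball.
Qed.

Lemma closed_measurable_plane U : closed U -> measurable U.
Proof.
by move/closed_openC/open_measurable_plane/measurableC; rewrite setCK.
Qed.

(** Strips over Borel sets lie in [G] because intervals pull back to open sets under the
    projections, and a measurable rectangle is the intersection of two strips. *)
Lemma measurable_plane_sub_open (G : set (set (plane R))) :
  sigma_algebra setT G -> open `<=` G -> measurable `<=` G.
Proof.
move=> sG oG.
have half (f : plane R -> R) : continuous f ->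
    forall X : set R, measurable X -> G (f @^-1` X).
  move=> cf X mX.
  pose H := [set Y : set R | G (f @^-1` Y)].
  have sH : sigma_algebra setT H.
    case: sG => G0 GC GU; split.
    - by rewrite /H/= preimage_set0.
    - by move=> A HA; rewrite /H/= setTD preimage_setC -setTD; exact: GC.
    - by move=> A HA; rewrite /H/= preimage_bigcup; exact: GU.
  have : <<s @RGenOpens.G R >> X.
    exact: (eq_ind _ (fun S : set (set R) => S X) mX _ (RGenOpens.measurableE R)).
  apply: (_ : _ `<=` H); apply: smallest_sub => //= _ [a [b ->]]; apply: oG.
  by apply: open_comp => [? _|]; [exact: cf|exact: interval_open].
rewrite measurable_prod_measurableType; apply: smallest_sub => //.
move=> _ [A mA] [B mB <-].
have -> : A `*` B = (fst @^-1` A) `&` (snd @^-1` B) by [].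
have GI : setI_closed G.
  move=> X Y GX GY; have [G0 GC GU] := sG.
  rewrite -[X `&` Y]setCK setCI -bigcup2E -setTD; apply: (GC); apply: (GU).
  by case => [|[|n]] /=; rewrite -?setTD ?setDv//; exact: (GC).
by apply: GI; apply: half => // x; [exact: cvg_fst|exact: cvg_snd].
Qed.

(** The inner parallel set for the max norm: a kernel of radius less than [e] centred in it is
    supported in [U]. It is closed whatever [U] is. *)
Definition margin U e := [set x : plane R | ball x e `<=` U].

Lemma marginS U e e' : e <= e' -> margin U e' `<=` margin U e.
Proof. by move=> ee' x xU y /(le_ball ee')/xU. Qed.

Lemma margin_sub U e : 0 < e -> margin U e `<=` U.
Proof. by move=> e0 x; apply; exact: ballxx. Qed.

Lemma closed_margin U e : 0 < e -> closed (margin U e).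
Proof.
move=> e0; rewrite -[X in closed X]setCK; apply: open_closedC.
rewrite openE => x /= /existsNP[y /not_implyP[xy nUy]].
move: xy; rewrite plane_ballE => -[xy1 xy2].
pose d := Num.min (e - `|x.1 - y.1|) (e - `|x.2 - y.2|).
have d0 : 0 < d by rewrite /d lt_min !subr_gt0 xy1 xy2.
apply/nbhs_ballP; exists d => //= z; rewrite plane_ballE => -[].
rewrite !lt_min => /andP[xz1 _] /andP[_ xz2].
apply/existsNP; exists y; apply/not_implyP; split => //.
rewrite plane_ballE; split.
  by rewrite -(subrKA x.1) (le_lt_trans (ler_normD _ _))// distrC; lra.
by rewrite -(subrKA x.2) (le_lt_trans (ler_normD _ _))// distrC; lra.
Qed.

Lemma open_bigcup_margin U : open U ->
  U = \bigcup_n margin U n.+1%:R^-1.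
Proof.
move=> oU; apply/seteqP; split=> [x Ux|x [n _]]; last first.
  by apply: margin_sub; rewrite invr_gt0.
have /nbhs_ballP[e /= e0 eU] : nbhs x U by exact: open_nbhs_nbhs.
have [n _ /(_ n (leqnn _))/= ne] := near_infty_natSinv_lt (PosNum e0).
exists n => // y /(le_ball (ltW ne)); exact: eU.
Qed.

Lemma measurable_margin U e : 0 < e -> measurable (margin U e).
Proof. by move=> e0; apply: closed_measurable_plane; exact: closed_margin. Qed.

Lemma nondecreasing_margin U :
  nondecreasing_seq (fun n => margin U n.+1%:R^-1).
Proof.
move=> m n mn; apply/subsetPset; apply: marginS.
by rewrite lef_pV2 ?posrE// ler_nat ltnS.
Qed.

Lemma measurable_fun_continuous_open U (f : plane R -> R) : open U ->
  (forall x, U x -> {for x, continuous f}) -> measurable_fun U f.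
Proof.
move=> oU cf; apply: (measurability _ (RGenOpens.measurableE R)) => //.
move=> _ [_ [a [b ->]] <-]; apply: open_measurable_plane.
rewrite openE => x [Ux fx]; apply: filterI; first exact: open_nbhs_nbhs.
by apply: (cf x Ux); apply: open_nbhs_nbhs; split=> //; exact: interval_open.
Qed.

End plane_measurability.

(** * Outer regularity of finite measures on the plane *)

Section outer_regularity.
Variable R : realType.
Local Open Scope ereal_scope.

(** Good-set argument. Closed sets inside are carried along with open sets outside, since
    complementation exchanges the two. *)
Lemma outer_regular_plane (mu : {finite_measure set (plane R) -> \bar R})
    (E : set (plane R)) (e : R) : measurable E -> (0 < e)%R ->
  exists U, [/\ open U, E `<=` U & mu (U `\` E) <= e%:E].
Proof.
pose G (A : set (plane R)) := measurable A /\ forall d : R, (0 < d)%R ->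
  exists F U, [/\ closed F, open U, F `<=` A, A `<=` U & mu (U `\` F) <= d%:E].
have mcl (F : set (plane R)) : closed F -> measurable F.
  exact: closed_measurable_plane.
have mop (F : set (plane R)) : open F -> measurable F.
  exact: open_measurable_plane.
have limE (F : nat -> set (plane R)) (d : R) : (0 < d)%R ->
    (forall n, measurable (F n)) -> nonincreasing_seq F ->
    \bigcap_n F n = set0 -> exists n, mu (F n) <= d%:E.
  move=> d0 mF niF F0.
  have : mu \o F @ \oo --> mu (\bigcap_n F n).
    apply: nonincreasing_cvg_mu => //; last by rewrite F0.
    by rewrite ltey_eq fin_num_measure.
  rewrite F0 measure0 => /fine_cvgP[_ /cvgr0Pnorm_lt/(_ _ d0)].
  move=> [n _ /(_ _ (leqnn n))] /= nd.
  exists n; rewrite -(@fineK _ (mu (F n))) ?fin_num_measure// lee_fin.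
  by rewrite (le_trans _ (ltW nd))// ler_norm.
suff GE : measurable `<=` G.
  move=> /GE[mE /[apply]] [F [U [cF oU FE EU UF]]]; exists U; split => //.
  apply: le_trans UF; apply: le_measure; rewrite ?inE.
  - by apply: measurableD => //; exact: mop.
  - by apply: measurableD; [exact: mop|exact: mcl].
  - exact: setDS.
apply: measurable_plane_sub_open.
  split.
  - split=> // d d0; exists set0, set0; split => //.
    + exact: closed0.
    + by rewrite setDv measure0 lee_fin ltW.
  - move=> A [mA GA]; rewrite setTD; split; first exact: measurableC.
    move=> d /GA[F [U [cF oU FA AU UF]]]; exists (~` U), (~` F); split.
    + exact: open_closedC.
    + exact: closed_openC.
    + exact: subsetC.
    + exact: subsetC.
    + by rewrite setDE setCK setIC -setDE.
  (* Half of [d] is shared geometrically among the members of the union; the other half pays for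
     cutting the union of the closed sets, which need not be closed, to a finite one. *)
  - move=> A GA; split; first by apply: bigcupT_measurable => n; case: (GA n).
    move=> d d0.
    have e2 n : (0 < d / 2 / (2 ^ n.+1)%:R)%R.
      by rewrite !divr_gt0// ltr0n expn_gt0.
    have /choice[FU FUP] : forall n, exists FU : set (plane R) * set (plane R),
        [/\ closed FU.1, open FU.2, FU.1 `<=` A n, A n `<=` FU.2
        & mu (FU.2 `\` FU.1) <= (d / 2 / (2 ^ n.+1)%:R)%:E].
      move=> n; have [_ /(_ _ (e2 n))[F [U]]] := GA n.
      by exists (F, U).
    pose U := \bigcup_n (FU n).2.
    pose F := \bigcup_n (FU n).1.
    pose F1 i := (FU i).1.
    pose Fn n := \big[setU/set0]_(i < n) F1 i.
    have cFn n : closed (Fn n).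
      by apply: closed_bigsetU => i _; case: (FUP i).
    have oU : open U by apply: bigcup_open => n _; case: (FUP n).
    have mF : measurable F.
      by apply: bigcupT_measurable => n; apply: mcl; case: (FUP n).
    have [n nP] : exists n, mu (F `\` Fn n) <= (d / 2)%:E.
      apply: limE; first by rewrite divr_gt0.
      - by move=> n; apply: measurableD => //; exact: mcl.
      - move=> m n mn; apply/subsetPset; apply: setDS.
        move=> x; rewrite /Fn -!bigcup_mkord => -[k /= km kx].
        by exists k => //=; exact: leq_trans mn.
      - apply/seteqP; split => // x xF.
        have [[k _ kx] _] := xF 0%N I.
        have [_] := xF k.+1 I; apply.
        by rewrite /Fn big_ord_recr/=; right.
    exists (Fn n), U; split => //.
    + move=> x; rewrite /Fn -bigcup_mkord => -[k /= kn kx].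
      by exists k => //; have [_ _ + _ _] := FUP k; apply.
    + move=> x [k _ kx]; exists k => //.
      by have [_ _ _ + _] := FUP k; apply.
    + have mUF : measurable (U `\` F) by apply: measurableD => //; exact: mop.
      have mFn : measurable (F `\` Fn n) by apply: measurableD => //; exact: mcl.
      apply: (@le_trans _ _ (mu (U `\` F) + mu (F `\` Fn n))).
        apply: le_trans (measureU2 _ _ _) => //.
        apply: le_measure; rewrite ?inE.
        * by apply: measurableD; [exact: mop|exact: mcl].
        * exact: measurableU.
        * move=> x [Ux nFx]; have [Fx|nF] := pselect (F x); last by left.
          by right.
      rewrite (splitr d) EFinD leeD//.
      apply: (@le_trans _ _ (\sum_(n <oo) mu ((FU n).2 `\` (FU n).1))).
        apply: measure_sigma_subadditive => //.
        * move=> k; apply: measurableD; [apply: mop|apply: mcl];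
            by case: (FUP k).
        * move=> x [[k _ kx] nF]; exists k => //; split => // kF.
          by apply: nF; exists k.
      apply: le_trans (epsilon_trick0 xpredT (ltW (divr_gt0 d0 (ltr0n R 2)))).
      by apply: lee_nneseries => // k _; case: (FUP k).
(* An open set is exhausted from inside by its closed margins. *)
move=> A oA; split; first exact: mop.
move=> d d0.
have [n nP] : exists n, mu (A `\` margin A n.+1%:R^-1) <= d%:E.
  apply: limE => //.
  - move=> n; apply: measurableD; first exact: mop.
    by apply: measurable_margin; rewrite invr_gt0.
  - move=> m n mn; apply/subsetPset; apply: setDS; apply/subsetPset.
    exact: nondecreasing_margin.
  - apply/seteqP; split => // x xF; have [Ax _] := xF 0%N I.
    move: Ax; rewrite [X in X x]open_bigcup_margin// => -[n _ xn].
    by have [_] := xF n I.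
exists (margin A n.+1%:R^-1), A; split => //.
  by apply: closed_margin; rewrite invr_gt0.
by apply: margin_sub; rewrite invr_gt0.
Qed.

(** The measure with density [w] is finite, although the Lebesgue measure of the plane is not. *)
Lemma outer_regular_weight (w : plane R -> \bar R) (E : set (plane R)) (e : R) :
  measurable_fun setT w -> (forall x, 0 <= w x) ->
  \int[leb2 R]_x w x < +oo -> measurable E -> (0 < e)%R ->
  exists U, [/\ open U, E `<=` U & \int[leb2 R]_(x in U `\` E) w x <= e%:E].
Proof.
move=> mw w0 wfin mE e0.
pose m (A : set (plane R)) := \int[leb2 R]_(x in A) w x.
have m0 : m set0 = 0 by exact: integral_set0.
have mge0 A : 0 <= m A by apply: integral_ge0.
have madd : semi_sigma_additive m.
  move=> F mF tF mUF; rewrite /m ge0_integral_bigcup//.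
    by apply: is_cvg_nneseries => n _ _; exact: integral_ge0.
  exact: measurable_funTS.
pose mm := isMeasure.Build _ _ _ m m0 mge0 madd.
pose mM : {measure set (plane R) -> \bar R} := HB.pack m mm.
have mfin : fin_num_fun mM.
  move=> A mA; rewrite ge0_fin_numE ?mge0//; apply: le_lt_trans wfin.
  exact: ge0_subset_integral.
pose mF := Measure_isFinite.Build _ _ _ mM mfin.
pose mFM : {finite_measure set (plane R) -> \bar R} := HB.pack m mm mF.
exact: (outer_regular_plane mFM mE e0).
Qed.

End outer_regularity.

Section plane_measure.
Variable R : realType.

Lemma leb2_ball_fin (x : plane R) e : 0 <= e -> (leb2 R (ball x e) < +oo)%E.
Proof.
move=> e0; have -> : ball x e = ball x.1 e `*` ball x.2 e by [].
have mb (a : R) : measurable (ball a e).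
  by apply: open_measurable; exact: ball_open.
rewrite [X in (X < _)%E](_ : _ = (e *+ 2)%:E * (e *+ 2)%:E)%E ?ltry//.
rewrite product_measure1E; [|exact: mb|exact: mb].
by congr (_ * _)%E; exact: lebesgue_measure_ball.
Qed.

Lemma leb2_sigma_finite : sigma_finite setT (leb2 R).
Proof.
exists (fun n => ball (0 : plane R) n%:R).
  apply/esym/seteqP; split=> // x _.
  have [n nx] : exists n, `|x| < n%:R by exists (Num.truncn `|x|).+1; exact: truncnS_gt.
  exists n => //; rewrite plane_ballE !sub0r !normrN.
  by move: nx; rewrite prod_normE gt_max => /andP.
move=> n; split; first exact: measurable_plane_ball.
exact: leb2_ball_fin.
Qed.

(* The library makes [m1 \x m2] canonically sigma-finite only for finite
   factors. *)
Definition leb2_sfm : {sigma_finite_measure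
    set (measurableTypeR R * measurableTypeR R)%type -> \bar R} :=
  HB.pack (leb2 R) (Measure_isSigmaFinite.Build _ _ _ (leb2 R) leb2_sigma_finite).

End plane_measure.

(** * Mollification *)

Section smooth_functions.
Variable R : realType.

(** Derivatives are read off a second-order remainder, both for [flat] at the origin and for
    mollifications, where the remainder of the kernel is uniform. *)
Lemma is_derive_quadratic (V : normedModType R) (f : V -> R) (x v : V) (d C : R) :
  (forall s, `|f (s *: v + x) - f x - s * d| <= C * s ^+ 2) ->
  is_derive x v f d.
Proof.
move=> fC.
have C0 : 0 <= C.
  by have := fC 1; rewrite expr1n mulr1; apply: le_trans.
have cd : h^-1 *: ((f \o shift x) (h *: v) - f x) @[h --> 0^'] --> d.
  apply/cvgrPdist_lt => e e0.
  have C1 : 0 < C + 1 by rewrite ltr_wpDl.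
  exists (e / (C + 1)); first by rewrite /= divr_gt0.
  move=> h /=; rewrite sub0r normrN => he h0.
  have -> : d - h^-1 *: (f (h *: v + x) - f x) =
      - (h^-1 * (f (h *: v + x) - f x - h * d)).
    by rewrite /GRing.scale/=; field.
  rewrite normrN normrM normfV.
  apply: (@le_lt_trans _ _ (`|h|^-1 * (C * h ^+ 2))).
    by rewrite ler_wpM2l// invr_ge0.
  have -> : `|h|^-1 * (C * h ^+ 2) = C * `|h|.
    by rewrite -real_normK ?num_real//; field; rewrite normr_eq0.
  apply: (@le_lt_trans _ _ ((C + 1) * `|h|)).
    by rewrite ler_wpM2r// lerDl.
  by rewrite mulrC -ltr_pdivlMr.
by apply: DeriveDef; [apply/cvg_ex; exists d|exact/cvg_lim].
Qed.

Fixpoint derivable_upto n (f : R -> R) : Prop :=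
  if n is m.+1 then (forall x, derivable f x 1) /\ derivable_upto m (derive1 f)
  else True.

Definition smooth1 f := forall n, derivable_upto n f.

Lemma derivable_uptoS n f : derivable_upto n.+1 f -> derivable_upto n f.
Proof.
elim: n f => // n IH f [df /IH] h; split => //.
Qed.

Lemma derivable_uptoD n f g : derivable_upto n f -> derivable_upto n g ->
  derivable_upto n (fun x => f x + g x).
Proof.
elim: n f g => // n IH f g [df hf] [dg hg]; split.
  by move=> x; apply: derivableD.
rewrite (_ : derive1 _ = (fun x => (derive1 f) x + (derive1 g) x)); first exact: IH.
by apply/funext => x; rewrite !derive1E deriveD.
Qed.

Lemma derivable_uptoM n f g : derivable_upto n f -> derivable_upto n g ->
  derivable_upto n (fun x => f x * g x).
Proof.
elim: n f g => // n IH f g hf hg.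
have [df hf'] := hf; have [dg hg'] := hg.
split; first by move=> x; apply: derivableM.
rewrite (_ : derive1 _ = (fun x => f x * (derive1 g) x + g x * (derive1 f) x)).
  by apply: derivable_uptoD; apply: IH => //; exact: derivable_uptoS.
by apply/funext => x; rewrite !derive1E deriveM.
Qed.

Lemma is_derive_affine (f : R -> R) a b c x : derivable f (a + b * x) 1 ->
  is_derive x 1 (fun t => c * f (a + b * t)) (c * b * derive1 f (a + b * x)).
Proof.
move=> df.
have h1 : is_derive x 1 (fun t : R => a + b * t) b.
  have := is_deriveD (is_derive_cst a x 1) (is_deriveZ b (is_derive_id x 1)).
  by rewrite add0r [b *: 1]mulr1.
have h2 : is_derive (a + b * x) 1 f (derive1 f (a + b * x)).
  by rewrite derive1E; exact: derivableP.
have h3 := @is_derive1_comp _ f (fun t : R => a + b * t) x _ _ h2 h1.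
have -> : (fun t => c * f (a + b * t)) = c *: (f \o (fun t : R => a + b * t)).
  by [].
have := @is_deriveZ _ _ _ _ c x 1 _ h3.
by rewrite -[_ *: _ in X in is_derive _ _ _ X -> _]/(c * _) mulrAC -mulrA.
Qed.

Lemma derivable_upto_affine n f a b c : derivable_upto n f ->
  derivable_upto n (fun t => c * f (a + b * t)).
Proof.
elim: n f c => // n IH f c [df hf]; split.
  by move=> x; have [] := @is_derive_affine f a b c x (df _).
rewrite (_ : derive1 _ = fun x => c * b * derive1 f (a + b * x)); first exact: IH.
apply/funext => x; rewrite derive1E.
by have [_ ->] := @is_derive_affine f a b c x (df _).
Qed.

Lemma smooth1_derive1 f : smooth1 f -> smooth1 (derive1 f).
Proof. by move=> sf n; have [] := sf n.+1. Qed.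

Lemma smooth1_derivable f x : smooth1 f -> derivable f x 1.
Proof. by move=> sf; have [] := sf 1%N. Qed.

Lemma smooth1_is_derive f (x : R) : smooth1 f -> is_derive x 1 f (derive1 f x).
Proof. by move=> sf; rewrite derive1E; apply: derivableP; exact: smooth1_derivable. Qed.

Lemma smooth1_continuous f : smooth1 f -> continuous f.
Proof.
move=> sf x; apply/differentiable_continuous/derivable1_diffP.
exact: smooth1_derivable.
Qed.

(* [exp(-1/t)] is flat at [0]; the polynomial factor in [1/t] makes the family
   closed under differentiation. *)
Definition flat (p : {poly R}) (t : R) : R :=
  if 0 < t then p.[t^-1] * expR (- t^-1) else 0.

(** Coefficient by coefficient, [y ^ i <= i! * exp y]: one term of the exponential series. *)
Lemma horner_le_expR (p : {poly R}) :
  exists2 C, 0 <= C & forall y, 0 < y -> `|p.[y]| <= C * expR y.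
Proof.
exists (\sum_(i < size p) `|p`_i| * i`!%:R).
  by apply: sumr_ge0 => i _; rewrite mulr_ge0.
move=> y y0; rewrite horner_coef mulr_suml.
apply: le_trans (ler_norm_sum _ _ _) _; apply: ler_sum => i _.
rewrite normrM -mulrA ler_wpM2l// normrX gtr0_norm//.
case: (nat_of_ord i) => [|k].
  by rewrite expr0 fact0 mul1r -expR0 ler_expR ltW.
rewrite mulrC -ler_pdivrMr ?ltr0n ?fact_gt0//.
by apply: le_trans (expR_ge1Dxn k (ltW y0)); rewrite lerDr.
Qed.

(** The preceding bound for ['X^2 * p] at the point [1/t]. Second-order flatness is enough for a
    zero derivative at the origin. *)
Lemma flat_quadratic (p : {poly R}) :
  exists C, forall t, `|flat p t| <= C * t ^+ 2.
Proof.
have [C C0 CP] := horner_le_expR ('X^2 * p).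
exists C => t; rewrite /flat; case: ifPn => [t0|_]; last first.
  by rewrite normr0 mulr_ge0// sqr_ge0.
have ti0 : 0 < t^-1 by rewrite invr_gt0.
have := CP _ ti0; rewrite hornerM hornerXn normrM normrX gtr0_norm// => h.
rewrite normrM (gtr0_norm (expR_gt0 _)) expRN ler_pdivrMr ?expR_gt0//.
rewrite -(ler_pM2l (exprn_gt0 2 ti0)) (le_trans h)//.
rewrite le_eqVlt; apply/orP; left; apply/eqP; field.
by rewrite gt_eqF.
Qed.

Lemma is_derive_flat (p : {poly R}) (t : R) :
  is_derive t 1 (flat p) (flat ('X^2 * (p - deriv p)) t).
Proof.
have [t0|t0|->] := ltgtP t 0.
- have -> : flat ('X^2 * (p - deriv p)) t = 0 by rewrite /flat ltNge ltW.
  apply: (@near_eq_is_derive _ _ _ (cst 0)).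
  near=> s; rewrite /flat ifF//; apply/negbTE; rewrite -leNgt ltW//.
  by near: s; exact: lt_nbhsl.
- apply: (@near_eq_is_derive _ _ _ (fun s : R => p.[s^-1] * expR (- s^-1))).
    near=> s; rewrite /flat ifT//.
    by near: s; exact: lt_nbhsr.
  have dV : is_derive t 1 (fun s : R => s^-1) (- t ^- 2).
    have := @is_deriveV R id t 1 1; rewrite /GRing.scale/= mulr1; apply.
    by rewrite gt_eqF.
  have d1 : is_derive t 1 (fun s : R => p.[s^-1]) ((deriv p).[t^-1] * - t ^- 2).
    exact: (@is_derive1_comp R (horner p) (fun s => s^-1)).
  have dNV : is_derive t 1 (fun s : R => - s^-1) (t ^- 2).
    by rewrite -[t ^- 2]opprK; exact: (@is_deriveN _ _ _ (fun s : R => s^-1)).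
  have d2 : is_derive t 1 (fun s : R => expR (- s^-1))
      (expR (- t^-1) * t ^- 2).
    exact: (@is_derive1_comp R expR (fun s => - s^-1)).
  have := is_deriveM d1 d2; congr (is_derive _ _ _ _).
  rewrite /flat t0 /GRing.scale/= !hornerE ?hornerXn ?exprVn.
  by rewrite /=; ring.
- have [C CP] := flat_quadratic p.
  have f0 q : flat q 0 = 0 by rewrite /flat ltxx.
  apply: (@is_derive_quadratic _ _ _ _ _ C) => s.
  rewrite !f0 !(mulr0, subr0, addr0) /GRing.scale/= mulr1; exact: CP.
Unshelve. all: by end_near. Qed.

Lemma smooth1_flat (p : {poly R}) : smooth1 (flat p).
Proof.
move=> n; elim: n p => // n IH p; split.
  by move=> x; have [] := is_derive_flat p x.
rewrite (_ : derive1 (flat p) = flat ('X^2 * (p - deriv p))); first exact: IH.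
by apply/funext => x; rewrite derive1E; have [_ ->] := is_derive_flat p x.
Qed.

Definition mollifier (e : R) (eta : R -> R) := [/\ smooth1 eta,
  forall t, 0 <= eta t, forall t, eta (- t) = eta t,
  forall t, e <= `|t| -> eta t = 0 &
  (\int[lebesgue_measure]_t (eta t)%:E = 1)%E].

Lemma mollifier_exists (e : R) : 0 < e -> exists eta, mollifier e eta.
Proof.
move=> e0.
(* Two one-sided flat functions are multiplied into an even bump that vanishes outside [[-e, e]]. *)
pose b t := flat 1 (e + 1 * t) * flat 1 (e + (-1) * t).
have flat1 t : flat 1 t = if 0 < t then expR (- t^-1) else 0.
  by rewrite /flat hornerC mul1r.
have flat_ge0 t : 0 <= flat 1 t by rewrite flat1; case: ifP => // _; exact: expR_ge0.
have flat_le (s t : R) : s <= t -> flat 1 s <= flat 1 t.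
  move=> st; rewrite !flat1; case: ifPn => [s0|_].
    rewrite (lt_le_trans s0 st) ler_expR lerN2 lef_pV2// posrE//.
    exact: lt_le_trans st.
  by case: ifP => // _; exact: expR_ge0.
have flat_le1 t : flat 1 t <= 1.
  rewrite flat1; case: ifP => // t0.
  by rewrite -expR0 ler_expR oppr_le0 invr_ge0 ltW.
have bs : smooth1 b.
  move=> n; rewrite /b; apply: derivable_uptoM.
    have := @derivable_upto_affine n (flat 1) e 1 1 (smooth1_flat _ _).
    by congr derivable_upto; apply/funext => t; rewrite mul1r.
  have := @derivable_upto_affine n (flat 1) e (-1) 1 (smooth1_flat _ _).
  by congr derivable_upto; apply/funext => t; rewrite mul1r.
have b0 t : 0 <= b t by rewrite /b mulr_ge0.
have bN t : b (- t) = b t.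
  by rewrite /b !mul1r !mulN1r opprK mulrC.
have bsupp (t : R) : e <= `|t| -> b t = 0.
  rewrite /b !flat1 mul1r mulN1r ler_normr => /orP[et|et].
    by rewrite [X in _ * X]ifF ?mulr0//; apply/negbTE; rewrite -leNgt; lra.
  by rewrite ifF ?mul0r//; apply/negbTE; rewrite -leNgt; lra.
have mb : measurable_fun setT b.
  by apply: continuous_measurable_fun; exact: smooth1_continuous.
pose I := (\int[lebesgue_measure]_t (b t)%:E)%E.
have IE : I = (\int[lebesgue_measure]_(t in `[(- e)%R, e%R]) (b t)%:E)%E.
  rewrite /I [RHS]integral_mkcond; apply: eq_integral => t _.
  rewrite patchE; case: ifPn => // /negP tN.
  rewrite bsupp// leNgt; apply/negP => te; apply: tN; rewrite inE/=.
  by rewrite in_itv/= -ler_norml ltW.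
have Ify : (I < +oo)%E.
  rewrite IE; apply: (@le_lt_trans _ _
    (\int[lebesgue_measure]_(t in `[(- e)%R, e%R]) (cst 1 t))%E).
    apply: ge0_le_integral => //.
    - by move=> t _; rewrite lee_fin.
    - by apply/measurable_EFinP; exact: measurable_funTS.
    - by move=> t _; rewrite lee_fin mulr_ile1.
  rewrite integral_cst//= mul1e lebesgue_measure_itv/=.
  by case: ifP => // _; rewrite ltry.
(* [flat 1] is nondecreasing, so [b >= c] on [[0, e / 2]] and the normalising constant is not
   zero. *)
have I0 : (0 < I)%E.
  pose c := flat 1 e * flat 1 (e / 2).
  have c0 : 0 < c by rewrite /c !flat1 e0 divr_gt0// mulr_gt0 ?expR_gt0.
  apply: (@lt_le_trans _ _ (\int[lebesgue_measure]_(t in `[0%R, (e / 2)%R]) (cst c%:E t))%E).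
    rewrite integral_cst//= lebesgue_measure_itv/= lte_fin divr_gt0//.
    by rewrite oppr0 addr0 mule_gt0// lte_fin divr_gt0.
  apply: (@le_trans _ _ (\int[lebesgue_measure]_(t in `[0%R, (e / 2)%R]) (b t)%:E)%E).
    apply: ge0_le_integral => //.
    - by move=> t _; rewrite lee_fin ltW.
    - by apply/measurable_EFinP; exact: measurable_funTS.
    - move=> t /=; rewrite in_itv/= lee_fin /b => /andP[t0 te].
      by apply: ler_pM => //; apply: flat_le; lra.
  apply: ge0_subset_integral => //.
    by apply/measurable_EFinP.
  by move=> t _; rewrite lee_fin.
have [r Ir] : exists r, I = r%:E.
  by exists (fine I); rewrite fineK// ge0_fin_numE// ltW.
have r0 : 0 < r by rewrite -lte_fin -Ir.
exists (fun t => r^-1 * b t); split.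
- move=> n; have := @derivable_upto_affine n b 0 1 r^-1 (bs n).
  by congr derivable_upto; apply/funext => t; rewrite add0r mul1r.
- by move=> t; rewrite mulr_ge0// invr_ge0 ltW.
- by move=> t; rewrite bN.
- by move=> t /bsupp ->; rewrite mulr0.
- under eq_integral do rewrite EFinM.
  rewrite ge0_integralZl//.
  + by rewrite -/I Ir -EFinM mulVf// gt_eqF.
  + exact/measurable_EFinP.
  + by move=> t _; rewrite lee_fin.
  + by rewrite lee_fin invr_ge0 ltW.
Qed.

End smooth_functions.

Section mollifier_bounds.
Variable R : realType.

Lemma smooth1_lipschitz (f : R -> R) C : smooth1 f ->
  (forall t, `|derive1 f t| <= C) -> forall s t, `|f s - f t| <= C * `|s - t|.
Proof.
move=> sf fC.
have main s t : s <= t -> `|f s - f t| <= C * `|s - t|.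
  move=> st; rewrite distrC (distrC s).
  have [||c _ ->] := @MVT_segment R f (derive1 f) s t st.
  - by move=> x _; exact: smooth1_is_derive.
  - by apply: continuous_subspaceT; exact: smooth1_continuous.
  - by rewrite normrM ler_wpM2r.
move=> s t; have [st|/ltW ts] := leP s t; first exact: main.
by rewrite distrC (distrC s); exact: main.
Qed.

(** One mean value theorem produces the increment [f' c * s] with [|c - t| <= |s|]; the Lipschitz
    bound on [f'] then compares [f' c] with [f' t]. *)
Lemma smooth1_quadratic (f : R -> R) C : smooth1 f ->
  (forall t, `|derive1 (derive1 f) t| <= C) ->
  forall t s, `|f (t + s) - f t - derive1 f t * s| <= C * s ^+ 2.
Proof.
move=> sf fC t s.
have C0 : 0 <= C by exact: le_trans (fC 0).
have lip := smooth1_lipschitz (smooth1_derive1 sf) fC.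
have cf a b : {within `[a, b], continuous f}.
  by apply: continuous_subspaceT; exact: smooth1_continuous.
have df (x : R) : is_derive x 1 f (derive1 f x) by exact: smooth1_is_derive.
have [c [cs ->]] : exists c, `|c - t| <= `|s| /\ f (t + s) - f t = derive1 f c * s.
  have [s0|/ltW s0] := leP 0 s.
    have ts : t <= t + s by lra.
    have [c ct E] := @MVT_segment R f (derive1 f) t (t + s) ts (fun x _ => df x) (cf _ _).
    exists c; split; last by rewrite E; ring.
    by move: ct; rewrite in_itv/= => /andP[? ?]; rewrite !ger0_norm; lra.
  have ts : t + s <= t by lra.
  have [c ct E] := @MVT_segment R f (derive1 f) (t + s) t ts (fun x _ => df x) (cf _ _).
  exists c; split; last by rewrite -opprB E; ring.
  by move: ct; rewrite in_itv/= => /andP[? ?]; rewrite !ler0_norm; lra.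
rewrite -mulrBl normrM -real_normK ?num_real// expr2 mulrA ler_wpM2r//.
by apply: le_trans (lip _ _) _; rewrite ler_wpM2l.
Qed.

Lemma continuous_compact_support_bounded (f : R -> R) (e : R) : continuous f ->
  (forall t, e < `|t| -> f t = 0) -> exists C, forall t, `|f t| <= C.
Proof.
move=> cf f0.
have : compact (f @` `[- e, e]).
  apply: continuous_compact; last exact: segment_compact.
  exact: continuous_subspaceT.
move=> /compact_bounded[M [_ MP]]; exists `|M + 1|%R => t.
have [te|et] := leP `|t| e; last by rewrite f0// normr0.
apply: (MP `|M + 1|).
  by apply: lt_le_trans (ler_norm _); rewrite ltrDl.
by exists t => //=; rewrite in_itv/= -ler_norml.
Qed.

Lemma derive1_support (f : R -> R) (e : R) :
  (forall t, e < `|t| -> f t = 0) -> forall t, e < `|t| -> derive1 f t = 0.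
Proof.
move=> f0 t et; rewrite derive1E (@near_eq_derive _ _ _ f (cst 0)) ?derive_cst//.
near=> s; apply: f0; near: s.
have : `|s| @[s --> t] --> `|t| by exact: norm_continuous.
by move/cvgr_gt; apply.
Unshelve. all: by end_near. Qed.

Lemma mollifier_bounded e (eta : R -> R) : mollifier e eta ->
  exists C, [/\ 0 <= C, forall t, `|eta t| <= C, forall t, `|derive1 eta t| <= C &
   forall t, `|derive1 (derive1 eta) t| <= C].
Proof.
move=> [seta _ _ eta0 _].
have e0 t : e < `|t| -> eta t = 0 by move/ltW; exact: eta0.
have e1 := derive1_support e0.
have e2 := derive1_support e1.
have s1 := smooth1_derive1 seta.
have s2 := smooth1_derive1 s1.
have [C0 H0] := continuous_compact_support_bounded (smooth1_continuous seta) e0.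
have [C1 H1] := continuous_compact_support_bounded (smooth1_continuous s1) e1.
have [C2 H2] := continuous_compact_support_bounded (smooth1_continuous s2) e2.
exists (`|C0| + `|C1| + `|C2|); split; first by rewrite !addr_ge0.
- move=> t; apply: le_trans (H0 t) _; apply: le_trans (ler_norm _) _.
  by rewrite -addrA lerDl addr_ge0.
- move=> t; apply: le_trans (H1 t) _; apply: le_trans (ler_norm _) _.
  by rewrite addrAC lerDr addr_ge0.
- move=> t; apply: le_trans (H2 t) _; apply: le_trans (ler_norm _) _.
  by rewrite lerDr addr_ge0.
Qed.

End mollifier_bounds.

(** * The planar kernel and its partial derivatives *)

Section kernel.
Variable R : realType.
Implicit Types (x y : plane R) (eta : R -> R).

Lemma is_derive_line (V : normedModType R) (f : V -> R) (x v : V) (d : R) :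
  is_derive (0 : R) 1 (fun h : R => f (h *: v + x)) d -> is_derive x v f d.
Proof.
move=> [df <-].
have E : (fun h : R => h^-1 *: ((f \o shift x) (h *: v) - f x)) =
    (fun h : R => h^-1 *: (((fun k : R => f (k *: v + x)) \o shift 0) (h *: 1)
                           - f (0 *: v + x))).
  by apply/funext => h /=; rewrite addr0 scale0r add0r [h *: 1]mulr1.
by apply: DeriveDef; [rewrite /derivable E|rewrite /derive E].
Qed.

Lemma is_derive_tensor (f g : R -> R) (j : 'I_2) x : smooth1 f -> smooth1 g ->
  is_derive x (basis2 R j) (fun y => f y.1 * g y.2)
    (if j == 0 then derive1 f x.1 * g x.2 else f x.1 * derive1 g x.2).
Proof.
move=> sf sg; apply: is_derive_line.
rewrite /basis2; case: ifP => _ /=.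
  have -> : (fun h : R => f (h * 1 + x.1) * g (h * 0 + x.2)) =
            (fun h => g x.2 * f (x.1 + 1 * h)).
    by apply/funext => h; rewrite mulr1 mulr0 add0r mul1r mulrC addrC.
  have := @is_derive_affine R f x.1 1 (g x.2) 0 (smooth1_derivable sf).
  by rewrite mulr0 addr0 mulr1 mulrC.
have -> : (fun h : R => f (h * 0 + x.1) * g (h * 1 + x.2)) =
          (fun h => f x.1 * g (x.2 + 1 * h)).
  by apply/funext => h; rewrite mulr1 mulr0 add0r mul1r (addrC h).
have := @is_derive_affine R g x.2 1 (f x.1) 0 (smooth1_derivable sg).
by rewrite mulr0 addr0 mulr1.
Qed.

Lemma differentiable_fst x : differentiable (fst : plane R -> R) x.
Proof.
by apply: (@linear_differentiable R _ _ (fst : {linear plane R -> R})) => y;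
  exact: cvg_fst.
Qed.

Lemma differentiable_snd x : differentiable (snd : plane R -> R) x.
Proof.
by apply: (@linear_differentiable R _ _ (snd : {linear plane R -> R})) => y;
  exact: cvg_snd.
Qed.

Lemma differentiable_tensor (f g : R -> R) x : smooth1 f -> smooth1 g ->
  differentiable (fun y : plane R => f y.1 * g y.2) x.
Proof.
move=> sf sg.
apply: (@differentiableM _ _ (f \o fst) (g \o snd)).
  apply: differentiable_comp; first exact: differentiable_fst.
  by apply/derivable1_diffP; exact: smooth1_derivable.
apply: differentiable_comp; first exact: differentiable_snd.
by apply/derivable1_diffP; exact: smooth1_derivable.
Qed.

(** Frechet counterpart of [is_derive_quadratic]: one remainder estimate, integrated against [g],
    replaces differentiation under the integral sign. *)
Lemma differentiable_quadratic (f : plane R -> R) x a b C :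
  (forall h : plane R,
     `|f (h + x) - f x - (a * h.1 + b * h.2)| <= C * (`|h.1| + `|h.2|) ^+ 2) ->
  differentiable f x.
Proof.
move=> fC.
pose L (h : plane R) : R := a * h.1 + b * h.2.
have Llin : linear L.
  by move=> k u v; rewrite /L /= /GRing.scale/=; ring.
pose LM := GRing.isLinear.Build _ _ _ _ _ Llin.
pose l : {linear plane R -> R} := HB.pack L LM.
have cl : continuous l.
  move=> y; apply: cvgD; apply: cvgM; do ?exact: cvg_cst.
    exact: cvg_fst.
  exact: cvg_snd.
have C0 : 0 <= C.
  have := le_trans (normr_ge0 _) (fC (1, 0)).
  by rewrite normr1 normr0 addr0 expr1n mulr1.
have fl (e : R) : 0 < e ->
    \forall h \near (0 : plane R), `|f (h + x) - f x - L h| <= e * `|h|.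
  move=> /posnumP[{}e]; near=> h.
  apply: le_trans (fC h) _.
  have h1 : `|h.1| <= `|h| by rewrite prod_normE le_max lexx.
  have h2 : `|h.2| <= `|h| by rewrite prod_normE le_max lexx orbT.
  have hC : `|h| * (4 * C) <= e%:num.
    near: h; apply/nbhs_ballP.
    have c0 : 0 < 4 * C + 1 by lra.
    exists (e%:num / (4 * C + 1)) => /=; first by rewrite divr_gt0.
    move=> z; rewrite plane_ballE !sub0r !normrN => -[z1 z2].
    have ze : `|z| < e%:num / (4 * C + 1) by rewrite prod_normE gt_max z1 z2.
    apply: (@le_trans _ _ (`|z| * (4 * C + 1))).
      by rewrite ler_wpM2l// lerDl.
    by rewrite -ler_pdivlMr// ltW.
  apply: (@le_trans _ _ (`|h| * (4 * C) * `|h|)); last by rewrite ler_wpM2r.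
  have -> : `|h| * (4 * C) * `|h| = C * (`|h| + `|h|) ^+ 2 by ring.
  by rewrite ler_wpM2l// lerXn2r ?nnegrE ?addr_ge0// lerD.
by apply/diff_locallyP; rewrite (@diff_unique R (plane R) R f l x cl); [split=> //|];
  apply: (iffRL (@eqaddoP R (plane R) R (plane R) _ _ _ _)) => e e0;
  apply: filterS (fl e e0) => h; congr (`|_| <= _);
  rewrite -addrA -opprD.
Unshelve. all: by end_near. Qed.

Lemma smooth_tensor (f g : R -> R) : smooth1 f -> smooth1 g ->
  smooth (fun y : plane R => f y.1 * g y.2).
Proof.
move=> sf sg s x.
suff [a [b [sa sb ->]]] : exists a b, [/\ smooth1 a, smooth1 b &
    foldr (@partial R) (fun y => f y.1 * g y.2) s = (fun y => a y.1 * b y.2)].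
  exact: differentiable_tensor.
elim: s => [|j s [a [b [sa sb IH]]]] /=; first by exists f, g.
rewrite IH; exists (if j == 0 then derive1 a else a).
exists (if j == 0 then b else derive1 b); split.
- by case: ifP => // _; exact: smooth1_derive1.
- by case: ifP => // _; exact: smooth1_derive1.
- apply/funext => y; rewrite /partial.
  have [_ ->] := is_derive_tensor j y sa sb.
  by case: ifP.
Qed.

(** A tensor product fits the squares that are the balls of [plane R], and lets integrals be treated
    one variable at a time. *)
Definition kern eta x y : R := eta (y.1 - x.1) * eta (y.2 - x.2).

(** The derivative in the integration variable [y]. The derivative in the centre [x] is its
    opposite, whence the minus sign in [dmoll]. *)
Definition dkern eta (j : 'I_2) x y : R :=
  if j == 0 then derive1 eta (y.1 - x.1) * eta (y.2 - x.2)
  else eta (y.1 - x.1) * derive1 eta (y.2 - x.2).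

Lemma smooth1_shift eta (a : R) : smooth1 eta -> smooth1 (fun t => eta (t - a)).
Proof.
move=> se n; have := @derivable_upto_affine R n eta (- a) 1 1 (se n).
by congr derivable_upto; apply/funext => t; rewrite !mul1r addrC.
Qed.

Lemma derive1_shift eta (a : R) : smooth1 eta ->
  derive1 (fun t => eta (t - a)) = (fun t => derive1 eta (t - a)).
Proof.
move=> se; apply/funext => t.
have := @is_derive_affine R eta (- a) 1 1 t (smooth1_derivable se).
rewrite mulr1 !mul1r (_ : (fun _ => _) = (fun t => eta (t - a))).
  by rewrite (addrC (- a)) => H; rewrite [LHS]derive1E; case: H.
by apply/funext => s; rewrite !mul1r addrC.
Qed.

Lemma partial_kern eta j x y : smooth1 eta ->
  partial j (kern eta x) y = dkern eta j x y.
Proof.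
move=> se; rewrite /partial.
have [_ ->] := is_derive_tensor j y (smooth1_shift x.1 se) (smooth1_shift x.2 se).
by rewrite !derive1_shift.
Qed.

Lemma kern_support e eta x y : mollifier e eta -> ~ ball x e y -> kern eta x y = 0.
Proof.
move=> [_ _ _ e0 _]; rewrite plane_ballE => /not_andP[] /negP; rewrite -leNgt.
  by move=> h; rewrite /kern e0 ?mul0r// distrC.
by move=> h; rewrite /kern [eta (y.2 - _)]e0 ?mulr0// distrC.
Qed.

Lemma kern_ge0 e eta x y : mollifier e eta -> 0 <= kern eta x y.
Proof. by move=> [_ h _ _ _]; rewrite mulr_ge0. Qed.

Lemma kernC e eta x y : mollifier e eta -> kern eta x y = kern eta y x.
Proof.
by move=> [_ _ h _ _]; rewrite /kern -opprB h -(opprB x.2) h.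
Qed.

Lemma dkern_support e eta j x y : mollifier e eta ->
  ~ (`|x.1 - y.1| <= e /\ `|x.2 - y.2| <= e) -> dkern eta j x y = 0.
Proof.
move=> [_ _ _ e0 _].
have e0' t : e < `|t| -> eta t = 0 by move/ltW; exact: e0.
have e1 := derive1_support e0'.
rewrite /dkern => /not_andP[] /negP; rewrite -ltNge distrC => h.
  by rewrite [eta (y.1 - _)]e0' ?[derive1 eta (y.1 - _)]e1// !mul0r if_same.
by rewrite [eta (y.2 - _)]e0'// [derive1 eta (y.2 - _)]e1// !mulr0 if_same.
Qed.

Lemma compact_square x (e : R) :
  compact [set y : plane R | `|x.1 - y.1| <= e /\ `|x.2 - y.2| <= e].
Proof.
have -> : [set y : plane R | `|x.1 - y.1| <= e /\ `|x.2 - y.2| <= e] =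
    `[x.1 - e, x.1 + e]%classic `*` `[x.2 - e, x.2 + e]%classic.
  by apply/seteqP; split => y /=; rewrite !in_itv/= -!ler_distlC.
by apply: compact_setX; exact: segment_compact.
Qed.

(** The support lies in the closed square of radius [e] about [x]; the strict inequality [e < r]
    puts this square inside the open ball that [margin] provides. *)
Lemma test_function_kern e eta x (Omega : set (plane R)) r : mollifier e eta ->
  e < r -> margin Omega r x -> test_function Omega (kern eta x).
Proof.
move=> m er xO; have [se _ _ _ _] := m.
set S := [set y : plane R | `|x.1 - y.1| <= e /\ `|x.2 - y.2| <= e].
have cS : compact S by exact: compact_square.
have clS : closed S.
  apply: compact_closed => //; exact: norm_hausdorff.
have KS : closure [set y | kern eta x y != 0] `<=` S.
  rewrite [X in _ `<=` X]((closure_id S).1 clS); apply: closure_subset => y /= /eqP k0.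
  apply: contrapT => nS; apply: k0; apply: (kern_support m) => -[h1 h2].
  by apply: nS; split; apply: ltW.
split.
- exact: (smooth_tensor (smooth1_shift x.1 se) (smooth1_shift x.2 se)).
- apply: (subclosed_compact _ cS) => //; exact: closed_closure.
- apply: (subset_trans KS) => y [y1 y2]; apply: xO.
  by rewrite plane_ballE; split; apply: le_lt_trans er.
Qed.

End kernel.

Section integrable_mul.
Context d (T : measurableType d) (R : realType).
Variable mu : {measure set T -> \bar R}.

Lemma integrable_mul_bounded (D : set T) (g k : T -> R) (C : R) :
  measurable D -> mu.-integrable D (EFin \o g) -> measurable_fun D k ->
  (forall x, D x -> `|k x| <= C) ->
  mu.-integrable D (EFin \o (fun x => g x * k x)).
Proof.
move=> mD ig mk kC; have mg := measurable_int _ ig.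
apply: (@le_integrable _ _ _ _ _ _ _ (fun x => C%:E * (g x)%:E)%E) => //.
- by apply/measurable_EFinP; apply: measurable_funM => //; exact/measurable_EFinP.
- move=> x Dx /=; rewrite lee_fin !normrM mulrC ler_wpM2r//.
  exact: le_trans (kC x Dx) (ler_norm _).
- exact: integrableZl.
Qed.

End integrable_mul.

Section mollification.
Variable R : realType.
Implicit Types (x y : plane R) (eta : R -> R) (g : plane R -> R).
Local Notation mu := (leb2 R).

Lemma measurable_kern eta : smooth1 eta ->
  measurable_fun setT (fun z : plane R * plane R => kern eta z.1 z.2).
Proof.
move=> se; have me : measurable_fun setT eta.
  by apply: continuous_measurable_fun; exact: smooth1_continuous.
apply: measurable_funM; apply: measurableT_comp => //; apply: measurable_funB.
- exact: measurableT_comp measurable_fst measurable_snd.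
- exact: measurableT_comp measurable_fst measurable_fst.
- exact: measurableT_comp measurable_snd measurable_snd.
- exact: measurableT_comp measurable_snd measurable_fst.
Qed.

Lemma measurable_tensor (f k : R -> R) x : measurable_fun setT f ->
  measurable_fun setT k ->
  measurable_fun setT (fun y : plane R => f (y.1 - x.1) * k (y.2 - x.2)).
Proof.
move=> mf mk; apply: measurable_funM; apply: measurableT_comp => //;
  by apply: measurable_funB.
Qed.

Lemma measurable_kernr eta x : smooth1 eta -> measurable_fun setT (kern eta x).
Proof.
move=> se; apply: measurable_tensor;
  by apply: continuous_measurable_fun; exact: smooth1_continuous.
Qed.

Lemma measurable_dkern eta j x : smooth1 eta ->
  measurable_fun setT (dkern eta j x).
Proof.
move=> se; rewrite /dkern; case: (j == 0); apply: measurable_tensor;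
  apply: continuous_measurable_fun; apply: smooth1_continuous => //;
  exact: smooth1_derive1.
Qed.

Lemma integral_shift eta (a : R) : continuous eta -> (forall t, 0 <= eta t) ->
  (\int[lebesgue_measure]_t (eta (t - a))%:E =
   \int[lebesgue_measure]_t (eta t)%:E)%E.
Proof.
move=> ce e0.
have dF (t : R) : is_derive t 1 (fun t : R => t - a) 1.
  by have := is_deriveB (is_derive_id t 1) (is_derive_cst a t 1); rewrite subr0.
have F1 : derive1 (fun t : R => t - a) = cst 1.
  by apply/funext => t; rewrite derive1E; case: (dF t).
rewrite (@increasing_ge0_integration_by_substitutionT R (fun t => t - a) eta)//.
- rewrite F1; apply: eq_integral => t _ /=; congr EFin.
  by rewrite fctE /= mulr1.
- by move=> s t; rewrite ltrD2r.
- by rewrite F1; exact: cst_continuous.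
- by rewrite F1; exact: is_cvg_cst.
- by rewrite F1; exact: is_cvg_cst.
- by apply/cvgrNyPle => M; near=> t; rewrite lerBlDr; near: t;
   apply: nbhs_ninfty_le; rewrite num_real.
- by apply/cvgryPge => M; near=> t; rewrite lerBrDr; near: t;
   apply: nbhs_pinfty_ge; rewrite num_real.
Unshelve. all: by end_near. Qed.

Lemma integral_kern e eta x : mollifier e eta ->
  (\int[mu]_y (kern eta x y)%:E = 1)%E.
Proof.
move=> [se e0 _ _ e1].
have ce := smooth1_continuous se.
have me : measurable_fun setT eta by exact: continuous_measurable_fun.
have mes (a : R) : measurable_fun setT (fun t : R => (eta (t - a))%:E).
  by apply/measurable_EFinP; apply: measurableT_comp => //; apply: measurable_funB.
rewrite fubini_tonelli1; first last.
- by move=> y; rewrite lee_fin mulr_ge0.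
- by apply/measurable_EFinP; exact: measurable_kernr.
rewrite -[RHS]e1 -(integral_shift x.1 ce e0); apply: eq_integral => t _.
rewrite /fubini_F /kern /=; under eq_integral do rewrite EFinM.
rewrite ge0_integralZl ?lee_fin//; last by move=> s _; rewrite lee_fin.
by rewrite integral_shift// e1 mule1.
exact: mes.
Qed.

Definition moll eta g x : R := \int[mu]_y (g y * kern eta x y).

Definition dmoll eta j g x : R := - \int[mu]_y (g y * dkern eta j x y).

(** If a number bounds [eta] and its first two derivatives, its square serves at once for the
    kernel, its gradient, its second-order remainder and its Lipschitz constant. *)
Lemma kern_bounded e eta : mollifier e eta -> exists C, [/\ 0 <= C,
  forall x y, `|kern eta x y| <= C,
  forall j x y, `|dkern eta j x y| <= C,
  forall x h y, `|kern eta (h + x) y - kern eta x y +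
      h.1 * dkern eta 0 x y + h.2 * dkern eta 1 x y|
    <= C * (`|h.1| + `|h.2|) ^+ 2 &
  forall j x h y, `|dkern eta j (h + x) y - dkern eta j x y|
    <= C * (`|h.1| + `|h.2|)].
Proof.
move=> m; have [se _ _ _ _] := m.
have [C [C0 H0 H1 H2]] := mollifier_bounded m.
have L0 := smooth1_lipschitz se H1.
have L1 := smooth1_lipschitz (smooth1_derive1 se) H2.
have Q := smooth1_quadratic se H2.
have sh (x y h : R) : y - (h + x) = (y - x) + - h by rewrite opprD addrCA addrC.
exists (C ^+ 2); split; first exact: sqr_ge0.
- by move=> x y; rewrite /kern normrM expr2 ler_pM.
- by move=> j x y; rewrite /dkern expr2; case: ifP => _; rewrite normrM ler_pM.
- move=> x h y; rewrite /kern /dkern /= !sh.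
  set s := y.1 - x.1; set t := y.2 - x.2.
  have := Q s (- h.1); have := Q t (- h.2).
  rewrite !sqrrN !mulrN !opprK => Q2 Q1.
  set a' := eta (s - h.1); set b' := eta (t - h.2).
  set al := derive1 eta s; set be := derive1 eta t.
  (* Remainder of a product: the remainder of each factor, plus a cross term of size
     [|h.1| * |h.2|]. The three bounds fit into the square of [|h.1| + |h.2|]. *)
  rewrite [X in `|X|](_ : _ = (a' - eta s + al * h.1) * b' +
    eta s * (b' - eta t + be * h.2) - al * h.1 * (b' - eta t)); last by ring.
  have l : `|b' - eta t| <= C * `|h.2|.
    by apply: le_trans (L0 _ _) _; rewrite addrAC subrr add0r normrN.
  have n1 : `|(a' - eta s + al * h.1) * b'| <= C * h.1 ^+ 2 * C.
    by rewrite normrM ler_pM// H0.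
  have n2 : `|eta s * (b' - eta t + be * h.2)| <= C * (C * h.2 ^+ 2).
    by rewrite normrM ler_pM// H0.
  have n3 : `|al * h.1 * (b' - eta t)| <= C * `|h.1| * (C * `|h.2|).
    by rewrite !normrM ler_pM// ?mulr_ge0// ler_wpM2r// H1.
  apply: le_trans (ler_normB _ _) _; apply: le_trans (lerD (ler_normD _ _) (lexx _)) _.
  apply: le_trans (lerD (lerD n1 n2) n3) _.
  rewrite -(real_normK (num_real h.1)) -(real_normK (num_real h.2)).
  have h12 : 0 <= C ^+ 2 * (`|h.1| * `|h.2|) by rewrite !mulr_ge0.
  by rewrite -subr_ge0 (le_trans h12)// le_eqVlt; apply/orP; left; apply/eqP; ring.
- move=> j x h y; rewrite /dkern /= !sh.
  have aux (f k : R -> R) (s t : R) : (forall t, `|k t| <= C) -> (forall t, `|f t| <= C) ->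
      (forall s t, `|f s - f t| <= C * `|s - t|) ->
      (forall s t, `|k s - k t| <= C * `|s - t|) ->
      `|f (s - h.1) * k (t - h.2) - f s * k t| <= C ^+ 2 * (`|h.1| + `|h.2|).
    move=> kC fC fL kL.
    have -> : f (s - h.1) * k (t - h.2) - f s * k t =
      (f (s - h.1) - f s) * k (t - h.2) + f s * (k (t - h.2) - k t) by ring.
    have l1 : `|f (s - h.1) - f s| <= C * `|h.1|.
      by apply: le_trans (fL _ _) _; rewrite addrAC subrr add0r normrN.
    have l2 : `|k (t - h.2) - k t| <= C * `|h.2|.
      by apply: le_trans (kL _ _) _; rewrite addrAC subrr add0r normrN.
    apply: le_trans (ler_normD _ _) _; rewrite !normrM.
    have -> : C ^+ 2 * (`|h.1| + `|h.2|) = C * `|h.1| * C + C * (C * `|h.2|) by ring.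
    by apply: lerD; apply: ler_pM.
  by case: ifP => _; apply: aux.
Qed.

Section integrable_moll.
Variables (e : R) (eta : R -> R) (m : mollifier e eta).
Let se : smooth1 eta. Proof. by case: m. Qed.

Lemma integrable_mul_kern g x : mu.-integrable setT (EFin \o g) ->
  mu.-integrable setT (EFin \o (fun y => g y * kern eta x y)).
Proof.
move=> ig; have [C [_ H _ _ _]] := kern_bounded m.
by apply: (integrable_mul_bounded (C := C)) => //; exact: measurable_kernr.
Qed.

Lemma integrable_mul_dkern g j x : mu.-integrable setT (EFin \o g) ->
  mu.-integrable setT (EFin \o (fun y => g y * dkern eta j x y)).
Proof.
move=> ig; have [C [_ _ H _ _]] := kern_bounded m.
by apply: (integrable_mul_bounded (C := C)) => //; exact: measurable_dkern.
Qed.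

Lemma EFin_moll g x : mu.-integrable setT (EFin \o g) ->
  (moll eta g x)%:E = (\int[mu]_y (g y * kern eta x y)%:E)%E.
Proof.
move=> ig; rewrite /moll /Rintegral fineK//.
exact: (integrable_fin_num measurableT (integrable_mul_kern x ig)).
Qed.

(** The kernel estimates are uniform in [y], so integrating them against [g] costs only the [L^1]
    norm of [g]. *)
Lemma moll_quadratic g : mu.-integrable setT (EFin \o g) -> exists C, 0 <= C /\
  (forall x h, `|moll eta g (h + x) - moll eta g x -
     (dmoll eta 0 g x * h.1 + dmoll eta 1 g x * h.2)|
     <= C * (`|h.1| + `|h.2|) ^+ 2) /\
  (forall j x h, `|dmoll eta j g (h + x) - dmoll eta j g x|
     <= C * (`|h.1| + `|h.2|)).
Proof.
move=> ig; have [C [C0 HK HD HQ HL]] := kern_bounded m.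
have iN : mu.-integrable setT (EFin \o (fun y => `|g y|)) by exact: integrable_norm.
pose N := \int[mu]_y `|g y|.
have N0 : 0 <= N by apply: Rintegral_ge0.
have bnd (k : plane R -> R) B : measurable_fun setT k ->
    (forall y, `|k y| <= B) -> `|\int[mu]_y (g y * k y)| <= B * N.
  move=> mk kB; have ik : mu.-integrable setT (EFin \o (fun y => g y * k y)).
    by apply: (integrable_mul_bounded (C := B)).
  apply: le_trans (le_normr_Rintegral measurableT ik) _.
  rewrite /N -RintegralZl//; apply: le_Rintegral => //.
  - exact: integrable_norm.
  - exact: (integrableZl measurableT B iN).
  - by move=> y _; rewrite normrM mulrC ler_wpM2r.
exists (C * N); split; first exact: mulr_ge0.
split.
- move=> x h.
  have i1 := integrable_mul_kern (h + x) ig.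
  have i2 := integrable_mul_kern x ig.
  have i3 := integrable_mul_dkern 0 x ig.
  have i4 := integrable_mul_dkern 1 x ig.
  have i12 : mu.-integrable setT
      (EFin \o (fun y => g y * kern eta (h + x) y - g y * kern eta x y)).
    exact: (integrableB measurableT i1 i2).
  have i3' : mu.-integrable setT (EFin \o (fun y => h.1 * (g y * dkern eta 0 x y))).
    exact: (integrableZl measurableT h.1 i3).
  have i4' : mu.-integrable setT (EFin \o (fun y => h.2 * (g y * dkern eta 1 x y))).
    exact: (integrableZl measurableT h.2 i4).
  have i123 : mu.-integrable setT
      (EFin \o (fun y => g y * kern eta (h + x) y - g y * kern eta x y +
         h.1 * (g y * dkern eta 0 x y))).
    exact: (integrableD measurableT i12 i3').
  rewrite [X in `|X|](_ : _ = \int[mu]_y (g y * (kern eta (h + x) y - kern eta x y +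
      h.1 * dkern eta 0 x y + h.2 * dkern eta 1 x y))).
    rewrite mulrAC; apply: bnd => //.
    apply: measurable_funD; last by apply: measurable_funM => //; exact: measurable_dkern.
    apply: measurable_funD; last by apply: measurable_funM => //; exact: measurable_dkern.
    by apply: measurable_funB; exact: measurable_kernr.
  rewrite /moll /dmoll !mulNr -opprD opprK addrA.
  rewrite (mulrC _ h.1) (mulrC _ h.2) -!RintegralZl// -RintegralB// -RintegralD//.
  rewrite -RintegralD//; apply: eq_Rintegral => y _; ring.
- move=> j x h.
  have i1 := integrable_mul_dkern j (h + x) ig.
  have i2 := integrable_mul_dkern j x ig.
  rewrite /dmoll opprK addrC -RintegralB//.
  rewrite [X in `|X|](_ : _ = \int[mu]_y (g y * (dkern eta j x y - dkern eta j (h + x) y))).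
    rewrite mulrAC; apply: bnd => //.
      by apply: measurable_funB; exact: measurable_dkern.
    by move=> y; rewrite distrC.
  by apply: eq_Rintegral => y _; rewrite mulrBr.
Qed.

Lemma differentiable_moll g x : mu.-integrable setT (EFin \o g) ->
  differentiable (moll eta g) x.
Proof.
move=> /moll_quadratic[C [_ [HQ _]]].
exact: (differentiable_quadratic (HQ x)).
Qed.

Lemma continuous_moll g : mu.-integrable setT (EFin \o g) ->
  continuous (moll eta g).
Proof. by move=> ig x; apply/differentiable_continuous/differentiable_moll. Qed.

Lemma is_derive_moll g j x : mu.-integrable setT (EFin \o g) ->
  is_derive x (basis2 R j) (moll eta g) (dmoll eta j g x).
Proof.
move=> /moll_quadratic[C [_ [HQ _]]].
apply: (@is_derive_quadratic _ _ _ _ _ _ C) => s.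
have := HQ x (s *: basis2 R j); rewrite /basis2.
case: (j =P 0) => [->|/eqP j0] /=; rewrite /GRing.scale/= mulr1 mulr0 normr0 ?addr0 ?add0r.
  by rewrite mulr0 addr0 real_normK ?num_real// mulrC.
have -> : j = 1 by case: j j0 => -[|[|]]// i _; exact/val_inj.
by rewrite mulr0 add0r real_normK ?num_real// mulrC.
Qed.

Lemma continuous_dmoll g j : mu.-integrable setT (EFin \o g) ->
  continuous (dmoll eta j g).
Proof.
move=> /moll_quadratic[C [C0 [_ HL]]] x.
apply/cvgrPdist_lt => d d0.
have c0 : 0 < 2 * C + 1 by lra.
apply: (iffRL (@nbhs_ballP R (plane R) x _)). exists (d / (2 * C + 1)); first by rewrite /= divr_gt0.
move=> z; rewrite plane_ballE => -[z1 z2].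
rewrite distrC -(subrK x z); apply: le_lt_trans (HL _ _ _) _ => /=.
rewrite distrC in z1; rewrite distrC in z2.
apply: (@le_lt_trans _ _ (C * (d / (2 * C + 1) + d / (2 * C + 1)))).
  by rewrite ler_wpM2l// lerD// ltW.
rewrite (_ : C * _ = d * (2 * C / (2 * C + 1))); last by field; rewrite gt_eqF.
by rewrite -[ltRHS]mulr1 ltr_pM2l// ltr_pdivrMr// mul1r ltrDl.
Qed.

End integrable_moll.
End mollification.

(** * Convergence of mollifications in [L^1] *)

Section moll_L1.
Variable R : realType.
Implicit Types (x y : plane R) (eta : R -> R) (g h k : plane R -> R).
Local Notation mu := (leb2 R).
Local Open Scope ereal_scope.

Lemma integral_norm_triangle g h k : measurable_fun setT g ->
  measurable_fun setT h -> measurable_fun setT k ->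
  (forall x, `|g x| <= `|h x| + `|k x|)%R ->
  \int[mu]_x `|g x|%:E <= \int[mu]_x `|h x|%:E + \int[mu]_x `|k x|%:E.
Proof.
move=> mg mh mk ghk.
have mn (f : plane R -> R) : measurable_fun setT f ->
    measurable_fun setT (fun x => `|f x|%:E).
  by move=> mf; apply/measurable_EFinP; exact: measurableT_comp.
rewrite -ge0_integralD//; [|exact: mn..].
apply: ge0_le_integral => //.
- exact: mn.
- by apply: emeasurable_funD; exact: mn.
- by move=> x _; rewrite -EFinD lee_fin.
Qed.

Lemma integrable_measurable D g : mu.-integrable D (EFin \o g) ->
  measurable_fun D g.
Proof. by move/measurable_int/measurable_EFinP. Qed.

(** Tonelli: the kernel is symmetric and has mass one in either variable. *)
Lemma integral_kernel_norm e eta g : mollifier e eta ->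
  measurable_fun setT g ->
  \int[mu]_x \int[mu]_y (`|g y| * kern eta x y)%:E = \int[mu]_y `|g y|%:E.
Proof.
move=> m mg; have [se _ _ _ _] := m.
have mf : measurable_fun setT (fun z : plane R * plane R =>
    (`|g z.2| * kern eta z.1 z.2)%:E).
  apply/measurable_EFinP; apply: measurable_funM; last exact: measurable_kern.
  by apply: measurableT_comp => //; apply: measurableT_comp mg measurable_snd.
transitivity (\int[mu]_y \int[mu]_x (`|g y| * kern eta x y)%:E).
  have f0 (z : plane R * plane R) : 0 <= (`|g z.2| * kern eta z.1 z.2)%:E.
    by rewrite lee_fin mulr_ge0// (kern_ge0 _ _ m).
  exact: (@fubini_tonelli _ _ _ _ R (leb2_sfm R) (leb2_sfm R) _ mf f0).
apply: eq_integral => y _.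
under eq_integral do rewrite EFinM (kernC _ _ m).
rewrite ge0_integralZl ?lee_fin//.
- by rewrite (integral_kern _ m) mule1.
- by apply/measurable_EFinP; exact: measurable_kernr.
- by move=> x _; rewrite lee_fin (kern_ge0 _ _ m).
Qed.

Lemma measurable_moll e eta g : mollifier e eta ->
  mu.-integrable setT (EFin \o g) -> measurable_fun setT (moll eta g).
Proof.
move=> m ig; apply: measurable_fun_continuous_open; first exact: openT.
by move=> x _; exact: (continuous_moll m ig).
Qed.

Lemma norm_moll_le e eta g x : mollifier e eta ->
  mu.-integrable setT (EFin \o g) ->
  `|moll eta g x|%:E <= \int[mu]_y (`|g y| * kern eta x y)%:E.
Proof.
move=> m ig; have ik := integrable_mul_kern m x ig.
rewrite -[leLHS]/(`|(moll eta g x)%:E|) (EFin_moll m x ig).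
apply: le_trans (le_abse_integral _ measurableT (measurable_int _ ik)) _.
rewrite le_eqVlt; apply/orP; left; apply/eqP; apply: eq_integral => y _ /=.
by rewrite normrM (ger0_norm (kern_ge0 _ _ m)).
Qed.

Lemma integral_moll_le e eta g : mollifier e eta ->
  mu.-integrable setT (EFin \o g) ->
  \int[mu]_x `|moll eta g x|%:E <= \int[mu]_x `|g x|%:E.
Proof.
move=> m ig; have mg := integrable_measurable ig; have [se _ _ _ _] := m.
rewrite -[leRHS](integral_kernel_norm m mg); apply: ge0_le_integral => //.
- apply/measurable_EFinP; apply: measurableT_comp => //.
  exact: measurable_moll m ig.
- apply: (@measurable_fun_fubini_tonelli_F _ _ _ _ _ (leb2_sfm R) (fun z : plane R * plane R =>
    (`|g z.2| * kern eta z.1 z.2)%:E)).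
    apply/measurable_EFinP; apply: measurable_funM; last exact: measurable_kern.
    by apply: measurableT_comp => //; apply: measurableT_comp mg measurable_snd.
  by move=> z; rewrite lee_fin mulr_ge0// (kern_ge0 _ _ m).
- by move=> x _; exact: norm_moll_le m ig.
Qed.

Lemma mollD e eta g h x : mollifier e eta -> mu.-integrable setT (EFin \o g) ->
  mu.-integrable setT (EFin \o h) ->
  moll eta (fun y => g y + h y)%R x = (moll eta g x + moll eta h x)%R.
Proof.
move=> m ig ih; rewrite /moll -RintegralD//; try exact: (integrable_mul_kern m).
by apply: eq_Rintegral => y _; rewrite mulrDl.
Qed.

Lemma mollB e eta g h x : mollifier e eta -> mu.-integrable setT (EFin \o g) ->
  mu.-integrable setT (EFin \o h) ->
  moll eta (fun y => g y - h y)%R x = (moll eta g x - moll eta h x)%R.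
Proof.
move=> m ig ih; rewrite /moll -RintegralB//; try exact: (integrable_mul_kern m).
by apply: eq_Rintegral => y _; rewrite mulrBl.
Qed.

Lemma mollZ e eta c g x : mollifier e eta -> mu.-integrable setT (EFin \o g) ->
  moll eta (fun y => c * g y)%R x = (c * moll eta g x)%R.
Proof.
move=> m ig; rewrite /moll -RintegralZl//; try exact: (integrable_mul_kern m).
by apply: eq_Rintegral => y _; rewrite mulrA.
Qed.

(** Convergence is uniform over all mollifiers of small radius instead of along a sequence, so that
    one radius can be chosen for several functions at once. *)
Definition moll_cvg g := mu.-integrable setT (EFin \o g) /\
  forall d : R, (0 < d)%R -> exists r : R, (0 < r)%R /\
    forall e eta, (e <= r)%R -> mollifier e eta ->
    \int[mu]_x `|moll eta g x - g x|%:E <= d%:E.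

Lemma moll_cvgD g h : moll_cvg g -> moll_cvg h ->
  moll_cvg (fun x => g x + h x)%R.
Proof.
move=> [ig cg] [ih ch]; split; first exact: (integrableD measurableT ig ih).
move=> d d0; have d2 : (0 < d / 2)%R by rewrite divr_gt0.
have [r [r0 rP]] := cg _ d2; have [s [s0 sP]] := ch _ d2.
exists (Num.min r s); split; first by rewrite lt_min r0 s0.
move=> e eta; rewrite le_min => /andP[er es] m.
rewrite (splitr d) EFinD.
apply: le_trans (leeD (rP _ _ er m) (sP _ _ es m)).
have mg := integrable_measurable ig; have mh := integrable_measurable ih.
apply: integral_norm_triangle.
- apply: measurable_funB; last exact: measurable_funD.
  apply: (measurable_moll m); exact: (integrableD measurableT ig ih).
- by apply: measurable_funB => //; exact: measurable_moll m ig.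
- by apply: measurable_funB => //; exact: measurable_moll m ih.
- move=> x; rewrite (mollD _ m ig ih) opprD addrACA; exact: ler_normD.
Qed.

Lemma moll_cvgZ c g : moll_cvg g -> moll_cvg (fun x => c * g x)%R.
Proof.
move=> [ig cg]; split; first exact: (integrableZl measurableT c ig).
move=> d d0; have c0 : (0 < `|c| + 1)%R by rewrite ltr_wpDl.
have [r [r0 rP]] := cg _ (divr_gt0 d0 c0).
exists r; split => // e eta er m.
have mg := integrable_measurable ig.
under eq_integral do rewrite (mollZ _ _ m ig) -mulrBr normrM EFinM.
rewrite ge0_integralZl ?lee_fin//; last first.
  apply/measurable_EFinP; apply: measurableT_comp => //.
  by apply: measurable_funB => //; exact: measurable_moll m ig.
apply: (@le_trans _ _ ((`|c| + 1)%:E * (d / (`|c| + 1))%:E)).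
  apply: lee_pmul => //; [exact: integral_ge0|by rewrite lee_fin lerDl|exact: rP m].
by rewrite -EFinM mulrC divfK// gt_eqF.
Qed.

(** Mollification does not increase the [L^1] norm, so the error for [g] exceeds the error for [h]
    by at most twice the distance from [g] to [h]. *)
Lemma moll_cvg_approx g : mu.-integrable setT (EFin \o g) ->
  (forall d : R, (0 < d)%R -> exists2 h, moll_cvg h &
     \int[mu]_x `|g x - h x|%:E <= d%:E) -> moll_cvg g.
Proof.
move=> ig gh; split=> // d d0; have d3 : (0 < d / 3)%R by rewrite divr_gt0.
have [h [ih ch] hg] := gh _ d3.
have [r [r0 rP]] := ch _ d3; exists r; split=> // e eta er m.
have mg := integrable_measurable ig; have mh := integrable_measurable ih.
have igh : mu.-integrable setT (EFin \o (fun x => g x - h x)%R).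
  exact: (integrableB measurableT ig ih).
have -> : d%:E = (d / 3)%:E + (d / 3)%:E + (d / 3)%:E.
  by rewrite -!EFinD; congr EFin; field.
have mm k : mu.-integrable setT (EFin \o k) -> measurable_fun setT (moll eta k).
  exact: (measurable_moll m).
apply: (@le_trans _ _ (\int[mu]_x `|(moll eta (fun x => g x - h x) x +
    (moll eta h x - h x))%R|%:E + \int[mu]_x `|g x - h x|%:E)).
  apply: integral_norm_triangle.
  - by apply: measurable_funB => //; exact: mm.
  - by apply: measurable_funD; [|apply: measurable_funB => //]; exact: mm.
  - exact: measurable_funB.
  - move=> x; rewrite (mollB _ m ig ih).
    rewrite (_ : moll eta g x - g x = moll eta g x - moll eta h x +
      (moll eta h x - h x) - (g x - h x))%R; last by ring.
    exact: ler_normB.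
apply: leeD => //.
apply: (@le_trans _ _ (\int[mu]_x `|moll eta (fun x => g x - h x)%R x|%:E +
    \int[mu]_x `|moll eta h x - h x|%:E)).
  apply: integral_norm_triangle.
  - by apply: measurable_funD; [|apply: measurable_funB => //]; exact: mm.
  - exact: mm.
  - by apply: measurable_funB => //; exact: mm.
  - by move=> x; exact: ler_normD.
apply: leeD; last exact: rP m.
by apply: le_trans hg; exact: integral_moll_le m igh.
Qed.

End moll_L1.

Section moll_L1b.

Variable R : realType.
Implicit Types (x y : plane R) (eta : R -> R) (g h k : plane R -> R).
Local Notation mu := (leb2 R).
Local Open Scope ereal_scope.

Lemma integrable_indic_fin (A : set (plane R)) : measurable A -> mu A < +oo ->
  mu.-integrable setT (EFin \o \1_A).
Proof.
by move=> mA Afin; apply/integrableP; split;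
  [exact/measurable_EFinP|under eq_integral do rewrite /= ger0_norm//;
   rewrite integral_indic// setIT].
Qed.

(** Indicators of open sets take the place that continuous functions usually have in the density
    argument. On a margin wider than the kernel the mollified indicator is exactly one, and the
    total mass does not increase. *)
Lemma moll_cvg_open (U : set (plane R)) : open U -> mu U < +oo ->
  moll_cvg \1_U.
Proof.
move=> oU Ufin; have mU : measurable U by exact: open_measurable_plane.
have iU : mu.-integrable setT (EFin \o \1_U) by exact: integrable_indic_fin.
split=> // d d0.
pose M n := margin U n.+1%:R^-1.
have mM n : measurable (M n) by apply: measurable_margin; rewrite invr_gt0.
have MU n : M n `<=` U by apply: margin_sub; rewrite invr_gt0.
have UE : \bigcup_n M n = U by rewrite -open_bigcup_margin.
have Mfin n : mu (M n) \is a fin_num.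
  rewrite ge0_fin_numE//; apply: le_lt_trans Ufin; apply: le_measure;
    rewrite ?inE; [exact: mM|exact: mU|exact: MU].
have Ufin' : mu U \is a fin_num by rewrite ge0_fin_numE.
have [n nP] : exists n, mu U - mu (M n) <= (d / 2)%:E.
  have : mu \o M @ \oo --> mu (\bigcup_n M n).
    by apply: nondecreasing_cvg_mu => //; [rewrite UE|exact: nondecreasing_margin].
  rewrite UE -(fineK Ufin') => /fine_cvgP[_ /cvgrPdist_le/(_ (d / 2)%R)].
  rewrite divr_gt0// => /(_ isT)[n _ /(_ n (leqnn n))] /= nd.
  exists n; rewrite -(fineK (Mfin n)) -EFinB lee_fin.
  exact: le_trans (ler_norm _) nd.
exists n.+1%:R^-1%R; split; first by rewrite invr_gt0.
move=> e eta en m; have [se _ _ _ _] := m.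
have mo1 x : M n x -> moll eta \1_U x = 1%R.
  move=> Mx; have -> : moll eta \1_U x = (\int[mu]_y (kern eta x y))%R.
    apply: eq_Rintegral => y _; have [xy|xy] := pselect (ball x e y).
      by rewrite indicE mem_set ?mul1r//; apply: Mx; exact: le_ball xy.
    by rewrite (kern_support m xy) mulr0.
  by rewrite /Rintegral (integral_kern x m).
have mo0 x : (0 <= moll eta \1_U x)%R.
  by apply: Rintegral_ge0 => y _; rewrite mulr_ge0// (kern_ge0 _ _ m).
have mmo := measurable_moll m iU.
(* Off [M n] an absolute difference is at most the sum of its terms; on [M n] both functions are
   one, so the difference is zero and the sum is the [2] moved to the left. Hence the error is at
   most twice [mu U - mu (M n)]. *)
have key : \int[mu]_x `|moll eta \1_U x - \1_U x|%:E + (mu (M n) + mu (M n)) <=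
    mu U + mu U.
  have mi (A : set (plane R)) : measurable A -> measurable_fun setT (\1_A : plane R -> R).
    by move=> mA; exact: measurable_indic.
  have miE (A : set (plane R)) : measurable A ->
      measurable_fun setT (fun x : plane R => (\1_A x : R)%:E).
    by move=> mA; apply/measurable_EFinP; exact: mi.
  have indE (A : set (plane R)) : measurable A -> mu A = \int[mu]_x (\1_A x)%:E.
    by move=> mA; rewrite integral_indic// setIT.
  have E1 : mu (M n) + mu (M n) = \int[mu]_x (\1_(M n) x + \1_(M n) x)%:E.
    by rewrite {1 2}indE// -ge0_integralD//; apply: miE.
  have := integral_moll_le m iU.
  rewrite [X in _ <= X](_ : _ = mu U); last first.
    by under eq_integral do rewrite ger0_norm//; rewrite integral_indic// setIT.
  move=> moU; apply: le_trans (leeD moU (lexx _)).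
  have mmn : measurable_fun setT (fun x => `|moll eta \1_U x|%R).
    exact: measurableT_comp.
  have mmd : measurable_fun setT (fun x => `|moll eta \1_U x - \1_U x|%R).
    by apply: measurableT_comp => //; apply: measurable_funB => //; exact: mi.
  have mMM : measurable_fun setT (fun x => \1_(M n) x + \1_(M n) x : R)%R.
    by apply: measurable_funD; exact: mi.
  rewrite (indE _ mU) E1 -!ge0_integralD//; try exact/measurable_EFinP; first last.
  apply: ge0_le_integral => //.
  - by move=> x _; rewrite -EFinD lee_fin !addr_ge0.
  - by apply/measurable_EFinP; exact: measurable_funD.
  - by apply/measurable_EFinP; apply: measurable_funD => //; exact: mi.
  - move=> x _; rewrite -!EFinD lee_fin (ger0_norm (mo0 x)).
    have [Mx|nM] := pselect (M n x).
      by rewrite mo1// !indicE (mem_set Mx) (mem_set (MU _ _ Mx)) subrr normr0 add0r.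
    rewrite [X in (_ + (X + X))%R]indicE memNset// !addr0.
    apply: le_trans (ler_normB _ _) _.
    by rewrite !ger0_norm// indicE.
have [D DE] : exists D, \int[mu]_x `|moll eta \1_U x - \1_U x|%:E = D%:E.
  exists (fine (\int[mu]_x `|moll eta \1_U x - \1_U x|%:E)).
  rewrite fineK// ge0_fin_numE; last exact: integral_ge0.
  apply: (@le_lt_trans _ _ (mu U + mu U)); last by rewrite lte_add_pinfty.
  by apply: le_trans key; rewrite leeDl// adde_ge0.
move: key nP; rewrite DE -(fineK Ufin') -(fineK (Mfin n)) -!EFinD !lee_fin; lra.
Qed.

End moll_L1b.

Import HBSimple.

Section moll_cvg_bounded.
Variable R : realType.
Implicit Types (x y : plane R) (eta : R -> R) (g h k : plane R -> R).
Local Notation mu := (leb2 R).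
Local Open Scope ereal_scope.

Lemma moll_cvg_indic (Omega E : set (plane R)) : open Omega ->
  mu Omega < +oo -> measurable E -> E `<=` Omega -> moll_cvg \1_E.
Proof.
move=> oO Ofin mE EO.
have mO : measurable Omega by exact: open_measurable_plane.
have Efin : mu E < +oo.
  by apply: le_lt_trans Ofin; apply: le_measure; rewrite ?inE; [exact: mE|exact: mO|].
apply: moll_cvg_approx; first exact: integrable_indic_fin.
move=> d d0.
(* The weight [\1_Omega] gives a finite measure, and it ignores the part of [U] that the
   intersection with [Omega] removes below. *)
have [|||U [oU EU Ud]] := @outer_regular_weight R (fun x => (\1_Omega x)%:E) E d _ _ _ mE d0.
- by apply/measurable_EFinP; exact: measurable_indic.
- by move=> x; rewrite lee_fin.
- by rewrite integral_indic// setIT.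
have mU : measurable U by exact: open_measurable_plane.
have mUE : measurable (U `\` E) by exact: measurableD.
have oV : open (U `&` Omega) by exact: openI.
have mV : measurable (U `&` Omega) by exact: open_measurable_plane.
exists \1_(U `&` Omega).
  apply: moll_cvg_open => //; apply: le_lt_trans Ofin.
  by apply: le_measure; rewrite ?inE; [exact: mV|exact: mO|exact: subIsetr].
apply: le_trans Ud; rewrite [leRHS]integral_mkcond le_eqVlt; apply/orP; left.
apply/eqP; apply: eq_integral => x _; rewrite patchE.
case: ifPn => [/set_mem[Ux nEx]|/negP xUE].
  by rewrite !indicE in_setI (mem_set Ux) (memNset nEx) sub0r normrN ger0_norm.
have [Ex|nE] := pselect (E x).
  rewrite !indicE mem_set// mem_set ?subrr ?normr0//.
  by split; [exact: EU|exact: EO].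
rewrite !indicE memNset// memNset ?subrr ?normr0//.
by move=> [Ux Ox]; apply: xUE; apply/mem_set.
Qed.

Lemma moll_cvg_sum (I : Type) (s : seq I) (F : I -> plane R -> R) :
  (forall i, moll_cvg (F i)) -> moll_cvg (fun x => \sum_(i <- s) F i x)%R.
Proof.
move=> cF; elim: s => [|i s IH].
  have -> : (fun x => \sum_(i <- [::]) F i x)%R = \1_set0.
    by apply/funext => x; rewrite big_nil indicE in_set0.
  by apply: moll_cvg_open; [exact: open0|rewrite measure0].
have -> : (fun x => \sum_(i <- i :: s) F i x)%R =
    (fun x => F i x + \sum_(i <- s) F i x)%R.
  by apply/funext => x; rewrite big_cons.
exact: moll_cvgD.
Qed.

(** Density in stages: open sets, then measurable sets by outer regularity, then combinations of
    indicators, then [g] by simple approximation. *)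
Theorem moll_cvg_integrable (Omega : set (plane R)) g : open Omega ->
  mu Omega < +oo -> mu.-integrable setT (EFin \o g) ->
  (forall x, ~ Omega x -> g x = 0%R) -> moll_cvg g.
Proof.
move=> oO Ofin ig g0.
have mO : measurable Omega by exact: open_measurable_plane.
apply: moll_cvg_approx => // d d0.
have igO : mu.-integrable Omega (EFin \o g) by exact: integrableS ig.
have [|h [ih _ hg]] := approximation_sfun_integrable _ igO; first exact: mO.
have [n nd] : exists n, \int[mu]_(z in Omega) `|(g z)%:E - (h n z)%:E| <= d%:E.
  have /fine_cvgP[[m _ mfin] /cvgrPdist_le/(_ d d0)[p _ pd]] := hg.
  exists (maxn m p).
  have := pd (maxn m p) (leq_maxr _ _); rewrite sub0r normrN /= => H.
  rewrite -[leLHS]fineK; last exact: (mfin (maxn m p) (leq_maxl _ _)).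
  by rewrite lee_fin (le_trans (ler_norm _) H).
(* The simple function is cut off outside [Omega], where [g] vanishes; what remains is a combination
   of indicators of subsets of [Omega]. *)
exists (fun x => \sum_(y <- finmap.enum_fset (fset_set (range (h n))))
    (y * \1_(h n @^-1` [set y] `&` Omega) x))%R.
  apply: moll_cvg_sum => y; apply: moll_cvgZ.
  apply: (moll_cvg_indic oO Ofin); last exact: subIsetr.
  apply: measurableI; [|exact: mO].
  have mh : measurable_fun setT (h n) by exact: measurable_funP.
  by rewrite -[X in measurable X]setTI; apply: mh => //; exact: measurable_set1.
apply: le_trans nd; rewrite [leRHS]integral_mkcond le_eqVlt; apply/orP; left.
apply/eqP; apply: eq_integral => x _; rewrite patchE.
case: ifPn => [/set_mem Ox|/negP nO].
  rewrite -EFinB /=; congr (`|_ - _|%:E)%R.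
  rewrite [RHS](fimfunE (h n)) fsbig_finite//=.
  by apply: eq_bigr => y _; rewrite !indicE in_setI (mem_set Ox) andbT.
rewrite g0; last by move=> Ox; apply: nO; exact: mem_set.
rewrite big1 ?subrr ?normr0// => y _.
by rewrite indicE memNset ?mulr0// => -[_ Ox]; apply: nO; exact: mem_set.
Qed.

End moll_cvg_bounded.

(** * Integration by parts against the kernel *)

Section integration_by_parts_kernel.
Variable R : realType.
Implicit Types (x y : plane R) (eta : R -> R).
Local Notation mu := (leb2 R).

Lemma mollifier_radius_gt0 e eta : mollifier e eta -> 0 < e.
Proof.
move=> [_ _ _ e0 e1]; rewrite ltNge; apply/negP => en.
have : (\int[lebesgue_measure]_t (eta t)%:E = 0)%E.
  by apply: integral0_eq => t _; rewrite e0// (le_trans en).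
by rewrite e1 => -[/eqP]; rewrite oner_eq0.
Qed.

(** The integrand is the derivative of [phi s * eta (s - a)], which vanishes at both ends of
    [[a - e, a + e]]. Beyond them [eta] is zero, so nothing is asked of [phi] there. *)
Lemma integral_slice_eq0 e eta (a : R) (phi dphi : R -> R) : mollifier e eta ->
  (forall s, `|a - s| <= e ->
     is_derive s 1 phi (dphi s) /\ {for s, continuous dphi}) ->
  (\int[lebesgue_measure]_s
     (phi s * derive1 eta (s - a) + dphi s * eta (s - a))%:E = 0)%E.
Proof.
move=> m H; have e0 := mollifier_radius_gt0 m; have [se _ _ z _] := m.
have ae : a - e < a + e by lra.
have inI s : (s \in `[a - e, a + e]) -> `|a - s| <= e.
  by rewrite in_itv/= => h; rewrite ler_distlC.
have z' t : e < `|t| -> eta t = 0 by move/ltW; exact: z.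
have dz := derive1_support z'.
have cphi s : `|a - s| <= e -> {for s, continuous phi}.
  by move=> /H[[d _] _]; apply/differentiable_continuous/derivable1_diffP.
have deta (s : R) : is_derive s 1 (fun s => eta (s - a)) (derive1 eta (s - a)).
  have := smooth1_is_derive s (smooth1_shift a se).
  by rewrite derive1_shift.
have ceta : continuous (fun s : R => eta (s - a)).
  by apply: smooth1_continuous; exact: smooth1_shift.
have cdeta : continuous (fun s : R => derive1 eta (s - a)).
  by apply: smooth1_continuous; apply: smooth1_shift; exact: smooth1_derive1.
pose F s := phi s * eta (s - a).
have dF s : `|a - s| <= e ->
    is_derive s 1 F (phi s * derive1 eta (s - a) + dphi s * eta (s - a)).
  move=> /H[d _]; have := is_deriveM d (deta s).
  by rewrite /GRing.scale/= [eta _ * _]mulrC.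
have cF s : `|a - s| <= e -> {for s, continuous F}.
  by move=> sa; apply: cvgM; [exact: cphi|exact: ceta].
transitivity (\int[lebesgue_measure]_(s in `[(a - e)%R, (a + e)%R])
     (phi s * derive1 eta (s - a) + dphi s * eta (s - a))%:E)%E.
  rewrite [RHS]integral_mkcond; apply: eq_integral => s _; rewrite patchE.
  case: ifPn => // /negP ns.
  have es : e < `|s - a|.
    rewrite ltNge; apply/negP => h; apply: ns; apply/mem_set => /=.
    by rewrite in_itv/= -ler_distlC distrC.
  by rewrite z'// dz// !mulr0 addr0.
rewrite (@continuous_FTC2 R _ F)//.
- have -> : F (a + e) = 0 by rewrite /F z ?mulr0// addrAC subrr add0r ler_norm.
  have -> : F (a - e) = 0.
    by rewrite /F z ?mulr0// addrAC subrr add0r normrN ler_norm.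
  by rewrite subee.
- apply: continuous_in_subspaceT => s /set_mem /= /inI sa.
  apply: cvgD; apply: cvgM.
  + exact: cphi.
  + exact: cdeta.
  + by have [] := H s sa.
  + exact: ceta.
- split.
  + move=> s /subset_itv_oo_cc/inI sa; have [] := dF s sa; exact.
  + by apply: cvg_at_right_filter; apply: cF; rewrite subKr gtr0_norm.
  + by apply: cvg_at_left_filter; apply: cF; rewrite distrC addrAC subrr add0r gtr0_norm.
- move=> s /subset_itv_oo_cc/inI sa; rewrite derive1E.
  by have [_ ->] := dF s sa.
Qed.

Lemma is_derive_slice (f : plane R -> R) (j : 'I_2) y d :
  is_derive y (basis2 R j) f d ->
  if j == 0 then is_derive y.1 1 (fun s : R => f (s, y.2)) d
  else is_derive y.2 1 (fun s : R => f (y.1, s)) d.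
Proof.
move=> [df <-]; rewrite /basis2 in df *; case: ifP df => _ df.
  have E : (fun h : R => h^-1 *: (((fun s : R => f (s, y.2)) \o shift y.1) (h *: 1)
          - f (y.1, y.2))) =
      (fun h : R => h^-1 *: ((f \o shift y) (h *: (1, 0)) - f y)).
    apply/funext => h /=; rewrite -surjective_pairing; congr (_ *: (f _ - _)).
    by case: y {df} => a b /=; congr pair; rewrite /= scaler0 add0r.
  by apply: DeriveDef; [rewrite /derivable E|rewrite /derive E].
have E : (fun h : R => h^-1 *: (((fun s : R => f (y.1, s)) \o shift y.2) (h *: 1)
        - f (y.1, y.2))) =
    (fun h : R => h^-1 *: ((f \o shift y) (h *: (0, 1)) - f y)).
  apply/funext => h /=; rewrite -surjective_pairing; congr (_ *: (f _ - _)).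
  by case: y {df} => a b /=; congr pair; rewrite /= scaler0 add0r.
by apply: DeriveDef; [rewrite /derivable E|rewrite /derive E].
Qed.

Lemma square_margin e r x y (A : set (plane R)) : e < r -> margin A r x ->
  `|x.1 - y.1| <= e /\ `|x.2 - y.2| <= e -> A y.
Proof.
move=> er xA [y1 y2]; apply: xA.
by rewrite plane_ballE; split; apply: le_lt_trans er.
Qed.

Lemma integrable_continuous_mul (A : set (plane R)) (f k : plane R -> R) x e r C :
  open A -> (forall y, A y -> {for y, continuous f}) ->
  measurable_fun setT k -> (forall y, `|k y| <= C) ->
  (forall y, ~ (`|x.1 - y.1| <= e /\ `|x.2 - y.2| <= e) -> k y = 0) ->
  0 < e -> e < r -> margin A r x ->
  mu.-integrable setT (EFin \o (fun y => f y * k y)).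
Proof.
move=> oA cf mk kC k0 e0 er xA.
set S := [set y : plane R | `|x.1 - y.1| <= e /\ `|x.2 - y.2| <= e].
have cS : compact S by exact: compact_square.
have SA : S `<=` A by move=> y; exact: square_margin er xA.
have mS : measurable S.
  by apply: closed_measurable_plane; apply: compact_closed => //; exact: norm_hausdorff.
have [M MP] : exists M, forall y, S y -> `|f y| <= M.
  have : compact (f @` S).
    apply: continuous_compact => //; apply: continuous_in_subspaceT => y /set_mem.
    by move/SA; exact: cf.
  move=> /compact_bounded[M [_ MP]]; exists `|M + 1| => y Sy.
  apply: (MP `|M + 1|); last by exists y.
  by apply: lt_le_trans (ler_norm _); rewrite ltrDl.
have -> : EFin \o (fun y => f y * k y) = (EFin \o (fun y => f y * k y)) \_ S.
  apply/funext => y; rewrite patchE; case: ifPn => // /negP yS /=.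
  by rewrite k0 ?mulr0// => h; apply: yS; exact: mem_set.
apply: (iffLR (integrable_mkcond _ _)); first exact: mS.
have Sfin : (mu S < +oo)%E.
  apply: (@le_lt_trans _ _ (mu (ball x r))); last first.
    by apply: leb2_ball_fin; exact/ltW/(lt_trans e0).
  apply: le_measure; rewrite ?inE; [exact: mS|exact: measurable_plane_ball|].
  by move=> y [y1 y2]; rewrite plane_ballE; split; apply: le_lt_trans er.
apply: measurable_bounded_integrable => //.
- apply: measurable_funM; last exact: measurable_funTS.
  apply: (measurable_funS _ SA); first exact: open_measurable_plane.
  exact: measurable_fun_continuous_open.
- exists (`|M| * `|C|); split; first exact: num_real.
  move=> z Mz y Sy; apply: le_trans (ltW Mz); rewrite normrM.
  by rewrite ler_pM// (le_trans _ (ler_norm _))// MP.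
Qed.

(** [f] may be arbitrary outside [A]: a kernel centred in a margin confines everything to a compact
    square inside [A], where the products are integrable and Fubini applies. *)
Lemma integration_by_parts_kern (A : set (plane R)) (f df : plane R -> R)
    (j : 'I_2) x e r eta : open A ->
  (forall y, A y -> is_derive y (basis2 R j) f (df y)) ->
  (forall y, A y -> {for y, continuous f}) ->
  (forall y, A y -> {for y, continuous df}) ->
  mollifier e eta -> e < r -> margin A r x ->
  [/\ mu.-integrable setT (EFin \o (fun y => f y * dkern eta j x y)),
      mu.-integrable setT (EFin \o (fun y => df y * kern eta x y)) &
  \int[mu]_y (f y * dkern eta j x y) = - \int[mu]_y (df y * kern eta x y)].
Proof.
move=> oA Df cf cdf m er xA.
have e0 := mollifier_radius_gt0 m; have [se _ _ z _] := m.
have z' t : e < `|t| -> eta t = 0 by move/ltW; exact: z.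
have [C [_ HK HD _ _]] := kern_bounded m.
have i1 : mu.-integrable setT (EFin \o (fun y => f y * dkern eta j x y)).
  apply: (integrable_continuous_mul oA cf (measurable_dkern j x se) (HD j x) _ e0 er xA).
  by move=> y; exact: (dkern_support j m).
have i2 : mu.-integrable setT (EFin \o (fun y => df y * kern eta x y)).
  apply: (integrable_continuous_mul oA cdf (measurable_kernr x se) (HK x) _ e0 er xA).
  move=> y h; apply: (kern_support m); rewrite plane_ballE => -[/ltW h1 /ltW h2].
  exact: h.
split => //.
apply/eqP; rewrite -addr_eq0; apply/eqP.
rewrite -RintegralD// /Rintegral.
have iD : mu.-integrable setT
    (EFin \o (fun y => f y * dkern eta j x y + df y * kern eta x y)).
  exact: (integrableD measurableT i1 i2).
suff -> : (\int[mu]_y (f y * dkern eta j x y + df y * kern eta x y)%:E = 0)%E by [].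
have sq (y : plane R) : `|x.1 - y.1| <= e -> `|x.2 - y.2| <= e -> A y.
  by move=> h1 h2; exact: square_margin er xA (conj h1 h2).
(* The inner integral is taken in the direction of differentiation, so that every slice vanishes by
   itself. *)
have [j0|j0] := eqVneq j 0.
- rewrite -[LHS](integral21_prod_meas1 iD); apply: integral0_eq => t _.
  rewrite /fubini_G /= j0 /dkern /kern /=.
  have [xt|xt] := leP `|x.2 - t| e; last first.
    apply: integral0_eq => s _; rewrite [eta (t - _)]z' ?mulr0 ?addr0 ?mulr0//.
    by rewrite distrC.
  transitivity (\int[lebesgue_measure]_s
     (f (s, t) * eta (t - x.2) * derive1 eta (s - x.1) +
      df (s, t) * eta (t - x.2) * eta (s - x.1))%:E)%E.
    by apply: eq_integral => s _; congr EFin; ring.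
  apply: (integral_slice_eq0 m (phi := fun s => f (s, t) * eta (t - x.2))
    (dphi := fun s => df (s, t) * eta (t - x.2))) => s xs.
  have Ay := sq (s, t) xs xt; split.
    have := is_derive_slice (Df _ Ay); rewrite j0 /= => d1.
    have := is_deriveM d1 (is_derive_cst (eta (t - x.2)) s 1).
    by rewrite scaler0 add0r [_ *: _]mulrC.
  apply: cvgM; last exact: cvg_cst.
  apply: (@continuous_comp _ _ _ (fun s : R => (s, t)) df s); last exact: cdf.
  by apply: (@cvg_pair _ _ _ (nbhs s) (nbhs s) (nbhs t)); [exact: cvg_id|exact: cvg_cst].
- rewrite -[LHS](integral12_prod_meas1 iD); apply: integral0_eq => t _.
  rewrite /fubini_F /= /dkern /kern (negbTE j0) /=.
  have [xt|xt] := leP `|x.1 - t| e; last first.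
    apply: integral0_eq => s _; rewrite [eta (t - _)]z' ?mul0r ?mulr0 ?addr0//.
    by rewrite distrC.
  transitivity (\int[lebesgue_measure]_s
     (f (t, s) * eta (t - x.1) * derive1 eta (s - x.2) +
      df (t, s) * eta (t - x.1) * eta (s - x.2))%:E)%E.
    by apply: eq_integral => s _; congr EFin; ring.
  apply: (integral_slice_eq0 m (phi := fun s => f (t, s) * eta (t - x.1))
    (dphi := fun s => df (t, s) * eta (t - x.1))) => s xs.
  have Ay := sq (t, s) xt xs; split.
    have := is_derive_slice (Df _ Ay); rewrite (negbTE j0) /= => d1.
    have := is_deriveM d1 (is_derive_cst (eta (t - x.1)) s 1).
    by rewrite scaler0 add0r [_ *: _]mulrC.
  apply: cvgM; last exact: cvg_cst.
  apply: (@continuous_comp _ _ _ (fun s : R => (t, s)) df s); last exact: cdf.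
  by apply: (@cvg_pair _ _ _ (nbhs s) (nbhs t) (nbhs s)); [exact: cvg_cst|exact: cvg_id].
Qed.

End integration_by_parts_kernel.

(** * The lower bound *)

Section graph_density.
Variable R : realType.
Implicit Types (M N : 'M[R]_2).

Lemma sum22 (E : 'I_2 -> 'I_2 -> R) :
  \sum_(i < 2) \sum_(j < 2) E i j = E 0 0 + E 0 1 + E 1 0 + E 1 1.
Proof.
rewrite !big_ord_recl !big_ord0 !addr0.
have -> : lift ord0 ord0 = 1 :> 'I_2 by apply/val_inj.
by rewrite -!addrA.
Qed.

Lemma frobenius_sqr M : frobenius M ^+ 2 = \sum_(i < 2) \sum_(j < 2) M i j ^+ 2.
Proof.
rewrite /frobenius sqr_sqrtr//.
by apply: sumr_ge0 => i _; apply: sumr_ge0 => j _; exact: sqr_ge0.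
Qed.

(** The Euclidean norm of the vector [(1, M)] of R^5; its Lipschitz, Cauchy-Schwarz and Jensen
    properties below come from this. *)
Definition gdens M : R := Num.sqrt (1 + frobenius M ^+ 2).

Lemma gdens_ge1 M : 1 <= gdens M.
Proof.
by rewrite /gdens -[leLHS]sqrtr1 ler_wsqrtr// lerDl sqr_ge0.
Qed.

Lemma gdens_ge0 M : 0 <= gdens M.
Proof. exact: sqrtr_ge0. Qed.

Lemma gdens_sqr M : gdens M ^+ 2 = 1 + \sum_(i < 2) \sum_(j < 2) M i j ^+ 2.
Proof.
rewrite /gdens sqr_sqrtr; first by rewrite frobenius_sqr.
by rewrite addr_ge0// sqr_ge0.
Qed.

Lemma entry_le_gdens M i j : `|M i j| <= gdens M.
Proof.
rewrite -(ler_pXn2r (ltn0Sn 1)) ?nnegrE ?gdens_ge0//.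
rewrite gdens_sqr real_normK ?num_real// (bigD1 i)//= (bigD1 j)//=.
apply: ler_wpDl => //; rewrite -addrA lerDl addr_ge0//.
  by apply: sumr_ge0 => k _; exact: sqr_ge0.
by apply: sumr_ge0 => k _; apply: sumr_ge0 => l _; exact: sqr_ge0.
Qed.

Lemma gdens_lipschitz M N :
  gdens M <= gdens N + \sum_(i < 2) \sum_(j < 2) `|M i j - N i j|.
Proof.
set s := \sum_(i < 2) _.
have s0 : 0 <= s by apply: sumr_ge0 => i _; apply: sumr_ge0.
rewrite -(ler_pXn2r (ltn0Sn 1)) ?nnegrE ?addr_ge0 ?gdens_ge0//.
rewrite sqrrD !gdens_sqr -[leRHS]addrA -addrA lerD2l.
have H i j : M i j ^+ 2 <= N i j ^+ 2 + gdens N * `|M i j - N i j| *+ 2 +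
    `|M i j - N i j| ^+ 2.
  rewrite real_normK ?num_real//.
  have := ler_norm (N i j * (M i j - N i j)); rewrite normrM => h.
  have : `|N i j| * `|M i j - N i j| <= gdens N * `|M i j - N i j|.
    by rewrite ler_wpM2r// entry_le_gdens.
  by move: h; set d := `|_| * `|_|; set e := gdens _ * _; nra.
apply: (@le_trans _ _ (\sum_(i < 2) \sum_(j < 2) (N i j ^+ 2 +
   gdens N * `|M i j - N i j| *+ 2 + `|M i j - N i j| ^+ 2))).
  by apply: ler_sum => i _; apply: ler_sum => j _; exact: H.
rewrite /s !sum22.
move: (normr_ge0 (M 0 0 - N 0 0)) (normr_ge0 (M 0 1 - N 0 1))
  (normr_ge0 (M 1 0 - N 1 0)) (normr_ge0 (M 1 1 - N 1 1)).
set a := `|_|; set b := `|_|; set c := `|_|; set d := `|_|; move=> a0 b0 c0 d0.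
rewrite -subr_ge0.
rewrite [leRHS](_ : _ = a * b *+ 2 + a * c *+ 2 + a * d *+ 2 + b * c *+ 2 +
  b * d *+ 2 + c * d *+ 2); last by ring.
by rewrite !addr_ge0// mulr_ge0.
Qed.

Lemma gdens_cauchy_schwarz M N :
  1 + \sum_(i < 2) \sum_(j < 2) M i j * N i j <= gdens M * gdens N.
Proof.
apply: le_trans (ler_norm _) _.
rewrite -(ler_pXn2r (ltn0Sn 1)) ?nnegrE ?mulr_ge0 ?gdens_ge0//.
rewrite exprMn !gdens_sqr real_normK ?num_real// !sum22.
set a := M 0 0; set b := M 0 1; set c := M 1 0; set d := M 1 1.
set a' := N 0 0; set b' := N 0 1; set c' := N 1 0; set d' := N 1 1.
(* Lagrange's identity in R^5: the ten squares are the 2 by 2 minors of the pair [(1, M)],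
   [(1, N)]. *)
rewrite -subr_ge0 [leRHS](_ : _ = (a - a') ^+ 2 + (b - b') ^+ 2 +
  (c - c') ^+ 2 + (d - d') ^+ 2 + (a * b' - b * a') ^+ 2 +
  (a * c' - c * a') ^+ 2 + (a * d' - d * a') ^+ 2 + (b * c' - c * b') ^+ 2 +
  (b * d' - d * b') ^+ 2 + (c * d' - d * c') ^+ 2); last by ring.
by rewrite !addr_ge0// sqr_ge0.
Qed.

Lemma gdens_le_area M : gdens M <= Num.sqrt (1 + frobenius M ^+ 2 + (\det M) ^+ 2).
Proof. by rewrite /gdens ler_wsqrtr// lerDl sqr_ge0. Qed.

Context d (T : measurableType d).
Variable mu : {measure set T -> \bar R}.

Lemma measurable_gdens (D : set T) (F : T -> 'M[R]_2) :
  (forall i j, measurable_fun D (fun x => F x i j)) ->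
  measurable_fun D (fun x => gdens (F x)).
Proof.
move=> mF; rewrite (_ : (fun x => gdens (F x)) = Num.sqrt \o
    (fun x => 1 + \sum_(i < 2) \sum_(j < 2) F x i j ^+ 2)).
  apply: measurableT_comp.
    by apply: continuous_measurable_fun; exact: sqrt_continuous.
  apply: measurable_funD => //.
  rewrite (_ : (fun x => \sum_(i < 2) \sum_(j < 2) F x i j ^+ 2) = (fun x =>
    F x 0 0 ^+ 2 + F x 0 1 ^+ 2 + F x 1 0 ^+ 2 + F x 1 1 ^+ 2)).
    by do 3 (apply: measurable_funD; last by apply: measurable_funX); apply: measurable_funX.
  by apply/funext => x; rewrite sum22.
by apply/funext => x; rewrite /gdens frobenius_sqr.
Qed.

Lemma integrable_EFinD (D : set T) (f g : T -> R) : measurable D ->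
  mu.-integrable D (EFin \o f) -> mu.-integrable D (EFin \o g) ->
  mu.-integrable D (EFin \o (fun x => f x + g x)).
Proof. by move=> mD i1 i2; exact: (integrableD mD i1 i2). Qed.

Lemma gdens_le_sum M : gdens M <= 1 + \sum_(i < 2) \sum_(j < 2) `|M i j|.
Proof.
have := gdens_lipschitz M 0.
rewrite [gdens 0](_ : _ = 1); last first.
  rewrite /gdens frobenius_sqr !big1 ?addr0 ?sqrtr1// => i _.
  by rewrite big1// => j _; rewrite mxE expr0n.
congr (_ <= _ + _).
by apply: eq_bigr => i _; apply: eq_bigr => j _; rewrite mxE subr0.
Qed.

(* Jensen's inequality: test the left-hand vector against the integrand. *)
Lemma gdens_jensen (F : T -> 'M[R]_2) (k : T -> R) :
  measurable_fun setT k -> (forall x, 0 <= k x) ->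
  (\int[mu]_x (k x)%:E = 1)%E ->
  (forall i j, mu.-integrable setT (EFin \o (fun x => F x i j * k x))) ->
  measurable_fun setT (fun x => gdens (F x) * k x) ->
  ((gdens (\matrix_(i, j) \int[mu]_x (F x i j * k x)))%:E <=
   \int[mu]_x (gdens (F x) * k x)%:E)%E.
Proof.
move=> mk k0 k1 iF mg.
have ik : mu.-integrable setT (EFin \o k).
  apply/integrableP; split; first exact/measurable_EFinP.
  under eq_integral do rewrite /= ger0_norm//.
  by rewrite k1 ltry.
set C := \matrix_(i, j) _.
have C0 : 0 < gdens C by apply: lt_le_trans (gdens_ge1 _).
have iCF i j : mu.-integrable setT (EFin \o (fun x => C i j * (F x i j * k x))).
  exact: (integrableZl measurableT (C i j) (iF i j)).
have iS : mu.-integrable setT (EFin \o (fun x => k x +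
    (C 0 0 * (F x 0 0 * k x) + C 0 1 * (F x 0 1 * k x) +
     C 1 0 * (F x 1 0 * k x) + C 1 1 * (F x 1 1 * k x)))).
  by apply: integrable_EFinD => //; do 3 (apply: integrable_EFinD => //).
have ig : mu.-integrable setT (EFin \o (fun x => gdens (F x) * k x)).
  have iN i j : mu.-integrable setT (EFin \o (fun x => `|F x i j * k x|)).
    exact: integrable_norm.
  have iB : mu.-integrable setT (EFin \o (fun x => k x + (`|F x 0 0 * k x| +
      `|F x 0 1 * k x| + `|F x 1 0 * k x| + `|F x 1 1 * k x|))).
    by apply: integrable_EFinD => //; do 3 (apply: integrable_EFinD => //).
  apply: (le_integrable measurableT _ _ iB); first exact/measurable_EFinP.
  move=> x _; rewrite lee_fin ger0_norm; last by rewrite mulr_ge0// gdens_ge0.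
  apply: le_trans (ler_norm _); rewrite !normrM (ger0_norm (k0 x)).
  have := gdens_le_sum (F x); rewrite sum22 => /(ler_wpM2r (k0 x)).
  by rewrite mulrDl mul1r !mulrDl.
have SE : (\int[mu]_x (k x + (C 0 0 * (F x 0 0 * k x) + C 0 1 * (F x 0 1 * k x) +
     C 1 0 * (F x 1 0 * k x) + C 1 1 * (F x 1 1 * k x)))%:E)%E = (gdens C ^+ 2)%:E.
  have i2 := integrable_EFinD measurableT (iCF 0 0) (iCF 0 1).
  have i3 := integrable_EFinD measurableT i2 (iCF 1 0).
  have i4 := integrable_EFinD measurableT i3 (iCF 1 1).
  rewrite -[LHS]fineK; last exact: (integrable_fin_num measurableT iS).
  congr EFin; rewrite -/(Rintegral _ _ _) RintegralD// !RintegralD// !RintegralZl//.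
  rewrite gdens_sqr sum22; congr (_ + _); first by rewrite /Rintegral k1.
  by rewrite !expr2 !mxE.
(* [SE] evaluates the pairing with [C] to [gdens C ^ 2]. Cauchy-Schwarz bounds the same integrand
   pointwise, and one positive factor [gdens C] then cancels. *)
have key : ((gdens C ^+ 2)%:E <= (gdens C)%:E * \int[mu]_x (gdens (F x) * k x)%:E)%E.
  rewrite -SE -integralZl//; apply: le_integral => //.
    exact: (integrableZl measurableT (gdens C) ig).
  move=> x _; rewrite -EFinM lee_fin.
  have := gdens_cauchy_schwarz C (F x); rewrite sum22 => /(ler_wpM2r (k0 x)).
  rewrite -[gdens C * _ * _]mulrA => h; apply: le_trans h; rewrite le_eqVlt; apply/orP; left; apply/eqP.
  by ring.
have [r rE] : exists r, (\int[mu]_x (gdens (F x) * k x)%:E)%E = r%:E.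
  exists (fine (\int[mu]_x (gdens (F x) * k x)%:E)).
  by rewrite fineK//; exact: (integrable_fin_num measurableT ig).
by move: key; rewrite rE -EFinM !lee_fin expr2 ler_pM2l.
Qed.

End graph_density.

(** * The area bounds the integral of the mollified gradient *)

Section lower_bound.
Variable R : realType.
Implicit Types (x y : plane R) (eta : R -> R) (A Omega : set (plane R)).
Implicit Types (u v : plane R -> plane R).
Local Notation mu := (leb2 R).

Lemma det_mx22 (M : 'M[R]_2) : \det M = M 0 0 * M 1 1 - M 0 1 * M 1 0.
Proof.
rewrite (expand_det_row _ 0) !big_ord_recl big_ord0 addr0 /cofactor.
have l01 : lift ord0 ord0 = 1 :> 'I_2 by apply/val_inj.
rewrite [row' _ _]mx11_scalar det_scalar1 [X in \det X]mx11_scalar det_scalar1.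
rewrite !mxE l01 /= expr0 expr1 mul1r mulN1r mulrN.
have -> : lift (1 : 'I_2) (0 : 'I_1) = 0 :> 'I_2 by apply/val_inj.
by [].
Qed.

Lemma differentiable_coord2 (i : 'I_2) x : differentiable (@coord2 R i) x.
Proof.
rewrite /coord2; case: (i == 0).
  exact: differentiable_fst.
exact: differentiable_snd.
Qed.

Lemma C1_differentiable A v (i : 'I_2) x : C1 A v -> A x ->
  differentiable (coord2 i \o v) x.
Proof.
move=> Cv Ax; have [dv _] := Cv x Ax.
by apply: differentiable_comp => //; exact: differentiable_coord2.
Qed.

Lemma C1_is_derive A v (i j : 'I_2) x : C1 A v -> A x ->
  is_derive x (basis2 R j) (coord2 i \o v) (grad v x i j).
Proof.
move=> Cv Ax; rewrite mxE; apply: derivableP; apply: diff_derivable.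
exact: C1_differentiable Cv Ax.
Qed.

Lemma C1_continuous A v (i : 'I_2) x : C1 A v -> A x ->
  {for x, continuous (coord2 i \o v)}.
Proof.
by move=> Cv Ax; apply: differentiable_continuous; exact: C1_differentiable Cv Ax.
Qed.

Lemma C1_continuous_grad A v (i j : 'I_2) x : C1 A v -> A x ->
  {for x, continuous (fun y => grad v y i j)}.
Proof.
move=> Cv Ax; have [_ cv] := Cv x Ax.
rewrite (_ : (fun y => _) = partial j (coord2 i \o v)); first exact: cv.
by apply/funext => y; rewrite mxE.
Qed.

Lemma integrable_ext0 A (f : plane R -> R) : measurable A ->
  mu.-integrable A (EFin \o f) -> mu.-integrable setT (EFin \o (f \_ A)).
Proof.
move=> mA fA; rewrite -restrict_EFin.
by apply: (iffLR (integrable_mkcond _ _)) => //; exact: mA.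
Qed.

Lemma ext0E_support A (f k : plane R -> R) y : (~ A y -> k y = 0) ->
  (f \_ A) y * k y = f y * k y.
Proof.
rewrite patchE; case: ifPn => // /negP nA k0.
by rewrite k0 ?mulr0// => Ay; apply: nA; exact: mem_set.
Qed.

Lemma margin_kern0 e r eta x A y : mollifier e eta -> e < r -> margin A r x ->
  ~ A y -> kern eta x y = 0.
Proof.
move=> m er xA nA; apply: (kern_support m) => -[h1 h2]; apply: nA.
by apply: (square_margin er xA); split; apply: ltW.
Qed.

Lemma margin_dkern0 e r eta j x A y : mollifier e eta -> e < r -> margin A r x ->
  ~ A y -> dkern eta j x y = 0.
Proof.
move=> m er xA nA; apply: (dkern_support _ m) => h; apply: nA.
exact: (square_margin er xA).
Qed.

(** The kernel centred at [x] is a test function supported in [A], so cutting [u] off outside [A] is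
    invisible to it. The minus signs of [dmoll] and of the weak derivative cancel. *)
Lemma dmoll_weak_grad A Omega u G e r eta (i j : 'I_2) x : A `<=` Omega ->
  is_weak_grad Omega u G -> mollifier e eta -> e < r -> margin A r x ->
  dmoll eta j ((coord2 i \o u) \_ A) x = moll eta ((fun y => G y i j) \_ A) x.
Proof.
move=> AO /(_ i j)[_ wG] m er xA; have [se _ _ _ _] := m.
have xO : margin Omega r x by apply: subset_trans AO.
have := wG _ (test_function_kern m er xO).
rewrite [X in X = _ -> _](_ : _ = \int[mu]_y (((coord2 i \o u) \_ A) y * dkern eta j x y)).
  rewrite /dmoll => ->; rewrite opprK Rintegral_mkcond.
  apply: eq_Rintegral => y _; rewrite (ext0E_support _ (margin_kern0 m er xA)).
  rewrite patchE; case: ifPn => // /negP nO.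
  by rewrite (margin_kern0 m er xO) ?mulr0// => Oy; apply: nO; exact: mem_set.
rewrite Rintegral_mkcond; apply: eq_Rintegral => y _.
rewrite (ext0E_support _ (margin_dkern0 j m er xA)).
rewrite patchE; case: ifPn => [_|/negP nO]; first by rewrite partial_kern.
by rewrite (margin_dkern0 j m er xO) ?mulr0// => Oy; apply: nO; exact: mem_set.
Qed.

Lemma dmoll_C1 A v e r eta (i j : 'I_2) x : open A -> C1 A v ->
  mollifier e eta -> e < r -> margin A r x ->
  mu.-integrable setT (EFin \o (fun y => grad v y i j * kern eta x y)) /\
  dmoll eta j ((coord2 i \o v) \_ A) x = \int[mu]_y (grad v y i j * kern eta x y).
Proof.
move=> oA Cv m er xA.
have [_ i2 E] := integration_by_parts_kern oA
  (fun y Ay => @C1_is_derive A v i j y Cv Ay) (fun y Ay => @C1_continuous A v i y Cv Ay)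
  (fun y Ay => @C1_continuous_grad A v i j y Cv Ay) m er xA.
split=> //; rewrite -[RHS]opprK -E /dmoll; congr (- _).
by apply: eq_Rintegral => y _; rewrite (ext0E_support _ (margin_dkern0 j m er xA)).
Qed.

(** Jensen's inequality at every [x], with the kernel as probability density, followed by Tonelli in
    [x]. *)
Lemma area_ge_moll A v e r eta : open A -> C1 A v -> L1 A v ->
  mollifier e eta -> e < r ->
  (\int[mu]_(x in margin A r)
     (gdens (\matrix_(i, j) dmoll eta j ((coord2 i \o v) \_ A) x))%:E
   <= area v A)%E.
Proof.
move=> oA Cv Lv m er; have r0 : 0 < r by exact: lt_trans (mollifier_radius_gt0 m) er.
have mA : measurable A by exact: open_measurable_plane.
have mM : measurable (margin A r) by exact: measurable_margin.
have [se _ _ _ _] := m.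
have mgr i j : measurable_fun A (fun x => grad v x i j).
  by apply: measurable_fun_continuous_open => // x; exact: C1_continuous_grad.
have mgd : measurable_fun A (fun x => gdens (grad v x)) by exact: measurable_gdens.
pose F := (fun x => gdens (grad v x)) \_ A.
have F0 x : 0 <= F x by rewrite /F patchE; case: ifP => // _; exact: gdens_ge0.
have mF : measurable_fun setT F.
  by apply/(measurable_restrictT _ mA).
have iv i : mu.-integrable setT (EFin \o ((coord2 i \o v) \_ A)).
  exact: integrable_ext0.
have mFk : measurable_fun setT (fun x : plane R => \int[mu]_y (`|F y| * kern eta x y)%:E)%E.
  apply: (@measurable_fun_fubini_tonelli_F _ _ _ _ _ (leb2_sfm R)
    (fun z : plane R * plane R => (`|F z.2| * kern eta z.1 z.2)%:E)).
    apply/measurable_EFinP; apply: measurable_funM; last exact: measurable_kern.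
    have mFs : measurable_fun setT (fun z : plane R * plane R => F z.2).
      exact: measurableT_comp mF measurable_snd.
    exact: measurableT_comp mFs.
  by move=> z; rewrite lee_fin mulr_ge0// (kern_ge0 _ _ m).
have Fk0 (x : plane R) : (0 <= \int[mu]_y (`|F y| * kern eta x y)%:E)%E.
  by apply: integral_ge0 => y _; rewrite lee_fin mulr_ge0// (kern_ge0 _ _ m).
apply: (@le_trans _ _ (\int[mu]_(x in margin A r) \int[mu]_y (`|F y| * kern eta x y)%:E)%E).
  apply: ge0_le_integral => //.
  - by move=> x _; rewrite lee_fin gdens_ge0.
  - apply/measurable_EFinP; apply: measurable_gdens => i j.
    have E : (fun x : plane R => (\matrix_(a, b) dmoll eta b ((coord2 a \o v) \_ A) x
        : 'M[R]_2) i j) = dmoll eta j ((coord2 i \o v) \_ A).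
      by apply/funext => x; rewrite mxE.
    rewrite E; apply: measurable_funTS; apply: measurable_fun_continuous_open; first exact: openT.
    by move=> x _; have H := continuous_dmoll m (iv i); exact: H.
  - exact: measurable_funTS.
  - move=> x xA.
    have FE y : `|F y| * kern eta x y = gdens (grad v y) * kern eta x y.
      by rewrite ger0_norm// (ext0E_support _ (margin_kern0 m er xA)).
    rewrite (_ : \matrix_(i, j) _ = \matrix_(i, j) \int[mu]_y (grad v y i j * kern eta x y)).
      rewrite (_ : (\int[mu]_y (`|F y| * kern eta x y)%:E)%E =
        (\int[mu]_y (gdens (grad v y) * kern eta x y)%:E)%E); last first.
        by apply: eq_integral => y _; rewrite FE.
      apply: gdens_jensen.
      + exact: measurable_kernr.
      + by move=> y; exact: kern_ge0 m.
      + exact: integral_kern m.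
      + by move=> i j; have [] := dmoll_C1 i j oA Cv m er xA.
      + rewrite (_ : (fun _ => _) = (fun y => `|F y| * kern eta x y)); last first.
          by apply/funext => y; rewrite FE.
        by apply: measurable_funM; [exact: measurableT_comp|exact: measurable_kernr].
    by apply/matrixP => i j; rewrite !mxE; have [] := dmoll_C1 i j oA Cv m er xA.
(* Over the whole plane the kernel has mass one in [x], which leaves the integral of
   [gdens (grad v)] over [A]. *)
apply: (@le_trans _ _ (\int[mu]_x \int[mu]_y (`|F y| * kern eta x y)%:E)%E).
  exact: ge0_subset_integral.
rewrite (integral_kernel_norm m mF).
rewrite (_ : (\int[mu]_y `|F y|%:E)%E = (\int[mu]_(y in A) (gdens (grad v y))%:E)%E); last first.
  rewrite [RHS]integral_mkcond; apply: eq_integral => y _.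
  by rewrite ger0_norm// /F !patchE; case: ifP.
apply: ge0_le_integral => //.
- by move=> x _; rewrite lee_fin gdens_ge0.
- exact/measurable_EFinP.
- apply/measurable_EFinP.
  rewrite (_ : (fun _ => _) = Num.sqrt \o (fun x => gdens (grad v x) ^+ 2 +
      (grad v x 0 0 * grad v x 1 1 - grad v x 0 1 * grad v x 1 0) ^+ 2)); last first.
    by apply/funext => x /=; rewrite det_mx22 gdens_sqr frobenius_sqr.
  apply: measurableT_comp.
    by apply: continuous_measurable_fun; exact: sqrt_continuous.
  apply: measurable_funD; first exact: measurable_funX.
  by apply: measurable_funX; apply: measurable_funB; apply: measurable_funM; exact: mgr.
- by move=> x _; rewrite lee_fin gdens_le_area.
Qed.

End lower_bound.

Section limn_einf_bounds.
Variable R : realType.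
Local Open Scope ereal_scope.

Lemma limn_einf_ge (u : (\bar R)^nat) a K :
  (forall k, (K <= k)%N -> a <= u k) -> a <= limn_einf u.
Proof.
move=> au; rewrite limn_einf_lim; apply: lime_ge; first exact: is_cvg_einfs.
exists K => // n /= Kn; apply: le_ereal_inf_tmp => _ [k /= nk <-].
by apply: au; exact: leq_trans nk.
Qed.

Lemma limn_einf_le (u : (\bar R)^nat) b K :
  (forall k, (K <= k)%N -> u k <= b) -> limn_einf u <= b.
Proof.
move=> ub; rewrite limn_einf_lim; apply: lime_le; first exact: is_cvg_einfs.
near=> n; apply: ge_ereal_inf; exists (u (maxn n K)).
  by exists (maxn n K) => //=; rewrite leq_maxl.
by apply: ub; rewrite leq_maxr.
Unshelve. all: by end_near. Qed.

End limn_einf_bounds.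

Section integral_sum22.
Context d (T : measurableType d) (R : realType).
Variables (mu : {measure set T -> \bar R}) (D : set T) (mD : measurable D).

Lemma ge0_integral_EFinD (f g : T -> R) : measurable_fun D f ->
  measurable_fun D g -> (forall x, 0 <= f x) -> (forall x, 0 <= g x) ->
  (\int[mu]_(x in D) (f x + g x)%:E =
   \int[mu]_(x in D) (f x)%:E + \int[mu]_(x in D) (g x)%:E)%E.
Proof.
move=> mf mg f0 g0; under eq_integral do rewrite EFinD.
apply: ge0_integralD => //.
- by move=> x _; rewrite lee_fin.
- exact/measurable_EFinP.
- by move=> x _; rewrite lee_fin.
- exact/measurable_EFinP.
Qed.

Lemma ge0_integral_sum22 (E : 'I_2 -> 'I_2 -> T -> R) :
  (forall i j, measurable_fun D (E i j)) -> (forall i j x, 0 <= E i j x) ->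
  (\int[mu]_(x in D) (\sum_(i < 2) \sum_(j < 2) E i j x)%:E =
   \int[mu]_(x in D) (E 0 0 x)%:E + \int[mu]_(x in D) (E 0 1 x)%:E +
   \int[mu]_(x in D) (E 1 0 x)%:E + \int[mu]_(x in D) (E 1 1 x)%:E)%E.
Proof.
move=> mE E0; under eq_integral do rewrite sum22.
rewrite ge0_integral_EFinD//; first last.
- by move=> x; rewrite !addr_ge0.
- by do 2 apply: measurable_funD => //.
rewrite ge0_integral_EFinD//; first last.
- by move=> x; rewrite !addr_ge0.
- by apply: measurable_funD.
by rewrite ge0_integral_EFinD.
Qed.

End integral_sum22.

Section relaxed_area_lower.
Variable R : realType.
Implicit Types (x y : plane R) (eta : R -> R) (A Omega : set (plane R)).
Implicit Types (u v : plane R -> plane R).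
Local Notation mu := (leb2 R).

Lemma coord2_le_enorm (i : 'I_2) x : `|coord2 i x| <= enorm x.
Proof.
rewrite /enorm -sqrtr_sqr ler_wsqrtr// /coord2.
by case: ifP => _; rewrite ?lerDl ?lerDr sqr_ge0.
Qed.

Lemma coord2B (i : 'I_2) x y : coord2 i (x - y) = coord2 i x - coord2 i y.
Proof. by rewrite /coord2; case: ifP. Qed.

Lemma measurable_enorm d (T : measurableType d) (D : set T) (w : T -> plane R) :
  measurable_fun D (coord2 0 \o w) -> measurable_fun D (coord2 1 \o w) ->
  measurable_fun D (fun t => enorm (w t)).
Proof.
move=> m0 m1; rewrite (_ : (fun _ => _) = Num.sqrt \o
  (fun t => (coord2 0 \o w) t ^+ 2 + (coord2 1 \o w) t ^+ 2)); last by [].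
apply: measurableT_comp.
  by apply: continuous_measurable_fun; exact: sqrt_continuous.
by apply: measurable_funD; exact: measurable_funX.
Qed.

(** All derivatives fall on the fixed kernel, so [L^1] closeness of the functions becomes uniform
    closeness of their mollified gradients. *)
Lemma dmoll_lipschitz e eta C (j : 'I_2) x (g h : plane R -> R) : mollifier e eta ->
  0 <= C -> (forall j x y, `|dkern eta j x y| <= C) ->
  mu.-integrable setT (EFin \o g) -> mu.-integrable setT (EFin \o h) ->
  (`|dmoll eta j g x - dmoll eta j h x|%:E <=
    C%:E * \int[mu]_y `|g y - h y|%:E)%E.
Proof.
move=> m C0 HC ig ih; have [se _ _ _ _] := m.
have igh : mu.-integrable setT (EFin \o (fun y => g y - h y)).
  exact: (integrableB measurableT ig ih).
have ik := integrable_mul_dkern m j x igh.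
have -> : dmoll eta j g x - dmoll eta j h x =
    - \int[mu]_y ((g y - h y) * dkern eta j x y).
  rewrite /dmoll opprK addrC -opprB; congr (- _).
  rewrite -RintegralB//; [|exact: (integrable_mul_dkern m)..].
  by apply: eq_Rintegral => y _; rewrite mulrBl.
rewrite normrN.
have mgh := integrable_measurable igh.
rewrite -[leLHS]/(`|(Rintegral _ _ _)%:E|)%E /Rintegral fineK; last first.
  exact: (integrable_fin_num measurableT ik).
apply: le_trans (le_abse_integral _ measurableT (measurable_int _ ik)) _.
rewrite -ge0_integralZl//; last by apply/measurable_EFinP; exact: measurableT_comp.
apply: ge0_le_integral => //.
- apply/measurable_EFinP; apply: measurableT_comp => //.
  by apply: measurable_funM => //; exact: measurable_dkern.
- apply/measurable_EFinP; apply: measurable_funM => //; exact: measurableT_comp.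
- by move=> y _; rewrite -EFinM lee_fin /= normrM mulrC ler_wpM2r.
Qed.

(** The mollifier stays fixed while [k] grows; the boundary of [A] is approached last, through the
    margins. *)
Lemma relaxed_area_ge A Omega u G : open A -> (mu A < +oo)%E -> open Omega ->
  A `<=` Omega -> L1 A u -> is_weak_grad Omega u G ->
  (\int[mu]_(x in A) (gdens (G x))%:E <= relaxed_area u A)%E.
Proof.
move=> oA Afin oO AO Lu wG.
have mA : measurable A by exact: open_measurable_plane.
have mO : measurable Omega by exact: open_measurable_plane.
apply: le_ereal_inf_tmp => _ [v [Hv cv ->]].
pose g i j := (fun y => G y i j) \_ A.
have iGA i j : mu.-integrable A (EFin \o (fun y => G y i j)).
  by have [iG _] := wG i j; apply: integrableS iG.
have mG : measurable_fun A (fun x => gdens (G x)).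
  by apply: measurable_gdens => i j; exact: integrable_measurable (iGA i j).
have ig i j : mu.-integrable setT (EFin \o g i j) by exact: integrable_ext0.
have g0 i j x : ~ A x -> g i j x = 0 by move=> nA; rewrite /g patchE memNset.
have cg i j := moll_cvg_integrable oA Afin (ig i j) (@g0 i j).
have iu i : mu.-integrable setT (EFin \o ((coord2 i \o u) \_ A)).
  by apply: integrable_ext0.
have iv i k : mu.-integrable setT (EFin \o ((coord2 i \o v k) \_ A)).
  by apply: integrable_ext0 => //; have [_] := Hv k; exact.
have main r d : 0 < r -> 0 < d ->
    (\int[mu]_(x in margin A r) (gdens (G x))%:E <=
     limn_einf (fun k => area (v k) A) + d%:E)%E.
  move=> r0 d0.
  have mM : measurable (margin A r) by exact: measurable_margin.
  have MA : margin A r `<=` A by exact: margin_sub.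
  (* Four matrix entries at [d / 8] each make up [d / 2], half of the budget. *)
  have [rho [rho0 rhoP]] : exists rho : R, 0 < rho /\ forall e eta, e <= rho ->
      mollifier e eta -> forall i j,
      (\int[mu]_x `|moll eta (g i j) x - g i j x|%:E <= (d / 8)%:E)%E.
    have d8 : 0 < d / 8 by rewrite divr_gt0.
    have /choice[q qP] : forall ij : 'I_2 * 'I_2, exists q : R, 0 < q /\
        forall e eta, e <= q -> mollifier e eta ->
        (\int[mu]_x `|moll eta (g ij.1 ij.2) x - g ij.1 ij.2 x|%:E <= (d / 8)%:E)%E.
      by move=> [i j]; have [_ /(_ _ d8)] := cg i j.
    exists (\big[Num.min/1]_(ij : 'I_2 * 'I_2) q ij); split.
      by apply: lt_bigmin => // ij _; have [] := qP ij.
    move=> e eta eq m i j; have [_ Q] := qP (i, j); apply: (Q e eta) => //.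
    by apply: (le_trans eq); exact: (bigmin_le_cond _ (j := (i, j))).
  pose e := Num.min (r / 2) rho.
  have e0 : 0 < e by rewrite lt_min divr_gt0.
  have er : e < r by rewrite gt_min; apply/orP; left; lra.
  have [eta m] := mollifier_exists e0.
  have erho : e <= rho by rewrite ge_min lexx orbT.
  have cgd := rhoP e eta erho m.
  have [C [C0 _ HC _ _]] := kern_bounded m.
  have [a aE] : exists a, mu A = a%:E.
    by exists (fine (mu A)); rewrite fineK// ge0_fin_numE.
  have a0 : 0 <= a by rewrite -lee_fin -aE.
  (* Multiplied by [C] and summed over four entries, this [L^1] distance gives at most
     [d / (2 * (a + 1))] pointwise, hence at most [d / 2] after integration over a set of measure at
     most [a]. The added ones keep the divisors positive. *)
  have b0 : 0 < d / (8 * (C + 1) * (a + 1)).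
    by rewrite divr_gt0// !mulr_gt0 ?ltr_wpDl.
  have [K KP] : exists K, forall k, (K <= k)%N ->
      (\int[mu]_(x in A) (enorm (v k x - u x))%:E <= (d / (8 * (C + 1) * (a + 1)))%:E)%E.
    have /fine_cvgP[[K1 _ K1P] /cvgrPdist_le/(_ _ b0)[K2 _ K2P]] := cv.
    exists (maxn K1 K2) => k; rewrite geq_max => /andP[k1 k2].
    rewrite -[leLHS]fineK; last exact: K1P.
    have := K2P k k2; rewrite sub0r normrN lee_fin; apply: le_trans; exact: ler_norm.
  pose D k x : 'M[R]_2 := \matrix_(i, j) dmoll eta j ((coord2 i \o v k) \_ A) x.
  pose H x : R := \sum_(i < 2) \sum_(j < 2) `|moll eta (g i j) x - g i j x|.
  have mmg i j : measurable_fun setT (fun x => `|moll eta (g i j) x - g i j x|).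
    apply: measurableT_comp => //; apply: measurable_funB.
      exact: measurable_moll m (ig i j).
    exact: integrable_measurable (ig i j).
  have mH : measurable_fun setT H.
    rewrite /H (_ : (fun x => _) = (fun x => `|moll eta (g 0 0) x - g 0 0 x| +
      `|moll eta (g 0 1) x - g 0 1 x| + `|moll eta (g 1 0) x - g 1 0 x| +
      `|moll eta (g 1 1) x - g 1 1 x|)); last by apply/funext => x; rewrite sum22.
    by do 3 apply: measurable_funD => //.
  have H0 x : 0 <= H x by apply: sumr_ge0 => i _; apply: sumr_ge0.
  have HI : (\int[mu]_x (H x)%:E <= (d / 2)%:E)%E.
    have E i j : (0 <= \int[mu]_x `|moll eta (g i j) x - g i j x|%:E)%E.
      by apply: integral_ge0 => x _; rewrite lee_fin.
    rewrite ge0_integral_sum22//.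
    have -> : (d / 2)%:E = ((d / 8)%:E + (d / 8)%:E + (d / 8)%:E + (d / 8)%:E)%E.
      by rewrite -!EFinD; congr EFin; field.
    by do 3 (apply: leeD; last exact: cgd); exact: cgd.
  have Dm k : measurable_fun setT (fun x => gdens (D k x)).
    apply: measurable_gdens => i j.
    have -> : (fun x : plane R => D k x i j) = dmoll eta j ((coord2 i \o v k) \_ A).
      by apply/funext => x; rewrite mxE.
    apply: measurable_fun_continuous_open; first exact: openT.
    by move=> x _; have HH := continuous_dmoll m (iv i k); exact: HH.
  have pt k x : (K <= k)%N -> margin A r x ->
      gdens (G x) <= gdens (D k x) + H x + d / (2 * (a + 1)).
    move=> Kk xA; apply: le_trans (gdens_lipschitz (G x) (D k x)) _.
    rewrite -addrA lerD2l.
    have c0 : 0 <= d / (8 * (a + 1)) by rewrite divr_ge0 ?mulr_ge0 ?ltW// ltr_wpDl.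
    apply: (@le_trans _ _ (\sum_(i < 2) \sum_(j < 2)
       (`|moll eta (g i j) x - g i j x| + d / (8 * (a + 1))))); last first.
      rewrite /H !sum22 le_eqVlt; apply/orP; left; apply/eqP; field.
      by rewrite gt_eqF// ltr_wpDl.
    apply: ler_sum => i _; apply: ler_sum => j _.
    have -> : G x i j = g i j x by rewrite /g patchE mem_set//; exact: MA.
    rewrite mxE -(subrKA (moll eta (g i j) x)).
    apply: le_trans (ler_normD _ _) _; rewrite distrC lerD2l.
    rewrite -(dmoll_weak_grad i j AO wG m er xA) -lee_fin.
    apply: le_trans (dmoll_lipschitz _ _ m C0 HC (iu i) (iv i k)) _.
    apply: (@le_trans _ _ (C%:E * (d / (8 * (C + 1) * (a + 1)))%:E)%E).
      apply: lee_pmul => //; first by apply: integral_ge0 => y _; rewrite lee_fin.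
      apply: le_trans (KP k Kk); rewrite [leRHS]integral_mkcond.
      have [_ Lv] := Hv k.
      have mcv l : measurable_fun A (coord2 l \o (fun z => v k z - u z)).
        rewrite (_ : _ \o _ = (fun z => (coord2 l \o v k) z - (coord2 l \o u) z)).
          apply: measurable_funB; first exact: integrable_measurable (Lv l).
          exact: integrable_measurable (Lu l).
        by apply/funext => z; rewrite /= coord2B.
      apply: ge0_le_integral => //.
      - apply/measurable_EFinP; apply: measurableT_comp => //; apply: measurable_funB.
          exact: integrable_measurable (iu i).
        exact: integrable_measurable (iv i k).
      - apply/(measurable_restrictT _ mA).
        by apply/measurable_EFinP; apply: measurable_enorm.
      - move=> y _; rewrite !patchE; case: ifPn => _; last by rewrite subrr normr0.
        by rewrite lee_fin distrC -coord2B coord2_le_enorm.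
    have C1 : 0 < C + 1 by rewrite ltr_wpDl.
    have a1 : 0 < a + 1 by rewrite ltr_wpDl.
    rewrite -EFinM lee_fin.
    rewrite (_ : C * _ = d / (8 * (a + 1)) * (C / (C + 1))); last first.
      by field; rewrite !gt_eqF.
    by rewrite ler_piMr// ler_pdivrMr// mul1r lerDl.
  rewrite -leeBlDr//; apply: (@limn_einf_ge _ _ _ K) => k Kk; rewrite leeBlDr//.
  have [Cv Lv] := Hv k.
  have c0 : 0 <= d / (2 * (a + 1)) by rewrite divr_ge0 ?mulr_ge0 ?ltW// ltr_wpDl.
  have mDk : measurable_fun (margin A r) (fun x => gdens (D k x)).
    by apply: measurable_funTS; exact: Dm.
  have mHk : measurable_fun (margin A r) H by exact: measurable_funTS.
  have mDH : measurable_fun (margin A r) (fun x => gdens (D k x) + H x).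
    exact: measurable_funD.
  have DH0 x : 0 <= gdens (D k x) + H x by rewrite addr_ge0// gdens_ge0.
  apply: (@le_trans _ _ (\int[mu]_(x in margin A r)
      (gdens (D k x) + H x + d / (2 * (a + 1)))%:E)%E).
    apply: ge0_le_integral => //.
    - by move=> x _; rewrite lee_fin gdens_ge0.
    - by apply/measurable_EFinP; exact: measurable_funS mG.
    - by apply/measurable_EFinP; exact: measurable_funD.
    - by move=> x xA; rewrite lee_fin; exact: pt.
  rewrite ge0_integral_EFinD// ge0_integral_EFinD//; last by move=> x; exact: gdens_ge0.
  rewrite -addeA; apply: leeD; first exact: (area_ge_moll oA Cv Lv m er).
  rewrite [d%:E](_ : _ = (d / 2)%:E + (d / 2)%:E)%E; last by rewrite -EFinD -splitr.
  apply: leeD.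
    apply: le_trans HI; apply: ge0_subset_integral => //.
    - exact/measurable_EFinP.
    - by move=> x _; rewrite lee_fin.
  rewrite integral_cst//.
  apply: (@le_trans _ _ ((d / (2 * (a + 1)))%:E * mu A)%E).
    rewrite lee_wpmul2l ?lee_fin//.
    by apply: le_measure; rewrite ?inE; [exact: mM|exact: mA|exact: MA].
  rewrite aE -EFinM lee_fin.
  have a1 : 0 < a + 1 by rewrite ltr_wpDl.
  rewrite (_ : _ * a = d / 2 * (a / (a + 1))); last by field; rewrite gt_eqF.
  apply: ler_piMr; first by rewrite divr_ge0// ltW.
  by rewrite ler_pdivrMr// mul1r lerDl.
have main' r : 0 < r -> (\int[mu]_(x in margin A r) (gdens (G x))%:E <=
     limn_einf (fun k => area (v k) A))%E.
  by move=> r0; apply/lee_addgt0Pr => d d0; exact: main.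
(* The margins now increase to [A], by monotone convergence. *)
rewrite [X in (\int[_]_(x in X) _)%E](open_bigcup_margin oA).
have nM := nondecreasing_margin A.
have mM n : measurable (margin A n.+1%:R^-1).
  by apply: measurable_margin; rewrite invr_gt0.
have cvM : (\int[mu]_(x in margin A n.+1%:R^-1) (gdens (G x))%:E)%E @[n --> \oo] -->
    (\int[mu]_(x in \bigcup_n margin A n.+1%:R^-1) (gdens (G x))%:E)%E.
  apply: ge0_nondecreasing_set_cvg_integral => //.
  - move=> n; apply/measurable_EFinP; apply: measurable_funS mG => //.
    by apply: margin_sub; rewrite invr_gt0.
  - by move=> n x _; rewrite lee_fin gdens_ge0.
rewrite -(cvg_lim (@ereal_hausdorff R) cvM); apply: lime_le.
  by apply/cvg_ex; eexists; exact: cvM.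
by near=> n; apply: main'; rewrite invr_gt0.
Unshelve. all: by end_near. Qed.

End relaxed_area_lower.

(** * Tangency of the weak gradient to the circle *)

Section small_products.
Context d (T : measurableType d) (R : realType).
Variables (mu : {measure set T -> \bar R}) (D : set T) (mD : measurable D).

Import HBSimple.

Lemma sfun_bounded (s : {sfun T >-> R}) : exists2 B, 0 <= B & forall x, `|s x| <= B.
Proof.
have [B /= [_ BP]] := simple_bounded s.
exists `|B + 1| => // x; apply: (BP `|B + 1|) => //.
by apply: lt_le_trans (ler_norm _); rewrite ltrDl.
Qed.

(** A bounded factor that is small in [L^1] makes the product with a fixed integrable [h] small: [h]
    is replaced by a bounded simple function, and the bound [C] absorbs the difference. This
    replaces a product estimate for [h] that is merely integrable. *)
Lemma small_integral_mul (h : T -> R) (C e : R) : mu.-integrable D (EFin \o h) ->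
  0 <= C -> 0 < e -> exists2 r : R, 0 < r & forall g : T -> R,
  measurable_fun D g -> (forall x, D x -> `|g x| <= C) ->
  (\int[mu]_(x in D) `|g x|%:E <= r%:E)%E ->
  (\int[mu]_(x in D) `|g x * h x|%:E <= e%:E)%E.
Proof.
move=> ih C0 e0; have [|s [is_ _ sh]] := approximation_sfun_integrable _ ih.
  exact: mD.
have C1 : 0 < C + 1 by rewrite ltr_wpDl.
have e1 : 0 < e / (2 * (C + 1)) by rewrite divr_gt0// mulr_gt0.
have [n nP] : exists n, (\int[mu]_(x in D) `|h x - s n x|%:E <= (e / (2 * (C + 1)))%:E)%E.
  have /fine_cvgP[[m _ mfin] /cvgrPdist_le/(_ _ e1)[p _ pP]] := sh.
  exists (maxn m p); rewrite -[leLHS]fineK; last exact: (mfin (maxn m p) (leq_maxl _ _)).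
  have := pP (maxn m p) (leq_maxr _ _); rewrite sub0r normrN lee_fin.
  by apply: le_trans; exact: ler_norm.
have [B B0 BP] := sfun_bounded (s n).
have B1 : 0 < B + 1 by rewrite ltr_wpDl.
exists (e / (2 * (B + 1))) => [|g mg gC gr]; first by rewrite divr_gt0// mulr_gt0.
have mh : measurable_fun D h by move/measurable_int/measurable_EFinP : ih.
have ms : measurable_fun D (s n) by exact: measurable_funTS.
have mn (f : T -> R) : measurable_fun D f -> measurable_fun D (fun x => `|f x|).
  by move=> mf; exact: measurableT_comp.
have m1 : measurable_fun D (fun x => (B + 1) * `|g x|).
  by apply: measurable_funM => //; exact: mn.
have m2 : measurable_fun D (fun x => (C + 1) * `|h x - s n x|).
  by apply: measurable_funM => //; apply: mn; exact: measurable_funB.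
apply: (@le_trans _ _ (\int[mu]_(x in D) ((B + 1) * `|g x| + (C + 1) * `|h x - s n x|)%:E)%E).
  apply: ge0_le_integral => //.
  - by apply/measurable_EFinP; apply: mn; exact: measurable_funM.
  - by apply/measurable_EFinP; exact: measurable_funD.
  - move=> x Dx; rewrite lee_fin.
    have -> : g x * h x = s n x * g x + g x * (h x - s n x) by ring.
    apply: le_trans (ler_normD _ _) _; rewrite !normrM.
    apply: lerD; rewrite ler_wpM2r//.
      by rewrite (le_trans (BP x))// lerDl.
    by rewrite (le_trans (gC x Dx))// lerDl.
rewrite ge0_integral_EFinD//; try by move=> x; rewrite mulr_ge0// ltW.
rewrite (splitr e) EFinD.
have pull (c : R) (f : T -> R) : 0 < c -> measurable_fun D f ->
    (\int[mu]_(x in D) (c * `|f x|)%:E = c%:E * \int[mu]_(x in D) `|f x|%:E)%E.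
  move=> c0 mf; under eq_integral do rewrite EFinM.
  rewrite ge0_integralZl//.
  - by apply/measurable_EFinP; exact: mn.
  - by rewrite lee_fin ltW.
rewrite !pull//; last exact: measurable_funB.
apply: leeD.
  apply: (@le_trans _ _ ((B + 1)%:E * (e / (2 * (B + 1)))%:E)%E).
    by rewrite lee_wpmul2l// lee_fin ltW.
  by rewrite -EFinM lee_fin le_eqVlt; apply/orP; left; apply/eqP; field; rewrite gt_eqF.
apply: (@le_trans _ _ ((C + 1)%:E * (e / (2 * (C + 1)))%:E)%E).
  by rewrite lee_wpmul2l// lee_fin ltW.
by rewrite -EFinM lee_fin le_eqVlt; apply/orP; left; apply/eqP; field; rewrite gt_eqF.
Qed.

Lemma Rintegral_dist_le (f g h : T -> R) (r : R) : mu.-integrable D (EFin \o f) ->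
  mu.-integrable D (EFin \o g) -> measurable_fun D h ->
  (forall x, D x -> `|f x - g x| <= h x) ->
  (\int[mu]_(x in D) (h x)%:E <= r%:E)%E ->
  `|\int[mu]_(x in D) f x - \int[mu]_(x in D) g x| <= r.
Proof.
move=> i1 i2 mh fgh hr; rewrite -RintegralB//.
have i12 : mu.-integrable D (EFin \o (fun x => f x - g x)).
  exact: (integrableB mD i1 i2).
rewrite -lee_fin; apply: le_trans hr.
rewrite -[leLHS]/(`|(Rintegral _ _ _)%:E|)%E /Rintegral fineK; last first.
  exact: (integrable_fin_num mD i12).
apply: le_trans (le_abse_integral _ mD (measurable_int _ i12)) _.
apply: ge0_le_integral => //.
- by apply: measurableT_comp => //; exact: measurable_int i12.
- exact/measurable_EFinP.
Qed.

Lemma integral_scale_le (c b : R) (f : T -> R) : 0 <= c -> measurable_fun D f ->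
  (forall x, 0 <= f x) -> (\int[mu]_(x in D) (f x)%:E <= b%:E)%E ->
  (\int[mu]_(x in D) (c * f x)%:E <= (c * b)%:E)%E.
Proof.
move=> c0 mf f0 fb; under eq_integral do rewrite EFinM.
rewrite ge0_integralZl//; [|exact/measurable_EFinP|by move=> x _; rewrite lee_fin].
by rewrite EFinM lee_wpmul2l.
Qed.

End small_products.

Section circle_valued.
Variable R : realType.
Implicit Types (x y : plane R) (eta : R -> R).
Local Notation mu := (leb2 R).

Lemma ord2P (i : 'I_2) : i = 0 \/ i = 1.
Proof. by case: i => -[|[|]]// p; [left|right]; exact/val_inj. Qed.

Lemma radius_forall (P : 'I_2 -> R -> Prop) :
  (forall i, exists q, 0 < q /\ forall e, e <= q -> P i e) ->
  exists q, 0 < q /\ forall e, e <= q -> forall i, P i e.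
Proof.
move=> /choice[q qP]; exists (Num.min (q 0) (q 1)).
have [q0 P0] := qP 0; have [q1 P1] := qP 1.
split; first by rewrite lt_min q0 q1.
move=> e; rewrite le_min => /andP[h0 h1] i.
by have [->|->] := ord2P i; [exact: P0|exact: P1].
Qed.

Lemma moll_norm_le1 e eta (g : plane R -> R) x : mollifier e eta ->
  mu.-integrable setT (EFin \o g) -> (forall y, `|g y| <= 1) ->
  `|moll eta g x| <= 1.
Proof.
move=> m ig g1; have [se _ _ _ _] := m.
rewrite -lee_fin; apply: le_trans (norm_moll_le x m ig) _.
rewrite -(integral_kern x m); apply: ge0_le_integral => //.
- by move=> y _; rewrite lee_fin mulr_ge0// (kern_ge0 _ _ m).
- apply/measurable_EFinP; apply: measurable_funM; last exact: measurable_kernr.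
  by apply: measurableT_comp => //; exact: integrable_measurable ig.
- by apply/measurable_EFinP; exact: measurable_kernr.
- by move=> y _; rewrite lee_fin ler_piMl// (kern_ge0 _ _ m).
Qed.

Variables (Omega : set (plane R)) (u : plane R -> plane R) (G : plane R -> 'M[R]_2).
Hypotheses (oO : open Omega) (Ofin : (mu Omega < +oo)%E) (Lu : L1 Omega u)
  (wG : is_weak_grad Omega u G) (circ : forall x, Omega x -> circle (u x)).

Definition uext (i : 'I_2) := (coord2 i \o u) \_ Omega.
Definition gext (i j : 'I_2) := (fun y => G y i j) \_ Omega.

Let mO : measurable Omega. Proof. exact: open_measurable_plane. Qed.

Lemma integrable_uext i : mu.-integrable setT (EFin \o uext i).
Proof. exact: integrable_ext0. Qed.

Lemma integrable_gext i j : mu.-integrable setT (EFin \o gext i j).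
Proof. by apply: integrable_ext0 => //; have [] := wG i j. Qed.

Lemma uext_out i x : ~ Omega x -> uext i x = 0.
Proof. by move=> nO; rewrite /uext patchE memNset. Qed.

Lemma gext_out i j x : ~ Omega x -> gext i j x = 0.
Proof. by move=> nO; rewrite /gext patchE memNset. Qed.

Lemma uext_circle x : Omega x -> uext 0 x ^+ 2 + uext 1 x ^+ 2 = 1.
Proof.
move=> Ox; rewrite /uext !patchE mem_set//= /coord2/=.
have := circ Ox; rewrite /circle/= /enorm => /(congr1 (fun t => t ^+ 2)).
by rewrite expr1n sqr_sqrtr// addr_ge0// sqr_ge0.
Qed.

Lemma uext_sqr_le1 x : uext 0 x ^+ 2 + uext 1 x ^+ 2 <= 1.
Proof.
have [Ox|nO] := pselect (Omega x); first by rewrite uext_circle.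
by rewrite !uext_out// expr0n addr0.
Qed.

Lemma uext_le1 i x : `|uext i x| <= 1.
Proof.
have h := uext_sqr_le1 x.
rewrite -(@expr_le1 _ 2)// real_normK ?num_real//.
have [->|->] := ord2P i.
  by apply: le_trans h; rewrite lerDl sqr_ge0.
by apply: le_trans h; rewrite lerDr sqr_ge0.
Qed.

Lemma moll_cvg_uext i : moll_cvg (uext i).
Proof.
by apply: (moll_cvg_integrable oO Ofin); [exact: integrable_uext|exact: uext_out].
Qed.

Lemma moll_cvg_gext i j : moll_cvg (gext i j).
Proof.
by apply: (moll_cvg_integrable oO Ofin); [exact: integrable_gext|exact: gext_out].
Qed.

Lemma measurable_uext i : measurable_fun setT (uext i).
Proof. exact: integrable_measurable (integrable_uext i). Qed.

Lemma measurable_gext i j : measurable_fun setT (gext i j).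
Proof. exact: integrable_measurable (integrable_gext i j). Qed.

(** Half the formal [j]-th derivative of [|u|^2]. *)
Definition normal_part (j : 'I_2) y := uext 0 y * gext 0 j y + uext 1 y * gext 1 j y.

Lemma integrable_uext_gext i j :
  mu.-integrable setT (EFin \o (fun y => gext i j y * uext i y)).
Proof.
apply: (@integrable_mul_bounded _ _ _ mu setT _ _ 1) => //.
- exact: integrable_gext.
- exact: measurable_uext.
- by move=> x _; exact: uext_le1.
Qed.

Lemma integrable_normal_part j : mu.-integrable setT (EFin \o normal_part j).
Proof.
rewrite (_ : normal_part j = (fun y => gext 0 j y * uext 0 y + gext 1 j y * uext 1 y)).
  by apply: integrable_EFinD => //; exact: integrable_uext_gext.
by apply/funext => y; rewrite /normal_part !(mulrC (uext _ _)).
Qed.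

Lemma moll_cvg_uext_gext t : 0 < t -> exists q : R, 0 < q /\
  forall e, e <= q -> forall i j k eta, mollifier e eta ->
  [/\ (\int[mu]_x `|moll eta (uext k) x - uext k x|%:E <= t%:E)%E,
      (\int[mu]_x `|moll eta (gext i j) x - gext i j x|%:E <= t%:E)%E &
      (\int[mu]_x `|(moll eta (uext k) x - uext k x) * gext i j x|%:E <= t%:E)%E].
Proof.
move=> t0; apply: radius_forall => i; apply: radius_forall => j; apply: radius_forall => k.
(* [2] bounds a mollified coordinate minus the coordinate itself, both being at most one in absolute
   value. *)
have [s s0 sP] := small_integral_mul measurableT
  (integrable_gext i j) (ler0n _ 2) t0.
have [_ /(_ _ t0)[q1 [q10 Q1]]] := moll_cvg_uext k.
have [_ /(_ _ s0)[q2 [q20 Q2]]] := moll_cvg_uext k.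
have [_ /(_ _ t0)[q3 [q30 Q3]]] := moll_cvg_gext i j.
have iU := integrable_uext k.
exists (Num.min q1 (Num.min q2 q3)); split; first by rewrite !lt_min q10 q20 q30.
move=> e; rewrite !le_min => /and3P[h1 h2 h3] eta m'; split.
- exact: Q1 m'.
- exact: Q3 m'.
- apply: sP; last exact: Q2 m'.
    apply: measurable_funB; last exact: measurable_uext.
    exact: measurable_moll m' iU.
  move=> y _; apply: le_trans (ler_normB _ _) _.
  apply: lerD; last exact: uext_le1.
  by apply: moll_norm_le1 m' iU _ => z; exact: uext_le1.
Qed.

(* [|u|^2] is constant, so the mollified [u_n] satisfy [grad |u_n|^2 -> 0]
   weakly, while [d_j |u_n|^2 = 2 u_n . d_j u_n -> 2 u . d_j u]. *)
Lemma moll_normal_part (j : 'I_2) x e r eta : mollifier e eta -> e < r ->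
  margin Omega r x -> moll eta (normal_part j) x = 0.
Proof.
move=> m er xO; have [se _ _ _ _] := m.
have e0 := mollifier_radius_gt0 m.
apply/eqP; rewrite -normr_eq0; apply/eqP; apply/le_anti; rewrite normr_ge0 andbT.
apply/ler_addgt0Pr => d d0; rewrite add0r.
have [C [C0 HK HD _ _]] := kern_bounded m.
have C1 : 0 < C + 1 by rewrite ltr_wpDl.
(* The two comparisons [b1] and [b2] cost [4 * C * t] and [8 * C * t]; together they stay below
   [d]. *)
pose t := d / (16 * (C + 1)).
have t0 : 0 < t by rewrite divr_gt0// mulr_gt0.
have [q [q0 qP]] := moll_cvg_uext_gext t0.
(* A second mollifier regularises [u]. Its radius is below [r - e], so that its gradient formula
   holds at every point reached by the outer kernel around [x]. *)
pose e' := Num.min ((r - e) / 2) q.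
have e'0 : 0 < e' by rewrite lt_min q0 divr_gt0// subr_gt0.
have e'q : e' <= q by rewrite ge_min lexx orbT.
have [eta' m'] := mollifier_exists e'0.
have er' : e' < r - e.
  by rewrite gt_min ltr_pdivrMr ?ltr_pMr ?subr_gt0// ltr1n.
have [U0 G0 P0] := qP _ e'q 0 j 0 _ m'.
have [U1 G1 P1] := qP _ e'q 1 j 1 _ m'.
pose W i := moll eta' (uext i); pose dW i := dmoll eta' j (uext i).
have W1 i y : `|W i y| <= 1.
  by apply: (moll_norm_le1 _ m' (integrable_uext i)) => z; exact: uext_le1.
have dWG i y : kern eta x y != 0 -> dW i y = moll eta' (gext i j) y.
  move=> k0; apply: (dmoll_weak_grad i j (@subset_refl _ Omega) wG m' er').
  have xy : ball x e y by apply: contrapT => /(kern_support m) k1; rewrite k1 eqxx in k0.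
  move=> z; rewrite plane_ballE => -[z1 z2]; apply: xO.
  move: xy; rewrite !plane_ballE => -[x1 x2]; split.
    by rewrite (le_lt_trans (ler_distD y.1 _ _))//; lra.
  by rewrite (le_lt_trans (ler_distD y.2 _ _))//; lra.
have Wc i : continuous (W i) by exact: (continuous_moll m' (integrable_uext i)).
have dWc i : continuous (dW i).
  by have H := continuous_dmoll m' (j := j) (integrable_uext i); exact: H.
pose f y := W 0 y * W 0 y + W 1 y * W 1 y.
pose df y := 2 * (W 0 y * dW 0 y + W 1 y * dW 1 y).
have Df y : is_derive y (basis2 R j) f (df y).
  have D i := is_derive_moll m' j y (integrable_uext i).
  have D2 := is_deriveD (is_deriveM (D 0) (D 0)) (is_deriveM (D 1) (D 1)).
  by move: D2; congr (is_derive _ _ _ _); rewrite /df/W/dW/= /GRing.scale/=; ring.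
have cf : continuous f.
  by move=> y; apply: cvgD; apply: cvgM; exact: Wc.
have cdf : continuous df.
  by move=> y; apply: cvgMr; apply: cvgD; apply: cvgM; [exact: Wc|exact: dWc|exact: Wc|exact: dWc].
have xT : margin setT r x by [].
have [i1 i2 E1] := integration_by_parts_kern openT (fun y _ => Df y)
  (fun y _ => cf y) (fun y _ => cdf y) m er xT.
have cc (c : R) : continuous (cst c : plane R -> R) by move=> y; exact: cst_continuous.
have D1 y : is_derive y (basis2 R j) (cst (1 : R)) 0 by exact: is_derive_cst.
have [i3 _ E2] := integration_by_parts_kern openT (fun y _ => D1 y)
  (fun y _ => cc 1 y) (fun y _ => cc 0 y) m er xT.
(* Since constants integrate to zero against [dkern], [f] may be replaced by [f - 1], and [1] is
   [|u|^2] on [Omega]. *)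
have E3 : \int[mu]_y (1 * dkern eta j x y) = 0 :> R.
  rewrite E2 (_ : (fun y => _) = (fun=> 0)); last first.
    by apply/funext => y; rewrite mul0r.
  by rewrite /Rintegral integral0 oppr0.
have mW i : measurable_fun setT (W i) by exact: (measurable_moll m' (integrable_uext i)).
have mMG i : measurable_fun setT (moll eta' (gext i j)).
  exact: (measurable_moll m' (integrable_gext i j)).
have mn (h : plane R -> R) : measurable_fun setT h -> measurable_fun setT (fun y => `|h y|).
  by move=> mh; exact: measurableT_comp.
have mU i : measurable_fun setT (fun y => `|W i y - uext i y|).
  by apply: mn; apply: measurable_funB; [exact: mW|exact: measurable_uext].
have mP i : measurable_fun setT (fun y => `|(W i y - uext i y) * gext i j y|).
  apply: mn; apply: measurable_funM; last exact: measurable_gext.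
  by apply: measurable_funB; [exact: mW|exact: measurable_uext].
have mQ i : measurable_fun setT (fun y => `|moll eta' (gext i j) y - gext i j y|).
  by apply: mn; apply: measurable_funB; [exact: mMG|exact: measurable_gext].
have mUU : measurable_fun setT (fun y => `|W 0 y - uext 0 y| + `|W 1 y - uext 1 y|).
  exact: measurable_funD (mU 0) (mU 1).
have mQP i : measurable_fun setT (fun y =>
    `|moll eta' (gext i j) y - gext i j y| + `|(W i y - uext i y) * gext i j y|).
  exact: measurable_funD (mQ i) (mP i).
have mQQ : measurable_fun setT (fun y =>
    `|moll eta' (gext 0 j) y - gext 0 j y| + `|(W 0 y - uext 0 y) * gext 0 j y| +
    (`|moll eta' (gext 1 j) y - gext 1 j y| + `|(W 1 y - uext 1 y) * gext 1 j y|)).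
  exact: measurable_funD (mQP 0) (mQP 1).
have b1 : `|\int[mu]_y (f y * dkern eta j x y) - \int[mu]_y (1 * dkern eta j x y)|
    <= (2 * C) * (t + t).
  apply: (@Rintegral_dist_le _ _ R mu setT measurableT _ _
    (fun y => (2 * C) * (`|W 0 y - uext 0 y| + `|W 1 y - uext 1 y|))) => //.
  - by apply: measurable_funM => //; exact: mUU.
  - move=> y _; rewrite -mulrBl normrM.
    have [Oy|nO] := pselect (Omega y); last first.
      by rewrite (margin_dkern0 j m er xO nO) normr0 mulr0 !mulr_ge0// addr_ge0.
    rewrite [leRHS]mulrAC; apply: ler_pM => //.
    rewrite -[X in `|_ - X|](uext_circle Oy) /f.
    have -> : W 0 y * W 0 y + W 1 y * W 1 y - (uext 0 y ^+ 2 + uext 1 y ^+ 2) =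
      (W 0 y - uext 0 y) * (W 0 y + uext 0 y) + (W 1 y - uext 1 y) * (W 1 y + uext 1 y).
      by ring.
    have h i : `|(W i y - uext i y) * (W i y + uext i y)| <= `|W i y - uext i y| * 2.
      rewrite normrM ler_wpM2l//; apply: le_trans (ler_normD _ _) _.
      by apply: le_trans (lerD (W1 i y) (uext_le1 i y)) _.
    by rewrite [leRHS]mulrDr !(mulrC 2); apply: le_trans (ler_normD _ _) (lerD (h 0) (h 1)).
  - apply: (@integral_scale_le _ _ R mu setT measurableT (2 * C) (t + t)
      (fun y => `|W 0 y - uext 0 y| + `|W 1 y - uext 1 y|)).
    + by rewrite mulr_ge0.
    + exact: mUU.
    + by move=> y; exact: addr_ge0.
    + rewrite ge0_integral_EFinD; [exact: (leeD U0 U1)|exact: measurableT|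
        exact: mU|exact: mU|by []|by []].
have b2 : `|\int[mu]_y (df y * kern eta x y) -
     \int[mu]_y ((2 * normal_part j y) * kern eta x y)| <= (2 * C) * ((t + t) + (t + t)).
  apply: (@Rintegral_dist_le _ _ R mu setT measurableT _ _
    (fun y => (2 * C) * ((`|moll eta' (gext 0 j) y - gext 0 j y| +
       `|(W 0 y - uext 0 y) * gext 0 j y|) + (`|moll eta' (gext 1 j) y - gext 1 j y| +
       `|(W 1 y - uext 1 y) * gext 1 j y|)))) => //.
  - apply: (integrable_mul_kern m x).
    by have := integrableZl measurableT 2 (integrable_normal_part j); exact.
  - apply: measurable_funM => //; exact: mQQ.
  - move=> y _; rewrite -mulrBl normrM.
    have [->|k0] := eqVneq (kern eta x y) 0.
      by rewrite normr0 mulr0 !mulr_ge0// !addr_ge0.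
    rewrite [leRHS]mulrAC; apply: ler_pM => //.
    rewrite /df /normal_part !dWG//.
    have -> (a b k l a2 b2 k2 l2 : R) : 2 * (a * b + k * l) - 2 * (a2 * b2 + k2 * l2) =
      2 * ((a * (b - b2) + (a - a2) * b2) + (k * (l - l2) + (k - k2) * l2)) by ring.
    rewrite normrM ger0_norm// ler_wpM2l//.
    apply: le_trans (ler_normD _ _) _; apply: lerD; apply: le_trans (ler_normD _ _) _.
      by rewrite lerD2r normrM ler_piMl.
    by rewrite lerD2r normrM ler_piMl.
  - apply: (@integral_scale_le _ _ R mu setT measurableT (2 * C) (t + t + (t + t))
      (fun y => `|moll eta' (gext 0 j) y - gext 0 j y| +
       `|(W 0 y - uext 0 y) * gext 0 j y| + (`|moll eta' (gext 1 j) y - gext 1 j y| +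
       `|(W 1 y - uext 1 y) * gext 1 j y|))).
    + by rewrite mulr_ge0.
    + exact: mQQ.
    + by move=> y; rewrite !addr_ge0.
    + rewrite ge0_integral_EFinD; [|exact: measurableT|exact: mQP|exact: mQP|
        by move=> y; rewrite addr_ge0|by move=> y; rewrite addr_ge0].
      rewrite EFinD; apply: leeD.
        rewrite ge0_integral_EFinD; [exact: (leeD G0 P0)|exact: measurableT|
          exact: mQ|exact: mP|by []|by []].
      rewrite ge0_integral_EFinD; [exact: (leeD G1 P1)|exact: measurableT|
        exact: mQ|exact: mP|by []|by []].
have E4 : \int[mu]_y ((2 * normal_part j y) * kern eta x y) = 2 * moll eta (normal_part j) x.
  rewrite /moll -RintegralZl//; last exact: (integrable_mul_kern m x (integrable_normal_part j)).
  by apply: eq_Rintegral => y _; rewrite mulrA.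
move: b1 b2; rewrite E1 E3 E4 subr0 normrN => b1 b2.
have tC : t * (C + 1) = d / 16 by rewrite /t; field; rewrite gt_eqF.
have Ct : C * t <= d / 16 by rewrite -tC mulrC ler_pM2l// lerDl.
have : `|2 * moll eta (normal_part j) x| <= 12 * (C * t).
  rewrite -[X in `|X|](subrK (\int[mu]_y (df y * kern eta x y))) -opprB.
  apply: le_trans (ler_normD _ _) _; rewrite normrN; move: b1 b2; lra.
rewrite normrM ger0_norm//; move: Ct d0; lra.
Qed.

End circle_valued.

Section tangency.
Variable R : realType.
Local Notation mu := (leb2 R).
Variables (Omega : set (plane R)) (u : plane R -> plane R) (G : plane R -> 'M[R]_2).
Hypotheses (oO : open Omega) (Ofin : (mu Omega < +oo)%E) (Lu : L1 Omega u)
  (wG : is_weak_grad Omega u G) (circ : forall x, Omega x -> circle (u x)).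

(** On this margin the mollifications of the normal part vanish for every radius below [r], while
    they converge to it in [L^1]. *)
Lemma normal_part_margin j r : 0 < r ->
  (\int[mu]_(x in margin Omega r) `|(normal_part Omega u G j x)%:E| = 0)%E.
Proof.
move=> r0; set h := normal_part Omega u G j.
have ih : mu.-integrable setT (EFin \o h) by exact: integrable_normal_part.
have mh := integrable_measurable ih.
have [_ ch] : moll_cvg h.
  apply: (moll_cvg_integrable oO Ofin ih) => x nO.
  by rewrite /h /normal_part !uext_out// !mul0r addr0.
apply/le_anti/andP; split; last by apply: integral_ge0 => x _; exact: abse_ge0.
apply/lee_addgt0Pr => d d0; rewrite add0e.
have [s [s0 sP]] := ch _ d0.
pose e := Num.min s (r / 2).
have e0 : 0 < e by rewrite lt_min s0 divr_gt0.
have er : e < r by rewrite gt_min ltr_pdivrMr// ltr_pMr// ltr1n orbT.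
have [eta m] := mollifier_exists e0.
have es : e <= s by rewrite ge_min lexx.
apply: le_trans (sP _ _ es m).
have mm : measurable (margin Omega r) by exact: measurable_margin.
have mf : measurable_fun setT (fun x => `|moll eta h x - h x|%:E).
  apply/measurable_EFinP; apply: measurableT_comp => //; apply: measurable_funB => //.
  exact: measurable_moll m ih.
rewrite (@eq_integral _ _ _ mu (margin Omega r) (fun x => `|moll eta h x - h x|%:E)).
  by apply: ge0_subset_integral; [exact: mm|exact: measurableT|exact: mf| |].
move=> x; rewrite inE => xm.
by rewrite /= (moll_normal_part oO Ofin Lu wG circ j m er xm) sub0r normrN.
Qed.

Lemma normal_part_ae j : {ae mu, forall x, normal_part Omega u G j x = 0}.
Proof.
set h := normal_part Omega u G j.
have ih : mu.-integrable setT (EFin \o h) by exact: integrable_normal_part.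
pose N n := [set x | margin Omega n.+1%:R^-1 x /\ h x != 0].
have : mu.-negligible (\bigcup_n N n).
  apply: negligible_bigcup => n.
  have r0 : 0 < n.+1%:R^-1 :> R by rewrite invr_gt0.
  have mm : measurable (margin Omega n.+1%:R^-1) by exact: measurable_margin.
  have mh : measurable_fun (margin Omega n.+1%:R^-1) (EFin \o h).
    exact: measurable_funTS (measurable_int _ ih).
  have := iffLR (ae_eq_integral_abs mu mm mh) (normal_part_margin j r0).
  apply: negligibleS => x [xm hx] /= /(_ xm)/= [h0].
  by rewrite h0 eqxx in hx.
apply: negligibleS => x /= /eqP hx.
have [Ox|nO] := pselect (Omega x); last first.
  by move: hx; rewrite /h /normal_part !uext_out// !mul0r addr0 eqxx.
by move: Ox; rewrite (open_bigcup_margin oO) => -[n _ xn]; exists n.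
Qed.

End tangency.

(** * Retraction onto the circle away from a pole *)

Section reflection_algebra.
Variable R : realType.

(* In complex notation, [- conj q * w ^ 2 / |w| ^ 2]: with [w = z - r q] and
   [|z| = |q| = 1] this is close to [z] when [r] is close to [1], except near
   [z = q]. *)
Definition refl0 (q1 q2 w1 w2 : R) : R :=
  - (q1 * (w1 ^+ 2 - w2 ^+ 2) + 2 * q2 * w1 * w2) / (w1 ^+ 2 + w2 ^+ 2).
Definition refl1 (q1 q2 w1 w2 : R) : R :=
  - (2 * q1 * w1 * w2 - q2 * (w1 ^+ 2 - w2 ^+ 2)) / (w1 ^+ 2 + w2 ^+ 2).

Definition poisson (r a1 a2 z1 z2 : R) : R := (r ^+ 2 - 1) / ((z1 - a1) ^+ 2 + (z2 - a2) ^+ 2).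

Lemma refl_sqr (q1 q2 w1 w2 : R) : q1 ^+ 2 + q2 ^+ 2 = 1 -> w1 ^+ 2 + w2 ^+ 2 != 0 ->
  refl0 q1 q2 w1 w2 ^+ 2 + refl1 q1 q2 w1 w2 ^+ 2 = 1.
Proof. by move=> q w; rewrite -[RHS]q /refl0 /refl1; field. Qed.

(** The component of [z - (1 + d) q] along [q] is at most [-d]. The condition [q . z <= 1] covers
    the mollified values inside the disc as well as points of the circle. *)
Lemma pole_dist_ge (q1 q2 d z1 z2 : R) : q1 ^+ 2 + q2 ^+ 2 = 1 -> 0 <= d ->
  q1 * z1 + q2 * z2 <= 1 ->
  d ^+ 2 <= (z1 - (1 + d) * q1) ^+ 2 + (z2 - (1 + d) * q2) ^+ 2.
Proof.
move=> q d0 qz.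
have -> : (z1 - (1 + d) * q1) ^+ 2 + (z2 - (1 + d) * q2) ^+ 2 =
   ((q1 * z1 + q2 * z2) - (1 + d) * (q1 ^+ 2 + q2 ^+ 2)) ^+ 2 +
   (q1 * z2 - q2 * z1) ^+ 2 + (z1 ^+ 2 + z2 ^+ 2 + (1 + d) ^+ 2 * (q1 ^+ 2 + q2 ^+ 2) -
    2 * (1 + d) * (q1 * z1 + q2 * z2)) * (1 - (q1 ^+ 2 + q2 ^+ 2)) by ring.
rewrite q subrr mulr0 addr0 mulr1.
apply: (@le_trans _ _ ((q1 * z1 + q2 * z2 - (1 + d)) ^+ 2)); last by rewrite lerDl sqr_ge0.
by rewrite -[leRHS]sqrrN ler_pXn2r ?nnegrE//; lra.
Qed.

(** With [t = q . z] and [w = z - (1 + d) q], the left-hand side equals [2 d^2 (1 + t) / |w|^2] and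
    the right-hand side [2 d^2 (2 + d) / |w|^2]. *)
Lemma refl_near (q1 q2 d z1 z2 : R) : q1 ^+ 2 + q2 ^+ 2 = 1 -> z1 ^+ 2 + z2 ^+ 2 = 1 ->
  0 < d ->
  (refl0 q1 q2 (z1 - (1 + d) * q1) (z2 - (1 + d) * q2) - z1) ^+ 2 +
  (refl1 q1 q2 (z1 - (1 + d) * q1) (z2 - (1 + d) * q2) - z2) ^+ 2 <=
  2 * d * poisson (1 + d) ((1 + d) * q1) ((1 + d) * q2) z1 z2.
Proof.
move=> q z d0; set w1 := z1 - _; set w2 := z2 - _.
pose t := q1 * z1 + q2 * z2.
have t1 : t <= 1.
  have : 0 <= (q1 - z1) ^+ 2 + (q2 - z2) ^+ 2 by rewrite addr_ge0// sqr_ge0.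
  have -> : (q1 - z1) ^+ 2 + (q2 - z2) ^+ 2 =
    (q1 ^+ 2 + q2 ^+ 2) + (z1 ^+ 2 + z2 ^+ 2) - 2 * t by rewrite /t; ring.
  by rewrite q z; lra.
have D0 : 0 < w1 ^+ 2 + w2 ^+ 2.
  by apply: lt_le_trans (pole_dist_ge q (ltW d0) t1); rewrite exprn_gt0.
have Dn : w1 ^+ 2 + w2 ^+ 2 != 0 by rewrite gt_eqF.
have D : w1 ^+ 2 + w2 ^+ 2 = 1 - 2 * (1 + d) * t + (1 + d) ^+ 2.
  have -> : w1 ^+ 2 + w2 ^+ 2 = (z1 ^+ 2 + z2 ^+ 2) - 2 * (1 + d) * t +
    (1 + d) ^+ 2 * (q1 ^+ 2 + q2 ^+ 2) by rewrite /w1 /w2 /t; ring.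
  by rewrite z q mulr1.
pose X := z1 * (q1 * (w1 ^+ 2 - w2 ^+ 2) + 2 * q2 * w1 * w2) +
  z2 * (2 * q1 * w1 * w2 - q2 * (w1 ^+ 2 - w2 ^+ 2)).
have EX : X = t - 2 * (1 + d) + (1 + d) ^+ 2 * t.
  have -> : X = (z1 ^+ 2 + z2 ^+ 2) * t -
     2 * (1 + d) * (z1 ^+ 2 + z2 ^+ 2) * (q1 ^+ 2 + q2 ^+ 2) +
     (1 + d) ^+ 2 * (q1 ^+ 2 + q2 ^+ 2) * t by rewrite /X /w1 /w2 /t; ring.
  by rewrite q z; ring.
have -> : (refl0 q1 q2 w1 w2 - z1) ^+ 2 + (refl1 q1 q2 w1 w2 - z2) ^+ 2 =
    (refl0 q1 q2 w1 w2 ^+ 2 + refl1 q1 q2 w1 w2 ^+ 2) + (z1 ^+ 2 + z2 ^+ 2) +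
    2 * (X / (w1 ^+ 2 + w2 ^+ 2)).
  by rewrite /refl0 /refl1 /X; field.
rewrite refl_sqr// z EX /poisson -/w1 -/w2 [leRHS]mulrA ler_pdivlMr//.
have -> (y : R) : (1 + 1 + 2 * (y / (w1 ^+ 2 + w2 ^+ 2))) * (w1 ^+ 2 + w2 ^+ 2) =
    2 * (w1 ^+ 2 + w2 ^+ 2) + 2 * y by field.
rewrite D.
have h : 0 <= d ^+ 2 * (1 - t) by rewrite mulr_ge0 ?sqr_ge0 ?subr_ge0.
have h3 : 0 <= d * d ^+ 2 by rewrite mulr_ge0 ?sqr_ge0 ?ltW.
by move: h h3 (d0); nra.
Qed.

(** The left-hand side is the square of twice the derivative of the argument of [z - a]. A tangent
    vector is [m = s (- z2, z1)], and [2 (1 - a . z) = |z - a|^2 + 1 - |a|^2] on the circle, which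
    produces the factor [1 - P]. *)
Lemma refl_tangent (r a1 a2 z1 z2 m1 m2 : R) : a1 ^+ 2 + a2 ^+ 2 = r ^+ 2 ->
  z1 ^+ 2 + z2 ^+ 2 = 1 -> z1 * m1 + z2 * m2 = 0 ->
  (z1 - a1) ^+ 2 + (z2 - a2) ^+ 2 != 0 ->
  (2 * ((z1 - a1) * m2 - (z2 - a2) * m1) / ((z1 - a1) ^+ 2 + (z2 - a2) ^+ 2)) ^+ 2 =
  (1 - poisson r a1 a2 z1 z2) ^+ 2 * (m1 ^+ 2 + m2 ^+ 2).
Proof.
move=> a z t D0; pose s := z1 * m2 - z2 * m1.
have e1 : m1 = - s * z2.
  have -> : - s * z2 = m1 * (z1 ^+ 2 + z2 ^+ 2) - z1 * (z1 * m1 + z2 * m2) by rewrite /s; ring.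
  by rewrite z t mulr1 mulr0 subr0.
have e2 : m2 = s * z1.
  have -> : s * z1 = m2 * (z1 ^+ 2 + z2 ^+ 2) - z2 * (z1 * m1 + z2 * m2) by rewrite /s; ring.
  by rewrite z t mulr1 mulr0 subr0.
have -> : m1 ^+ 2 + m2 ^+ 2 = s ^+ 2.
  by rewrite e1 e2 -[RHS]mulr1 -z; ring.
rewrite /poisson -a -exprMn; congr (_ ^+ 2).
have -> : (1 - (a1 ^+ 2 + a2 ^+ 2 - 1) / ((z1 - a1) ^+ 2 + (z2 - a2) ^+ 2)) * s =
    (((z1 - a1) ^+ 2 + (z2 - a2) ^+ 2) - (a1 ^+ 2 + a2 ^+ 2 - 1)) * s /
    ((z1 - a1) ^+ 2 + (z2 - a2) ^+ 2) by field.
congr (_ / _); move: (s) e1 e2 => t' -> ->; rewrite -[X in (_ - (_ - X)) * _]z; ring.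
Qed.

End reflection_algebra.

Section reflection_estimates.
Variable R : realType.

Lemma normr_le_sqr (x y : R) : 0 <= y -> x ^+ 2 <= y ^+ 2 -> `|x| <= y.
Proof. by move=> y0; rewrite -[x ^+ 2]real_normK ?num_real// ler_pXn2r ?nnegrE. Qed.

(** Together with [inv0 w2 w1], the coordinates of the inversion [w / |w|^2]. [slope], [refl0] and
    [refl1] are polynomials in these, [w], [q] and the direction. *)
Definition inv0 (w1 w2 : R) : R := w1 / (w1 ^+ 2 + w2 ^+ 2).

Lemma inv0_le (d w1 w2 : R) : 0 < d -> d ^+ 2 <= w1 ^+ 2 + w2 ^+ 2 ->
  `|inv0 w1 w2| <= d^-1.
Proof.
move=> d0 dw; have D0 : 0 < w1 ^+ 2 + w2 ^+ 2 by apply: lt_le_trans dw; rewrite exprn_gt0.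
apply: normr_le_sqr; first by rewrite invr_ge0 ltW.
rewrite exprVn (@le_trans _ _ (w1 ^+ 2 + w2 ^+ 2)^-1)//; last first.
  by rewrite lef_pV2 ?posrE ?exprn_gt0.
rewrite /inv0 expr_div_n ler_pdivrMr ?exprn_gt0// expr2 mulKf ?gt_eqF//.
by rewrite expr2 lerDl sqr_ge0.
Qed.

(** The inversion maps [w] and [y] to points at distance [|w - y| / (|w| |y|)]. *)
Lemma inv0_lipschitz (d w1 w2 y1 y2 : R) : 0 < d ->
  d ^+ 2 <= w1 ^+ 2 + w2 ^+ 2 -> d ^+ 2 <= y1 ^+ 2 + y2 ^+ 2 ->
  `|inv0 w1 w2 - inv0 y1 y2| <= (`|w1 - y1| + `|w2 - y2|) / d ^+ 2.
Proof.
move=> d0 dw dy; have d2 : 0 < d ^+ 2 by rewrite exprn_gt0.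
have D0 : 0 < w1 ^+ 2 + w2 ^+ 2 by exact: lt_le_trans dw.
have E0 : 0 < y1 ^+ 2 + y2 ^+ 2 by exact: lt_le_trans dy.
apply: normr_le_sqr; first by rewrite divr_ge0 ?addr_ge0// ltW.
apply: (@le_trans _ _ ((inv0 w1 w2 - inv0 y1 y2) ^+ 2 + (inv0 w2 w1 - inv0 y2 y1) ^+ 2)).
  by rewrite lerDl sqr_ge0.
have -> : (inv0 w1 w2 - inv0 y1 y2) ^+ 2 + (inv0 w2 w1 - inv0 y2 y1) ^+ 2 =
   ((w1 - y1) ^+ 2 + (w2 - y2) ^+ 2) / ((w1 ^+ 2 + w2 ^+ 2) * (y1 ^+ 2 + y2 ^+ 2)).
  rewrite /inv0 (addrC (w2 ^+ 2)) (addrC (y2 ^+ 2)); field.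
  by rewrite !gt_eqF.
rewrite expr_div_n; apply: ler_pM.
- by rewrite addr_ge0 ?sqr_ge0.
- by rewrite invr_ge0 mulr_ge0 ?ltW.
- have -> : (`|w1 - y1| + `|w2 - y2|) ^+ 2 =
    (w1 - y1) ^+ 2 + (w2 - y2) ^+ 2 + 2 * (`|w1 - y1| * `|w2 - y2|).
    by rewrite -[(w1 - y1) ^+ 2]real_normK ?num_real// -[(w2 - y2) ^+ 2]real_normK ?num_real//; ring.
  by rewrite lerDl !mulr_ge0.
- by rewrite lef_pV2 ?posrE ?mulr_gt0 ?exprn_gt0// expr2 ler_pM// ltW.
Qed.

Lemma mul_dist_le (a b a' b' A B da db : R) : `|a| <= A -> `|b'| <= B ->
  `|a - a'| <= da -> `|b - b'| <= db -> `|a * b - a' * b'| <= A * db + da * B.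
Proof.
move=> hA hB ha hb.
have -> : a * b - a' * b' = a * (b - b') + (a - a') * b' by ring.
by apply: le_trans (ler_normD _ _) _; rewrite !normrM lerD// ler_pM.
Qed.

(** Twice the derivative of the argument of [w] in the direction [m]: the angular speed of the
    reflected map, whose argument is a constant plus twice that of [w]. *)
Definition slope (w1 w2 m1 m2 : R) : R :=
  2 * (w1 * m2 - w2 * m1) / (w1 ^+ 2 + w2 ^+ 2).

Lemma slope_dist_le (d w1 w2 y1 y2 m1 m2 n1 n2 : R) : 0 < d ->
  d ^+ 2 <= w1 ^+ 2 + w2 ^+ 2 -> d ^+ 2 <= y1 ^+ 2 + y2 ^+ 2 ->
  `|slope w1 w2 m1 m2 - slope y1 y2 n1 n2| <=
  2 * ((`|m1 - n1| + `|m2 - n2|) / d +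
    (`|w1 - y1| + `|w2 - y2|) / d ^+ 2 * (`|n1| + `|n2|)).
Proof.
move=> d0 dw dy.
have E a b p q : slope a b p q = 2 * (inv0 a b * q - inv0 b a * p).
  by rewrite /slope /inv0 (addrC (b ^+ 2)); ring.
rewrite !E -mulrBr normrM ger0_norm// ler_pM2l//.
have dw' : d ^+ 2 <= w2 ^+ 2 + w1 ^+ 2 by rewrite addrC.
have dy' : d ^+ 2 <= y2 ^+ 2 + y1 ^+ 2 by rewrite addrC.
have h2 := mul_dist_le (inv0_le d0 dw) (lexx `|n2|) (inv0_lipschitz d0 dw dy) (lexx `|m2 - n2|).
have h1 := mul_dist_le (inv0_le d0 dw') (lexx `|n1|) (inv0_lipschitz d0 dw' dy') (lexx `|m1 - n1|).
have -> : inv0 w1 w2 * m2 - inv0 w2 w1 * m1 - (inv0 y1 y2 * n2 - inv0 y2 y1 * n1) =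
  (inv0 w1 w2 * m2 - inv0 y1 y2 * n2) - (inv0 w2 w1 * m1 - inv0 y2 y1 * n1) by ring.
apply: le_trans (ler_normB _ _) _; apply: le_trans (lerD h2 h1) _.
by rewrite (addrC `|w2 - y2|) le_eqVlt; apply/orP; left; apply/eqP; ring.
Qed.

(** Each quotient of a product of two coordinates by [|w|^2] is a coordinate times a coordinate of
    the inversion, and moves by at most [K]. Four of them occur, counted with their coefficients. *)
Lemma refl_dist_le (d q1 q2 w1 w2 y1 y2 B : R) : 0 < d ->
  `|q1| <= 1 -> `|q2| <= 1 -> `|w1| <= B -> `|w2| <= B ->
  d ^+ 2 <= w1 ^+ 2 + w2 ^+ 2 -> d ^+ 2 <= y1 ^+ 2 + y2 ^+ 2 ->
  `|refl0 q1 q2 w1 w2 - refl0 q1 q2 y1 y2| <=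
    4 * (B / d ^+ 2 + d^-1) * (`|w1 - y1| + `|w2 - y2|) /\
  `|refl1 q1 q2 w1 w2 - refl1 q1 q2 y1 y2| <=
    4 * (B / d ^+ 2 + d^-1) * (`|w1 - y1| + `|w2 - y2|).
Proof.
move=> d0 hq1 hq2 hw1 hw2 dw dy.
have dw' : d ^+ 2 <= w2 ^+ 2 + w1 ^+ 2 by rewrite addrC.
have dy' : d ^+ 2 <= y2 ^+ 2 + y1 ^+ 2 by rewrite addrC.
set D := `|w1 - y1| + `|w2 - y2|; set K := (B / d ^+ 2 + d^-1) * D.
have D1 : `|w1 - y1| <= D by rewrite lerDl.
have D2 : `|w2 - y2| <= D by rewrite lerDr.
have i1 := inv0_lipschitz d0 dw dy.
have i2 := inv0_lipschitz d0 dw' dy'.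
rewrite (addrC `|w2 - y2|) -/D in i2; rewrite -/D in i1.
have KE : B * (D / d ^+ 2) + D * d^-1 = K by rewrite /K; ring.
have h11 := mul_dist_le hw1 (inv0_le d0 dy) D1 i1.
have h12 := mul_dist_le hw1 (inv0_le d0 dy') D1 i2.
have h22 := mul_dist_le hw2 (inv0_le d0 dy') D2 i2.
rewrite !KE in h11 h12 h22.
have E0 (a b : R) : refl0 q1 q2 a b =
    - (q1 * (a * inv0 a b - b * inv0 b a) + 2 * (q2 * (a * inv0 b a))).
  by rewrite /refl0 /inv0 (addrC (b ^+ 2)); ring.
have E1 (a b : R) : refl1 q1 q2 a b =
    - (2 * (q1 * (a * inv0 b a)) - q2 * (a * inv0 a b - b * inv0 b a)).
  by rewrite /refl1 /inv0 (addrC (b ^+ 2)); ring.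
have comb (p q X Y Z : R) : `|p| <= 1 -> `|q| <= 1 -> `|X| <= K -> `|Y| <= K -> `|Z| <= K ->
    `|p * (X - Y) + 2 * (q * Z)| <= 4 * K.
  move=> hp hq hX hY hZ; apply: le_trans (ler_normD _ _) _; rewrite !normrM (ger0_norm (ler0n R 2)).
  have : `|p| * `|X - Y| <= K + K.
    apply: (@le_trans _ _ `|X - Y|); first by rewrite ler_piMl.
    by apply: le_trans (ler_normB _ _) _; exact: lerD.
  have : `|q| * `|Z| <= K by apply: le_trans hZ; rewrite ler_piMl.
  lra.
rewrite -!mulrA -/K !E0 !E1; split.
  rewrite -normrN.
  have -> : forall a b c a' b' c' : R, - (- (q1 * (a - b) + 2 * (q2 * c)) -
     - (q1 * (a' - b') + 2 * (q2 * c'))) =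
     q1 * ((a - a') - (b - b')) + 2 * (q2 * (c - c')) by move=> *; ring.
  exact: comb.
have -> : forall a b c a' b' c' : R, - (2 * (q1 * c) - q2 * (a - b)) -
     - (2 * (q1 * c') - q2 * (a' - b')) =
     q2 * ((a - a') - (b - b')) + 2 * ((- q1) * (c - c')) by move=> *; ring.
by apply: comb; rewrite ?normrN.
Qed.

End reflection_estimates.

(** * Poisson kernels of poles spread along an arc *)

Section poisson_estimates.
Variable R : realType.

(** The gradient of a circle-valued map is a unit tangent times a row of slopes. Putting this row
    first and a zero row below keeps the Frobenius norm, so that [gdens] serves as area density. *)
Definition slope_mx (w1 w2 : R) (M : 'M[R]_2) : 'M[R]_2 :=
  \matrix_(i, j) if i == 0 then slope w1 w2 (M 0 j) (M 1 j) else 0.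

Lemma poisson_ge0 (r a1 a2 z1 z2 : R) : 1 <= r -> 0 <= poisson r a1 a2 z1 z2.
Proof.
move=> r1; apply: divr_ge0; last by rewrite addr_ge0// sqr_ge0.
rewrite subr_ge0 -[X in X <= _](expr1n _ 2).
by rewrite ler_pXn2r ?nnegrE// (le_trans ler01).
Qed.

(** Tangent columns are scaled by [1 - P], and under the root both [(1 - P)^2] and the constant [1]
    are dominated by [(1 + P)^2]. *)
Lemma gdens_slope_le (r a1 a2 z1 z2 : R) (M : 'M[R]_2) : 1 <= r ->
  a1 ^+ 2 + a2 ^+ 2 = r ^+ 2 -> z1 ^+ 2 + z2 ^+ 2 = 1 ->
  (z1 - a1) ^+ 2 + (z2 - a2) ^+ 2 != 0 ->
  (forall j, z1 * M 0 j + z2 * M 1 j = 0) ->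
  gdens (slope_mx (z1 - a1) (z2 - a2) M) <= (1 + poisson r a1 a2 z1 z2) * gdens M.
Proof.
move=> r1 a z D0 t; have P0 := poisson_ge0 a1 a2 z1 z2 r1.
rewrite -(ler_pXn2r (ltn0Sn 1)) ?nnegrE ?mulr_ge0 ?addr_ge0 ?gdens_ge0//.
rewrite exprMn !gdens_sqr !sum22 !mxE/=.
rewrite !(refl_tangent a z (t _) D0) expr0n/= !addr0.
set P := poisson _ _ _ _ _ in P0 *.
have := sqr_ge0 (M 0 0); have := sqr_ge0 (M 0 1).
have := sqr_ge0 (M 1 0); have := sqr_ge0 (M 1 1).
move: (M 0 0 ^+ 2) (M 0 1 ^+ 2) (M 1 0 ^+ 2) (M 1 1 ^+ 2) => x y v w w0 v0 y0 x0.
have S0 : 0 <= x + y + v + w by rewrite !addr_ge0.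
have h1 : (1 - P) ^+ 2 <= (1 + P) ^+ 2.
  have e : (1 + P) ^+ 2 - (1 - P) ^+ 2 = 4 * P by ring.
  by rewrite -subr_ge0 e mulr_ge0.
have h2 : 1 <= (1 + P) ^+ 2 by rewrite expr_ge1 ?addr_ge0// lerDl.
rewrite [leRHS]mulrDr mulr1.
have -> : 1 + ((1 - P) ^+ 2 * (x + v) + (1 - P) ^+ 2 * (y + w)) =
   1 + (1 - P) ^+ 2 * (x + y + v + w) by ring.
by rewrite lerD// ler_wpM2r.
Qed.

(* Telescoping: [1 / (1 + s^2) <= 4 (phi (s + 1) - phi s)] with [|phi| <= 1]. *)
Lemma sum_cauchy_le (t : R) n : \sum_(i < n) (1 + (t - i%:R) ^+ 2)^-1 <= 8.
Proof.
pose phi (s : R) := s / (1 + `|s|).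
have n0 (s : R) : 0 < 1 + `|s| by rewrite ltr_pwDl.
have phi1 s : `|phi s| <= 1.
  by rewrite normrM normfV (gtr0_norm (n0 s)) ler_pdivrMr// mul1r lerDr.
have step s : (1 + s ^+ 2)^-1 <= 4 * (phi (s + 1) - phi s).
  have d0 : 0 < 1 + s ^+ 2 by rewrite ltr_pwDl// sqr_ge0.
  rewrite -[X in X <= _]mul1r ler_pdivrMr// /phi.
  have [s0|s0] := leP 0 s.
    rewrite !ger0_norm ?addr_ge0//.
    have -> : 4 * ((s + 1) / (1 + (s + 1)) - s / (1 + s)) * (1 + s ^+ 2) =
        4 * (1 + s ^+ 2) / ((1 + (s + 1)) * (1 + s)).
      by field; rewrite !gt_eqF//; lra.
    rewrite ler_pdivlMr ?mul1r; last by apply: mulr_gt0; lra.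
    by have := sqr_ge0 (s - 1); nra.
  rewrite (ltr0_norm s0).
  have [s1|s1] := leP 0 (s + 1).
    rewrite ger0_norm//.
    have -> : 4 * ((s + 1) / (1 + (s + 1)) - s / (1 - s)) * (1 + s ^+ 2) =
        4 * (1 - 2 * s * (s + 1)) * (1 + s ^+ 2) / ((1 + (s + 1)) * (1 - s)).
      by field; rewrite !gt_eqF//; lra.
    rewrite ler_pdivlMr ?mul1r; last by apply: mulr_gt0; lra.
    have h : 0 <= - s * (s + 1) by rewrite mulr_ge0//; lra.
    apply: (@le_trans _ _ (4 * (1 - 2 * s * (s + 1)))); first nra.
    by rewrite ler_peMr ?lerDl ?sqr_ge0//; nra.
  rewrite ltr0_norm//.
  have -> : 4 * ((s + 1) / (1 - (s + 1)) - s / (1 - s)) * (1 + s ^+ 2) =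
      4 * (1 + s ^+ 2) / (- s * (1 - s)).
    by field; do ?[apply/andP; split]; apply/eqP => h; lra.
  rewrite ler_pdivlMr ?mul1r; last by apply: mulr_gt0; lra.
  by have := sqr_ge0 (s + 1); nra.
apply: (@le_trans _ _ (\sum_(i < n) 4 * (phi (t - i%:R + 1) - phi (t - i%:R)))).
  by apply: ler_sum => i _; exact: step.
have -> : \sum_(i < n) 4 * (phi (t - i%:R + 1) - phi (t - i%:R)) =
    4 * (phi (t + 1) - phi (t - n%:R + 1)).
  elim: n => [|n IH]; first by rewrite big_ord0 subr0 subrr mulr0.
  have e : t - n.+1%:R + 1 = t - n%:R by rewrite -natr1; ring.
  by rewrite big_ord_recr/= IH -mulrDr e addrA subrK.
have := phi1 (t + 1); have := phi1 (t - n%:R + 1); rewrite !ler_norml; lra.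
Qed.

(* The poles lie on the circle of radius [1 + 1/N], on the side of [- s], with
   second coordinates [0, 1/(2N), 2/(2N), ...]. *)
Definition pole0 (s : R) (N : nat) (i : nat) : R :=
  - s * Num.sqrt ((1 + N%:R^-1) ^+ 2 - (i%:R / (2 * N%:R)) ^+ 2).
Definition pole1 (N : nat) (i : nat) : R := i%:R / (2 * N%:R).

Lemma pole1_bound N i : (i < N)%N -> 0 <= pole1 N i <= 2^-1.
Proof.
move=> iN; have N0 : 0 < N%:R :> R by rewrite ltr0n (leq_ltn_trans _ iN).
rewrite divr_ge0 ?mulr_ge0 ?ler0n//= ler_pdivrMr ?mulr_gt0// mulKf ?pnatr_eq0//.
by rewrite ler_nat ltnW.
Qed.

Lemma pole_sqr s N i : s ^+ 2 = 1 -> (i < N)%N ->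
  pole0 s N i ^+ 2 + pole1 N i ^+ 2 = (1 + N%:R^-1) ^+ 2.
Proof.
move=> s1 iN; have /andP[p0 p1] := pole1_bound iN.
rewrite /pole0 exprMn sqrrN s1 mul1r sqr_sqrtr ?subrK// subr_ge0.
have N0 : 0 <= N%:R^-1 :> R by rewrite invr_ge0.
by rewrite -/(pole1 N i) ler_pXn2r ?nnegrE ?addr_ge0//; move: p1; lra.
Qed.

(** The squared distance to the pole is at least [1 / N^2] and at least [(z2 - a2)^2], while
    [r^2 - 1 <= 3 / N]. So the [i]-th kernel is at most [24 N / (1 + (2 N z2 - i)^2)], and
    [192 = 24 * 8] by [sum_cauchy_le]. *)
Lemma poisson_sum_le s N z1 z2 : s ^+ 2 = 1 -> (0 < N)%N ->
  z1 ^+ 2 + z2 ^+ 2 = 1 ->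
  \sum_(i < N) poisson (1 + N%:R^-1) (pole0 s N i) (pole1 N i) z1 z2 <= 192 * N%:R.
Proof.
move=> s1 N0 z; have n0 : 0 < N%:R :> R by rewrite ltr0n.
have n1 : 1 <= N%:R :> R by rewrite ler1n.
have ni : N%:R^-1 <= 1 :> R by rewrite invf_le1.
have ni0 : 0 < N%:R^-1 :> R by rewrite invr_gt0.
pose r : R := 1 + N%:R^-1.
apply: (@le_trans _ _ (\sum_(i < N) 24 * N%:R * (1 + (2 * N%:R * z2 - i%:R) ^+ 2)^-1)); last first.
  rewrite -mulr_sumr; apply: (@le_trans _ _ (24 * N%:R * 8)).
    by apply: ler_wpM2l; [rewrite mulr_ge0// ltW|exact: sum_cauchy_le].
  by lra.
apply: ler_sum => i _.
have pq := pole_sqr s1 (ltn_ord i).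
set a1 := pole0 s N i in pq *; set a2 := pole1 N i in pq *; rewrite -/r in pq *.
have r0 : r != 0 by rewrite gt_eqF// /r; lra.
have q : (a1 / r) ^+ 2 + (a2 / r) ^+ 2 = 1.
  have -> : (a1 / r) ^+ 2 + (a2 / r) ^+ 2 = (a1 ^+ 2 + a2 ^+ 2) / r ^+ 2 by field.
  by rewrite pq divff// expf_neq0.
have zq : (a1 / r) * z1 + (a2 / r) * z2 <= 1.
  have := sqr_ge0 (a1 / r - z1); have := sqr_ge0 (a2 / r - z2); move: q z; nra.
have := pole_dist_ge q (ltW ni0) zq; rewrite -/r !(mulrC r) !divfK// => h1.
have h2 : (2 * N%:R * z2 - i%:R) ^+ 2 * N%:R^-1 ^+ 2 <= 4 * ((z1 - a1) ^+ 2 + (z2 - a2) ^+ 2).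
  have -> : (2 * N%:R * z2 - i%:R) ^+ 2 * N%:R^-1 ^+ 2 = 4 * (z2 - a2) ^+ 2.
    by rewrite /a2 /pole1; field; rewrite gt_eqF.
  by rewrite ler_pM2l// lerDr sqr_ge0.
set D := _ + _ in h1 h2 *.
have D0 : 0 < D by apply: lt_le_trans h1; rewrite exprn_gt0.
have c0 : 0 < 1 + (2 * N%:R * z2 - i%:R) ^+ 2 by rewrite ltr_pwDl// sqr_ge0.
rewrite /poisson -/D ler_pdivrMr// mulrAC ler_pdivlMr//.
have h3 : (1 + (2 * N%:R * z2 - i%:R) ^+ 2) * N%:R^-1 ^+ 2 <= 8 * D.
  rewrite mulrDl mul1r; lra.
have h4 : r ^+ 2 - 1 <= 3 * N%:R^-1.
  rewrite /r; nra.
apply: (@le_trans _ _ (3 * N%:R^-1 * (1 + (2 * N%:R * z2 - i%:R) ^+ 2))).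
  by rewrite ler_wpM2r// ltW.
have -> : 3 * N%:R^-1 * (1 + (2 * N%:R * z2 - i%:R) ^+ 2) =
  3 * N%:R * ((1 + (2 * N%:R * z2 - i%:R) ^+ 2) * N%:R^-1 ^+ 2) by field; rewrite gt_eqF.
have -> : 24 * N%:R * D = 3 * N%:R * (8 * D) by ring.
by rewrite ler_pM2l// mulr_gt0.
Qed.

(** The second coordinate of a pole is at most [1/2], so the first has square at least [3/4] and
    lies on the other side of zero from [z1]. The squared distance is thus at least [3/4], against
    the numerator [r^2 - 1 <= 3 / N]. *)
Lemma poisson_far_le s N i z1 z2 : s ^+ 2 = 1 -> (i < N)%N -> 0 <= s * z1 ->
  poisson (1 + N%:R^-1) (pole0 s N i) (pole1 N i) z1 z2 <= 4 / N%:R.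
Proof.
move=> s1 iN sz; have N0 : (0 < N)%N by exact: leq_ltn_trans iN.
have n1 : 1 <= N%:R :> R by rewrite ler1n.
have n0 : 0 < N%:R :> R by rewrite ltr0n.
have ni : N%:R^-1 <= 1 :> R by rewrite invf_le1.
have ni0 : 0 < N%:R^-1 :> R by rewrite invr_gt0 ltr0n.
have /andP[p0 p1] := pole1_bound iN.
have pq := pole_sqr s1 iN.
have sp : s * pole0 s N i <= 0.
  by rewrite /pole0 mulNr mulrN mulrA -expr2 s1 mul1r oppr_le0 sqrtr_ge0.
set a1 := pole0 s N i in sp pq *; set a2 := pole1 N i in p0 p1 pq *.
have h : 3 / 4 <= (z1 - a1) ^+ 2 + (z2 - a2) ^+ 2.
  apply: (@le_trans _ _ ((z1 - a1) ^+ 2)); last by rewrite lerDl sqr_ge0.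
  have -> : (z1 - a1) ^+ 2 = (s * z1 - s * a1) ^+ 2.
    have -> : (s * z1 - s * a1) ^+ 2 = s ^+ 2 * (z1 - a1) ^+ 2 by ring.
    by rewrite s1 mul1r.
  have : a1 ^+ 2 = (s * a1) ^+ 2 by rewrite [RHS]exprMn s1 mul1r.
  move: pq; nra.
rewrite /poisson ler_pdivrMr; last by apply: lt_le_trans h; rewrite divr_gt0.
apply: (@le_trans _ _ (4 / N%:R * (3 / 4))); last by rewrite ler_wpM2l// divr_ge0.
nra.
Qed.

End poisson_estimates.

(** * Derivatives and area density of the reflected map *)

Section reflection_calculus.
Variable R : realType.
Implicit Types (x y v : plane R).

Lemma is_derive_div (f g : plane R -> R) x v a b : is_derive x v f a ->
  is_derive x v g b -> g x != 0 ->
  is_derive x v (fun y => f y / g y) ((a * g x - f x * b) / (g x ^+ 2)).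
Proof.
move=> df dg g0; have [D1 E1] := dg.
have dV : is_derive x v (fun y => (g y)^-1) (- (g x) ^- 2 *: b).
  split; first exact: derivableV.
  by rewrite deriveV// E1.
have := is_deriveM df dV; congr (is_derive _ _ _ _).
by rewrite /GRing.scale/=; field.
Qed.

Variables (W0 W1 : plane R -> R).

(** The modulus of the map is constant and its argument is a constant plus twice that of [W]; so its
    derivative is the quarter turn of its value times [slope]. *)
Lemma is_derive_refl q1 q2 x v a b : is_derive x v W0 a -> is_derive x v W1 b ->
  W0 x ^+ 2 + W1 x ^+ 2 != 0 ->
  is_derive x v (fun y => refl0 q1 q2 (W0 y) (W1 y))
    (slope (W0 x) (W1 x) a b * - refl1 q1 q2 (W0 x) (W1 x)) /\
  is_derive x v (fun y => refl1 q1 q2 (W0 y) (W1 y))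
    (slope (W0 x) (W1 x) a b * refl0 q1 q2 (W0 x) (W1 x)).
Proof.
move=> d0 d1 D0.
have dA := is_deriveB (is_deriveM d0 d0) (is_deriveM d1 d1).
have dB := is_deriveM d0 d1.
have dD := is_deriveD (is_deriveM d0 d0) (is_deriveM d1 d1).
have n0 : is_derive x v
    (fun y => - (q1 * (W0 y ^+ 2 - W1 y ^+ 2) + 2 * q2 * (W0 y * W1 y)))
    (- (q1 * (W0 x * a + W0 x * a - (W1 x * b + W1 x * b)) +
        2 * q2 * (W0 x * b + W1 x * a))).
  exact: is_deriveN (is_deriveD (is_deriveZ q1 dA) (is_deriveZ (2 * q2) dB)).
have n1 : is_derive x v
    (fun y => - (2 * q1 * (W0 y * W1 y) - q2 * (W0 y ^+ 2 - W1 y ^+ 2)))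
    (- (2 * q1 * (W0 x * b + W1 x * a) -
        q2 * (W0 x * a + W0 x * a - (W1 x * b + W1 x * b)))).
  exact: is_deriveN (is_deriveB (is_deriveZ (2 * q1) dB) (is_deriveZ q2 dA)).
split.
  have := is_derive_div n0 dD D0; congr (is_derive _ _ _ _).
    by apply/funext => y; rewrite /refl0/= mulrA.
  by rewrite /slope /refl1 /GRing.scale/= !fctE; field.
have := is_derive_div n1 dD D0; congr (is_derive _ _ _ _).
  by apply/funext => y; rewrite /refl1/= mulrA.
by rewrite /slope /refl0 /GRing.scale/= !fctE; field.
Qed.

Hypothesis W_neq0 : forall x, W0 x ^+ 2 + W1 x ^+ 2 != 0.

Lemma differentiable_refl q1 q2 x : differentiable W0 x -> differentiable W1 x ->
  differentiable (fun y => (refl0 q1 q2 (W0 y) (W1 y), refl1 q1 q2 (W0 y) (W1 y))) x.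
Proof.
move=> d0 d1.
have dA := differentiableB (differentiableM d0 d0) (differentiableM d1 d1).
have dB := differentiableM d0 d1.
have dD := differentiableD (differentiableM d0 d0) (differentiableM d1 d1).
have n0 : differentiable
    (fun y => - (q1 * (W0 y ^+ 2 - W1 y ^+ 2) + 2 * q2 * (W0 y * W1 y))) x.
  exact: differentiableN (differentiableD (differentiableZ q1 dA) (differentiableZ (2 * q2) dB)).
have n1 : differentiable
    (fun y => - (2 * q1 * (W0 y * W1 y) - q2 * (W0 y ^+ 2 - W1 y ^+ 2))) x.
  exact: differentiableN (differentiableB (differentiableZ (2 * q1) dB) (differentiableZ q2 dA)).
have dV := differentiableV dD (W_neq0 x).
apply: differentiable_pair.
  have := differentiableM n0 dV; congr (differentiable _ _).
  by apply/funext => y; rewrite /refl0 fctE/= mulrA.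
have := differentiableM n1 dV; congr (differentiable _ _).
by apply/funext => y; rewrite /refl1 fctE/= mulrA.
Qed.

Variable dW : 'I_2 -> 'I_2 -> plane R -> R.
Hypotheses (dW0 : forall j x, is_derive x (basis2 R j) W0 (dW 0 j x))
  (dW1 : forall j x, is_derive x (basis2 R j) W1 (dW 1 j x))
  (W0d : forall x, differentiable W0 x) (W1d : forall x, differentiable W1 x)
  (dWc : forall i j, continuous (dW i j)).

Definition refl_map q1 q2 y : plane R :=
  (refl0 q1 q2 (W0 y) (W1 y), refl1 q1 q2 (W0 y) (W1 y)).

Lemma continuous_refl_map q1 q2 i : continuous (coord2 i \o refl_map q1 q2).
Proof.
move=> x; apply: differentiable_continuous; apply: differentiable_comp.
  exact: differentiable_refl.
exact: differentiable_coord2.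
Qed.

Lemma continuous_slope j : continuous (fun y => slope (W0 y) (W1 y) (dW 0 j y) (dW 1 j y)).
Proof.
have c0 : continuous W0 by move=> x; exact: differentiable_continuous.
have c1 : continuous W1 by move=> x; exact: differentiable_continuous.
move=> x; apply: cvgM.
  apply: cvgMr; apply: cvgB; apply: cvgM; [exact: c0|exact: dWc|exact: c1|exact: dWc].
apply: (@cvgV R (plane R) (nbhs x) _ (fun y => W0 y ^+ 2 + W1 y ^+ 2)).
  exact: W_neq0.
by apply: cvgD; apply: cvgM; [exact: c0|exact: c0|exact: c1|exact: c1].
Qed.

Lemma partial_refl_map q1 q2 j y :
  partial j (coord2 0 \o refl_map q1 q2) y =
    slope (W0 y) (W1 y) (dW 0 j y) (dW 1 j y) * - (coord2 1 \o refl_map q1 q2) y /\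
  partial j (coord2 1 \o refl_map q1 q2) y =
    slope (W0 y) (W1 y) (dW 0 j y) (dW 1 j y) * (coord2 0 \o refl_map q1 q2) y.
Proof.
have [[_ h0] [_ h1]] := is_derive_refl q1 q2 (dW0 j y) (dW1 j y) (W_neq0 y).
by split; [exact: h0|exact: h1].
Qed.

Lemma C1_refl_map A q1 q2 : C1 A (refl_map q1 q2).
Proof.
move=> x _; split; first exact: differentiable_refl.
move=> i j; have [->|->] := ord2P i.
- rewrite (_ : partial _ _ = (fun y => slope (W0 y) (W1 y) (dW 0 j y) (dW 1 j y) *
    - (coord2 1 \o refl_map q1 q2) y)).
    apply: cvgM; first exact: continuous_slope.
    by apply: cvgN; exact: continuous_refl_map.
  by apply/funext => y; have [] := partial_refl_map q1 q2 j y.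
- rewrite (_ : partial _ _ = (fun y => slope (W0 y) (W1 y) (dW 0 j y) (dW 1 j y) *
    (coord2 0 \o refl_map q1 q2) y)).
    by apply: cvgM; [exact: continuous_slope|exact: continuous_refl_map].
  by apply/funext => y; have [] := partial_refl_map q1 q2 j y.
Qed.

(** Both columns of the gradient are multiples of one tangent vector, which kills the determinant;
    this vector has length one, so only the slopes remain. *)
Lemma area_density_refl_map q1 q2 y : q1 ^+ 2 + q2 ^+ 2 = 1 ->
  Num.sqrt (1 + frobenius (grad (refl_map q1 q2) y) ^+ 2 +
    (\det (grad (refl_map q1 q2) y)) ^+ 2) =
  gdens (slope_mx (W0 y) (W1 y) (\matrix_(i, j) dW i j y)).
Proof.
move=> q; rewrite /gdens; congr Num.sqrt; rewrite !frobenius_sqr !sum22 det_mx22 !mxE/=.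
have [-> ->] := partial_refl_map q1 q2 0 y.
have [-> ->] := partial_refl_map q1 q2 1 y.
have := refl_sqr q (W_neq0 y).
rewrite /refl_map /coord2/=.
move: (refl0 _ _ _ _) (refl1 _ _ _ _) (slope _ _ _ _) (slope _ _ _ _) => a b t s ab.
have -> : 1 + ((s * - b) ^+ 2 + (t * - b) ^+ 2 + (s * a) ^+ 2 + (t * a) ^+ 2) +
    (s * - b * (t * a) - t * - b * (s * a)) ^+ 2 =
  1 + (s ^+ 2 + t ^+ 2) * (a ^+ 2 + b ^+ 2) by ring.
by rewrite ab; ring.
Qed.

End reflection_calculus.

(** * The upper bound *)

Section approximants.
Variable R : realType.
Implicit Types (x y : plane R) (eta : R -> R).
Local Notation mu := (leb2 R).

Lemma measurable_poisson d (T : measurableType d) (D : set T) (f g : T -> R) (r a b : R) :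
  measurable_fun D f -> measurable_fun D g ->
  measurable_fun D (fun p => poisson r a b (f p) (g p)).
Proof.
move=> mf mg; pose h p := (f p - a) ^+ 2 + (g p - b) ^+ 2.
(* As a real power the inverse is measurable on the whole line, so the denominator need not be kept
   away from zero. *)
rewrite (_ : (fun p => _) = (fun p => (r ^+ 2 - 1) * (h p `^ (-1)))); last first.
  by apply/funext => p; rewrite powR_inv1// addr_ge0// sqr_ge0.
apply: measurable_funM => //; apply: (measurableT_comp (measurable_powR (-1))).
by apply: measurable_funD; apply: measurable_funX; apply: measurable_funB.
Qed.

(** A substitute for [|x| <= sqrt M] that is affine in [M]: the displacement is then controlled by
    the integral of the Poisson kernel itself. *)
Lemma normr_le_tau (x M t : R) : 0 < t -> 0 <= M -> x ^+ 2 <= M -> `|x| <= t + M / t.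
Proof.
move=> t0 M0 xM; apply: normr_le_sqr; first by rewrite addr_ge0 ?divr_ge0// ltW.
apply: le_trans xM _.
have -> : (t + M / t) ^+ 2 = t ^+ 2 + 2 * M + (M / t) ^+ 2 by field; rewrite gt_eqF.
by have := sqr_ge0 t; have := sqr_ge0 (M / t); lra.
Qed.

Variables (Omega : set (plane R)) (u : plane R -> plane R) (G : plane R -> 'M[R]_2).
Hypotheses (oO : open Omega) (Ofin : (mu Omega < +oo)%E) (Lu : L1 Omega u)
  (wG : is_weak_grad Omega u G) (circ : forall x, Omega x -> circle (u x)).

Local Notation U := (uext Omega u).
Local Notation g := (gext Omega G).

Lemma uext_dir_le1 q1 q2 x : q1 ^+ 2 + q2 ^+ 2 = 1 -> `|q1 * U 0 x + q2 * U 1 x| <= 1.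
Proof.
move=> q; have h := uext_sqr_le1 circ x.
apply: normr_le_sqr => //; rewrite expr1n.
have := sqr_ge0 (q1 * U 1 x - q2 * U 0 x).
have : (q1 * U 0 x + q2 * U 1 x) ^+ 2 + (q1 * U 1 x - q2 * U 0 x) ^+ 2 =
  (q1 ^+ 2 + q2 ^+ 2) * (U 0 x ^+ 2 + U 1 x ^+ 2) by ring.
by rewrite q mul1r; lra.
Qed.

(** An average of points of the closed disc stays in the half-plane [q . z <= 1], hence away from
    the pole. *)
Lemma moll_dir_le1 e eta q1 q2 x : mollifier e eta -> q1 ^+ 2 + q2 ^+ 2 = 1 ->
  q1 * moll eta (U 0) x + q2 * moll eta (U 1) x <= 1.
Proof.
move=> m q; have i0 := integrable_uext oO Lu 0; have i1 := integrable_uext oO Lu 1.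
have z0 : mu.-integrable setT (EFin \o (fun y => q1 * U 0 y)) by exact: (integrableZl measurableT q1 i0).
have z1 : mu.-integrable setT (EFin \o (fun y => q2 * U 1 y)) by exact: (integrableZl measurableT q2 i1).
rewrite -(mollZ q1 x m i0) -(mollZ q2 x m i1) -(mollD x m z0 z1).
apply: le_trans (ler_norm _) _; apply: (moll_norm_le1 x m); first exact: integrable_EFinD.
by move=> y; exact: uext_dir_le1.
Qed.

End approximants.

(** * The approximating circle-valued maps for a given pole *)

Section reflected_approximation.
Variable R : realType.
Implicit Types (x y : plane R) (eta : R -> R).
Local Notation mu := (leb2 R).

Lemma measurable_area_density B (v : plane R -> plane R) : open B -> C1 B v ->
  measurable_fun B (fun x => Num.sqrt (1 + frobenius (grad v x) ^+ 2 +
    (\det (grad v x)) ^+ 2)).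
Proof.
move=> oB Cv.
have mg i j : measurable_fun B (fun x => grad v x i j).
  by apply: measurable_fun_continuous_open => // x; exact: C1_continuous_grad.
rewrite (_ : (fun x => _) = Num.sqrt \o (fun x => 1 + (grad v x 0 0 ^+ 2 +
  grad v x 0 1 ^+ 2 + grad v x 1 0 ^+ 2 + grad v x 1 1 ^+ 2) +
  (grad v x 0 0 * grad v x 1 1 - grad v x 0 1 * grad v x 1 0) ^+ 2)); last first.
  by apply/funext => x /=; rewrite frobenius_sqr sum22 det_mx22.
apply: measurableT_comp.
  by apply: continuous_measurable_fun; exact: sqrt_continuous.
apply: measurable_funD.
  apply: measurable_funD => //.
  by do 3! (apply: measurable_funD; last exact: measurable_funX); exact: measurable_funX.
apply: measurable_funX.
by apply: measurable_funB; apply: measurable_funM.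
Qed.

Lemma enorm_le x : enorm x <= `|x.1| + `|x.2|.
Proof.
rewrite -(ler_pXn2r (ltn0Sn 1)) ?nnegrE ?addr_ge0 ?sqrtr_ge0//.
rewrite sqr_sqrtr ?addr_ge0 ?sqr_ge0// -[x.1 ^+ 2]real_normK ?num_real//.
rewrite -[x.2 ^+ 2]real_normK ?num_real//.
have := mulr_ge0 (normr_ge0 x.1) (normr_ge0 x.2); nra.
Qed.

Variables (Omega : set (plane R)) (u : plane R -> plane R) (G : plane R -> 'M[R]_2).
Hypotheses (oO : open Omega) (Ofin : (mu Omega < +oo)%E) (Lu : L1 Omega u)
  (wG : is_weak_grad Omega u G) (circ : forall x, Omega x -> circle (u x)).

Local Notation U := (uext Omega u).
Local Notation g := (gext Omega G).

Variables (A : set (plane R)) (s : R).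
Hypotheses (oA : open A) (s0 : 0 < s) (AO : A `<=` margin Omega s).

Let mA : measurable A. Proof. exact: open_measurable_plane. Qed.
Let AOm : A `<=` Omega. Proof. by apply: subset_trans AO _; exact: margin_sub. Qed.

Lemma measure_margin_fin : (mu A < +oo)%E.
Proof.
apply: le_lt_trans Ofin; apply: le_measure; rewrite ?inE; [exact: mA| |exact: AOm].
exact: open_measurable_plane.
Qed.

Variables (q1 q2 d : R).
Hypotheses (q : q1 ^+ 2 + q2 ^+ 2 = 1) (d0 : 0 < d) (d1 : d <= 1).

Local Notation P x :=
  (poisson (1 + d) ((1 + d) * q1) ((1 + d) * q2) (U 0 x) (U 1 x)).

Let q1_le1 : `|q1| <= 1.
Proof. by apply: normr_le_sqr => //; rewrite expr1n -q lerDl sqr_ge0. Qed.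
Let q2_le1 : `|q2| <= 1.
Proof. by apply: normr_le_sqr => //; rewrite expr1n -q lerDr sqr_ge0. Qed.

Let cS (a b : R) : a * q1 ^+ 2 + a * q2 ^+ 2 = a.
Proof. by rewrite -mulrDr q mulr1. Qed.

Let E_ge y : d ^+ 2 <= (U 0 y - (1 + d) * q1) ^+ 2 + (U 1 y - (1 + d) * q2) ^+ 2.
Proof.
apply: pole_dist_ge => //; first exact: ltW.
by apply: le_trans (ler_norm _) _; exact: (uext_dir_le1 circ).
Qed.

(** What [slope_dist_le] leaves over: the error of the gradient, and the error of the values
    weighted by the true gradient. The weighted part is controlled through [small_integral_mul]. *)
Definition moll_error eta i j x := `|moll eta (g i j) x - g i j x| +
  (`|(moll eta (U 0) x - U 0 x) * g i j x| + `|(moll eta (U 1) x - U 1 x) * g i j x|).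

Section fixed_mollifier.
Variables (e : R) (eta : R -> R) (m : mollifier e eta) (es : e < s).

Let W (i : 'I_2) (qi : R) y := moll eta (U i) y - (1 + d) * qi.

Let D_ge y : d ^+ 2 <= W 0 q1 y ^+ 2 + W 1 q2 y ^+ 2.
Proof. by apply: pole_dist_ge => //; [exact: ltW|exact: (moll_dir_le1 oO Lu circ y m q)]. Qed.

Let D_neq0 y : W 0 q1 y ^+ 2 + W 1 q2 y ^+ 2 != 0.
Proof. by rewrite gt_eqF// (lt_le_trans _ (D_ge y))// exprn_gt0. Qed.

Let dW i j y := dmoll eta j (U i) y.

Let W_derive i qi j y : is_derive y (basis2 R j) (W i qi) (dW i j y).
Proof.
have := is_deriveB (is_derive_moll m j y (integrable_uext oO Lu i))
  (is_derive_cst ((1 + d) * qi) y (basis2 R j)).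
by rewrite subr0.
Qed.

Let W_diff i qi y : differentiable (W i qi) y.
Proof.
have h := differentiable_moll m y (integrable_uext oO Lu i).
exact: (differentiableB h (differentiable_cst ((1 + d) * qi) y)).
Qed.

Let dW_cont i j : continuous (dW i j).
Proof. have H := continuous_dmoll m (j := j) (integrable_uext oO Lu i); exact: H. Qed.

Let v := refl_map (W 0 q1) (W 1 q2) q1 q2.

Lemma moll_reflection_C1 : C1 A v.
Proof.
exact: (C1_refl_map D_neq0 (W_derive 0 q1) (W_derive 1 q2) (W_diff 0 q1) (W_diff 1 q2) dW_cont).
Qed.

Lemma moll_reflection_L1 : L1 A v.
Proof.
move=> i; apply: measurable_bounded_integrable; [exact: mA|exact: measure_margin_fin| |].
  apply: measurable_fun_continuous_open => // x _.
  exact: (continuous_refl_map D_neq0 (W_diff 0 q1) (W_diff 1 q2)).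
exists 1; split => // M M1 x _ /=; apply: le_trans (ltW M1).
apply: le_trans (coord2_le_enorm i (v x)) _.
by rewrite /enorm refl_sqr// sqrtr1.
Qed.

Lemma moll_reflection_slope x : A x ->
  gdens (slope_mx (W 0 q1 x) (W 1 q2 x) (\matrix_(i, j) dW i j x)) <=
  gdens (slope_mx (U 0 x - (1 + d) * q1) (U 1 x - (1 + d) * q2) (\matrix_(i, j) g i j x)) +
  \sum_(i < 2) \sum_(j < 2) 2 * (d^-1 + d ^- 2) * moll_error eta i j x.
Proof.
move=> Ax; set N := slope_mx (U 0 x - _) _ _.
apply: le_trans (gdens_lipschitz _ N) _; rewrite lerD2l !sum22 /N.
have dg i j : dW i j x = g i j x + (moll eta (g i j) x - g i j x).
  rewrite /dW (dmoll_weak_grad i j (@subset_refl _ Omega) wG m es (AO Ax)).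
  by rewrite addrC subrK.
have Wd (i : 'I_2) qi : W i qi x - (U i x - (1 + d) * qi) = moll eta (U i) x - U i x.
  by rewrite /W; ring.
have H j : `|slope (W 0 q1 x) (W 1 q2 x) (dW 0 j x) (dW 1 j x) -
     slope (U 0 x - (1 + d) * q1) (U 1 x - (1 + d) * q2) (g 0 j x) (g 1 j x)| <=
   2 * (d^-1 + d ^- 2) * moll_error eta 0 j x + 2 * (d^-1 + d ^- 2) * moll_error eta 1 j x.
  apply: le_trans (slope_dist_le _ _ _ _ d0 (D_ge x) (E_ge x)) _.
  rewrite !Wd !dg !(addrC (g _ _ _)) !addrK /moll_error !normrM.
  have k0 : 0 <= d^-1 by rewrite invr_ge0 ltW.
  have l0 : 0 <= d ^- 2 by rewrite invr_ge0 exprn_ge0// ltW.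
  move: (normr_ge0 (moll eta (g 0 j) x - g 0 j x)) (normr_ge0 (moll eta (g 1 j) x - g 1 j x))
    (normr_ge0 (moll eta (U 0) x - U 0 x)) (normr_ge0 (moll eta (U 1) x - U 1 x))
    (normr_ge0 (g 0 j x)) (normr_ge0 (g 1 j x)).
  move: `|moll eta (g 0 j) x - _| `|moll eta (g 1 j) x - _|
    `|moll eta (U 0) x - _| `|moll eta (U 1) x - _| `|g 0 j x| `|g 1 j x|
    => a b p r z w a0 b0 p0 r0 z0 w0.
  rewrite -subr_ge0 [leRHS](_ : _ = 2 * (d ^- 2 * (a + b) + d^-1 * ((p + r) * (z + w)))).
    by rewrite mulr_ge0// addr_ge0// mulr_ge0// ?mulr_ge0// addr_ge0.
  ring.
rewrite !mxE/= !subr0 !normr0 !addr0.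
apply: le_trans (lerD (H 0) (H 1)) _.
by rewrite le_eqVlt; apply/orP; left; apply/eqP; ring.
Qed.

(** The reflected value of [u x] itself is inserted: the reflection is Lipschitz away from the pole,
    and [refl_near] measures its displacement on the circle. *)
Lemma moll_reflection_dist t x : 0 < t -> A x ->
  enorm (v x - u x) <= 8 * (3 / d ^+ 2 + d^-1) *
    (`|moll eta (U 0) x - U 0 x| + `|moll eta (U 1) x - U 1 x|) +
  2 * (t + 2 * d * P x / t).
Proof.
move=> t0 Ax; have Ox := AOm Ax.
have r1 : 1 <= 1 + d by rewrite lerDl ltW.
have P0 := poisson_ge0 ((1 + d) * q1) ((1 + d) * q2) (U 0 x) (U 1 x) r1.
have uE : u x = (U 0 x, U 1 x).
  by rewrite /uext !patchE mem_set//= /coord2/=; case: (u x).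
have near := refl_near q (uext_circle circ Ox) d0.
set Z0 := U 0 x - (1 + d) * q1 in near; set Z1 := U 1 x - (1 + d) * q2 in near.
have dP0 : 0 <= 2 * d * P x by apply: mulr_ge0 => //; rewrite mulr_ge0// ltW.
have n0 : `|refl0 q1 q2 Z0 Z1 - U 0 x| <= t + 2 * d * P x / t.
  by apply: normr_le_tau => //; apply: le_trans near; rewrite lerDl sqr_ge0.
have n1 : `|refl1 q1 q2 Z0 Z1 - U 1 x| <= t + 2 * d * P x / t.
  by apply: normr_le_tau => //; apply: le_trans near; rewrite lerDr sqr_ge0.
have B (i : 'I_2) qi : `|qi| <= 1 -> `|W i qi x| <= 3.
  move=> h; apply: le_trans (ler_normB _ _) _.
  have : `|moll eta (U i) x| <= 1.
    apply: (moll_norm_le1 x m (integrable_uext oO Lu i)) => z; exact: (uext_le1 circ).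
  have : `|(1 + d) * qi| <= 2.
    rewrite normrM ger0_norm; last by rewrite addr_ge0// ltW.
    apply: (@le_trans _ _ ((1 + d) * 1)); first by rewrite ler_wpM2l// addr_ge0// ltW.
    by rewrite mulr1 lerD2l.
  by lra.
have [l0 l1] := refl_dist_le d0 q1_le1 q2_le1 (B 0 _ q1_le1) (B 1 _ q2_le1) (D_ge x) (E_ge x).
have Wd (i : 'I_2) qi : W i qi x - (U i x - (1 + d) * qi) = moll eta (U i) x - U i x.
  by rewrite /W; ring.
rewrite !Wd in l0 l1.
apply: (@le_trans _ _ (`|(v x).1 - U 0 x| + `|(v x).2 - U 1 x|)).
  by rewrite uE; apply: le_trans (enorm_le _) _.
have T (a b z : R) : `|a - z| <= `|a - b| + `|b - z|.
  by rewrite (le_trans _ (ler_normD _ _))// addrA subrK.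
apply: le_trans (lerD (T _ (refl0 q1 q2 Z0 Z1) _) (T _ (refl1 q1 q2 Z0 Z1) _)) _.
rewrite [X in X + 2 * _](_ : _ = 4 * (3 / d ^+ 2 + d^-1) *
    (`|moll eta (U 0) x - U 0 x| + `|moll eta (U 1) x - U 1 x|) + 4 * (3 / d ^+ 2 + d^-1) *
    (`|moll eta (U 0) x - U 0 x| + `|moll eta (U 1) x - U 1 x|)); last by ring.
rewrite [2 * (t + _)]mulr_natl mulr2n [leRHS]addrACA; apply: lerD; exact: lerD.
Qed.

Lemma moll_reflection : exists v' : plane R -> plane R, [/\ C1 A v', L1 A v',
  forall x, A x -> Num.sqrt (1 + frobenius (grad v' x) ^+ 2 + (\det (grad v' x)) ^+ 2) <=
    gdens (slope_mx (U 0 x - (1 + d) * q1) (U 1 x - (1 + d) * q2) (\matrix_(i, j) g i j x)) +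
    \sum_(i < 2) \sum_(j < 2) 2 * (d^-1 + d ^- 2) * moll_error eta i j x &
  forall t x, 0 < t -> A x -> enorm (v' x - u x) <= 8 * (3 / d ^+ 2 + d^-1) *
    (`|moll eta (U 0) x - U 0 x| + `|moll eta (U 1) x - U 1 x|) +
    2 * (t + 2 * d * P x / t)].
Proof.
exists v; split; [exact: moll_reflection_C1|exact: moll_reflection_L1| |exact: moll_reflection_dist].
move=> x Ax; rewrite (area_density_refl_map D_neq0 (W_derive 0 q1) (W_derive 1 q2))//.
exact: moll_reflection_slope.
Qed.

End fixed_mollifier.

Hypothesis mG : forall i j, measurable_fun A (fun x => G x i j).

Lemma measurable_UA i : measurable_fun A (U i).
Proof. exact: measurable_funTS (measurable_uext oO Lu i). Qed.

Let mP : measurable_fun A (fun x => P x).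
Proof. by apply: measurable_poisson; exact: measurable_UA. Qed.

Let mgd : measurable_fun A (fun x => gdens (G x)).
Proof. exact: measurable_gdens. Qed.

Let P0 x : 0 <= P x.
Proof. by apply: poisson_ge0; rewrite lerDl ltW. Qed.

Lemma reflected_approx t e0 : 0 < t -> 0 < e0 -> exists v' : plane R -> plane R,
  [/\ C1 A v', L1 A v',
    (area v' A <= \int[mu]_(x in A) ((1 + P x) * gdens (G x))%:E + e0%:E)%E &
    (\int[mu]_(x in A) (enorm (v' x - u x))%:E <=
      \int[mu]_(x in A) (2 * (t + 2 * d * P x / t))%:E + e0%:E)%E].
Proof.
move=> t0 e00.
(* [K] collects four entries, each [2 * (d^-1 + d ^- 2)] times three errors of size [h]; [L] is
   [8 * (3 / d ^ 2 + d^-1)] times two such errors. *)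
pose K : R := 24 * (d^-1 + d ^- 2); pose L : R := 16 * (3 / d ^+ 2 + d^-1).
have di : 0 < d^-1 by rewrite invr_gt0.
have d2i : 0 < d ^- 2 by rewrite invr_gt0 exprn_gt0.
have K0 : 0 < K by rewrite mulr_gt0// addr_gt0.
have L0 : 0 < L by rewrite mulr_gt0// addr_gt0// mulr_gt0.
pose h := e0 / (K + L).
have h0 : 0 < h by rewrite divr_gt0// addr_gt0.
have Kh : K * h <= e0 by rewrite /h mulrCA ger_pMr// ler_pdivrMr ?addr_gt0// mul1r lerDl ltW.
have Lh : L * h <= e0 by rewrite /h mulrCA ger_pMr// ler_pdivrMr ?addr_gt0// mul1r lerDr ltW.
have [r [r0 rP]] := moll_cvg_uext_gext oO Ofin Lu wG circ h0.
pose e := Num.min r (s / 2).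
have e_gt0 : 0 < e by rewrite lt_min r0 divr_gt0.
have er : e <= r by rewrite ge_min lexx.
have es : e < s by rewrite gt_min ltr_pdivrMr// ltr_pMr// ltr1n orbT.
have [eta m] := mollifier_exists e_gt0.
have {}rP i j k := rP e er i j k eta m.
have [v [Cv Lv areav distv]] := moll_reflection m es.
(* Only almost everywhere, because the tangency that replaces the slopes by the factor [1 + P] holds
   only almost everywhere. *)
have ae_le : {ae mu, forall x, A x -> Num.sqrt (1 + frobenius (grad v x) ^+ 2 +
      (\det (grad v x)) ^+ 2) <= (1 + P x) * gdens (G x) +
    \sum_(i < 2) \sum_(j < 2) 2 * (d^-1 + d ^- 2) * moll_error eta i j x}.
  move: (normal_part_ae oO Ofin Lu wG circ 0) (normal_part_ae oO Ofin Lu wG circ 1).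
  move=> N0 N1; have := negligibleU N0 N1; apply: negligibleS => x /= H.
  apply: contrapT => /not_orP[/contrapT n0 /contrapT n1]; apply: H => Ax.
  apply: le_trans (areav x Ax) _; rewrite lerD2r.
  have Ox := AOm Ax.
  have -> : \matrix_(i, j) g i j x = G x.
    by apply/matrixP => i j; rewrite mxE /gext patchE mem_set.
  apply: gdens_slope_le; [by rewrite lerDl ltW| |exact: (uext_circle circ Ox)| |].
  - by rewrite !exprMn -mulrDr q mulr1.
  - by rewrite gt_eqF// (lt_le_trans _ (E_ge x))// exprn_gt0.
  - move=> j; have [->|->] := ord2P j.
    + by move: n0; rewrite /normal_part /gext !patchE mem_set.
    + by move: n1; rewrite /normal_part /gext !patchE mem_set.
have iU i := integrable_uext oO Lu i.
have mn (f : plane R -> R) : measurable_fun setT f -> measurable_fun setT (fun x => `|f x|).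
  by move=> mf; exact: measurableT_comp.
have mU i : measurable_fun setT (fun x => moll eta (U i) x - U i x).
  by apply: measurable_funB; [exact: measurable_moll m (iU i)|exact: measurable_uext].
have mUG i j k : measurable_fun setT (fun x => `|(moll eta (U k) x - U k x) * g i j x|).
  by apply: mn; apply: measurable_funM; [exact: mU|exact: measurable_gext].
have mGG i j : measurable_fun setT (fun x => `|moll eta (g i j) x - g i j x|).
  apply: mn; apply: measurable_funB; last exact: measurable_gext.
  exact: measurable_moll m (integrable_gext oO wG i j).
have mE i j : measurable_fun setT (moll_error eta i j).
  by apply: measurable_funD; [exact: mGG|apply: measurable_funD; exact: mUG].
have E0 i j x : 0 <= moll_error eta i j x by rewrite !addr_ge0.
have sub (f : plane R -> R) (b : R) : measurable_fun setT f -> (forall x, 0 <= f x) ->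
    (\int[mu]_x (f x)%:E <= b%:E)%E -> (\int[mu]_(x in A) (f x)%:E <= b%:E)%E.
  move=> mf f0; apply: le_trans; apply: ge0_subset_integral;
    [exact: mA|exact: measurableT|exact/measurable_EFinP| |by []].
  by move=> x _; rewrite lee_fin.
have scale (c b : R) (f : plane R -> R) : 0 <= c -> measurable_fun setT f ->
    (forall x, 0 <= f x) -> (\int[mu]_x (f x)%:E <= b%:E)%E ->
    (\int[mu]_(x in A) (c * f x)%:E <= (c * b)%:E)%E.
  move=> c0 mf f0 fb; apply: sub.
  - exact: measurable_funM.
  - by move=> x; exact: mulr_ge0.
  - by apply: (@integral_scale_le _ _ R mu setT measurableT).
have c0 : 0 <= 2 * (d^-1 + d ^- 2) by rewrite mulr_ge0// ltW// addr_gt0.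
have errE i j : (\int[mu]_(x in A) (2 * (d^-1 + d ^- 2) * moll_error eta i j x)%:E <=
    (2 * (d^-1 + d ^- 2) * (h + (h + h)))%:E)%E.
  apply: scale => //.
  rewrite ge0_integral_EFinD; [|exact: measurableT|exact: mGG|
    exact: measurable_funD (mUG i j 0) (mUG i j 1)|by []|by move=> x; rewrite addr_ge0].
  have [_ b1 b2] := rP i j 0; have [_ _ b3] := rP i j 1.
  rewrite ge0_integral_EFinD; [|exact: measurableT|exact: mUG|exact: mUG|by []|by []].
  exact: (leeD b1 (leeD b2 b3)).
have mEA i j : measurable_fun A (fun x => 2 * (d^-1 + d ^- 2) * moll_error eta i j x).
  by apply: measurable_funTS; exact: measurable_funM.
have ff0 x : 0 <= (1 + P x) * gdens (G x) by rewrite mulr_ge0 ?gdens_ge0// addr_ge0.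
have mff : measurable_fun A (fun x => (1 + P x) * gdens (G x)).
  by apply: measurable_funM => //; apply: measurable_funD.
have ss0 x : 0 <= \sum_(i < 2) \sum_(j < 2) 2 * (d^-1 + d ^- 2) * moll_error eta i j x.
  by apply: sumr_ge0 => i _; apply: sumr_ge0 => j _; exact: mulr_ge0.
have mss : measurable_fun A
    (fun x => \sum_(i < 2) \sum_(j < 2) 2 * (d^-1 + d ^- 2) * moll_error eta i j x).
  by apply: measurable_sum => i; apply: measurable_sum => j; exact: mEA.
exists v; split => //.
- apply: (@le_trans _ _ (\int[mu]_(x in A) ((1 + P x) * gdens (G x) +
      \sum_(i < 2) \sum_(j < 2) 2 * (d^-1 + d ^- 2) * moll_error eta i j x)%:E)%E).
    apply: ae_ge0_le_integral.
    + exact: mA.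
    + by move=> x _; rewrite lee_fin sqrtr_ge0.
    + by apply/measurable_EFinP; exact: measurable_area_density.
    + by move=> x _; rewrite lee_fin addr_ge0.
    + by apply/measurable_EFinP; exact: measurable_funD.
    + move: ae_le; apply: negligibleS => x /= H1 H2; apply: H1 => Ax.
      by rewrite lee_fin; exact: H2.
  rewrite ge0_integral_EFinD; [|exact: mA|exact: mff|exact: mss|by []|by []].
  rewrite leeD2l// ge0_integral_sum22; [|exact: mA|exact: mEA|by move=> i j x; exact: mulr_ge0].
  apply: le_trans (leeD (leeD (leeD (errE 0 0) (errE 0 1)) (errE 1 0)) (errE 1 1)) _.
  rewrite -!EFinD lee_fin; apply: le_trans Kh; rewrite /K; lra.
- have mtau : measurable_fun A (fun x => 2 * (t + 2 * d * P x / t)).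
    apply: measurable_funM => //; apply: measurable_funD => //.
    by apply: measurable_funM => //; exact: measurable_funM.
  have tau0 x : 0 <= 2 * (t + 2 * d * P x / t).
    apply: mulr_ge0 => //; apply: addr_ge0; first exact: ltW.
    apply: divr_ge0; last exact: ltW.
    by apply: mulr_ge0 => //; rewrite mulr_ge0// ltW.
  have l0 : 0 <= 8 * (3 / d ^+ 2 + d^-1) by rewrite mulr_ge0// ltW// addr_gt0// mulr_gt0.
  have mUU : measurable_fun setT (fun x => `|moll eta (U 0) x - U 0 x| +
      `|moll eta (U 1) x - U 1 x|).
    exact: measurable_funD (mn _ (mU 0)) (mn _ (mU 1)).
  apply: (@le_trans _ _ (\int[mu]_(x in A) (8 * (3 / d ^+ 2 + d^-1) *
     (`|moll eta (U 0) x - U 0 x| + `|moll eta (U 1) x - U 1 x|) +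
     2 * (t + 2 * d * P x / t))%:E)%E).
    apply: ge0_le_integral.
    + exact: mA.
    + by move=> x _; rewrite lee_fin sqrtr_ge0.
    + apply/measurable_EFinP.
      have mw (i : 'I_2) : measurable_fun A (coord2 i \o (fun x => v x - u x)).
        rewrite (_ : _ \o _ = (fun x => (coord2 i \o v) x - (coord2 i \o u) x)); last first.
          by apply/funext => x; exact: coord2B.
        apply: measurable_funB; first exact: integrable_measurable (Lv i).
        have := integrable_measurable (Lu i); apply: measurable_funS; last exact: AOm.
        exact: open_measurable_plane.
      exact: measurable_enorm (mw 0) (mw 1).
    + apply/measurable_EFinP; apply: measurable_funD => //.
      by apply: measurable_funTS; exact: measurable_funM.
    + by move=> x Ax; rewrite lee_fin; exact: distv.
  rewrite ge0_integral_EFinD; [|exact: mA| |exact: mtau| |exact: tau0].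
  + rewrite addeC leeD2l//; apply: (@le_trans _ _ ((8 * (3 / d ^+ 2 + d^-1)) * (h + h))%:E).
      apply: (scale _ _ (fun x => `|moll eta (U 0) x - U 0 x| +
         `|moll eta (U 1) x - U 1 x|)) => //.
      have [b1 _ _] := rP 0 0 0; have [b2 _ _] := rP 0 0 1.
      rewrite ge0_integral_EFinD; [|exact: measurableT|exact: mn|exact: mn|by []|by []].
      exact: (leeD b1 b2).
    by rewrite lee_fin; apply: le_trans Lh; rewrite /L; lra.
  + by apply: measurable_funTS; exact: measurable_funM.
  + by move=> x; rewrite mulr_ge0// addr_ge0.
Qed.

End reflected_approximation.

Section relaxed_area_upper.
Variable R : realType.
Implicit Types (x y : plane R) (eta : R -> R).
Local Notation mu := (leb2 R).

(** The choices [e = 1 / (k + 1)] form an admissible sequence, and the excess in their areas tends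
    to zero. *)
Lemma relaxed_area_le (A : set (plane R)) (u : plane R -> plane R) (B : \bar R) :
  (forall e : R, 0 < e -> exists v, [/\ C1 A v, L1 A v,
    (area v A <= B + e%:E)%E &
    (\int[mu]_(x in A) (enorm (v x - u x))%:E <= e%:E)%E]) ->
  (relaxed_area u A <= B)%E.
Proof.
move=> H; have n0 k : 0 < k.+1%:R^-1 :> R by rewrite invr_gt0.
have /choice[v vP] : forall k, exists v, [/\ C1 A v, L1 A v,
    (area v A <= B + (k.+1%:R^-1)%:E)%E &
    (\int[mu]_(x in A) (enorm (v x - u x))%:E <= (k.+1%:R^-1)%:E)%E].
  by move=> k; exact: H.
apply/lee_addgt0Pr => e e0.
apply: (@le_trans _ _ (limn_einf (fun k => area (v k) A))).
  apply: ereal_inf_lbound; exists v; split=> //; first by move=> k; have [? ? _ _] := vP k.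
  apply: (@squeeze_cvge _ _ _ _ (cst 0%E) _ (fun k => (k.+1%:R^-1)%:E)).
  - near=> k; have [_ _ _ ->] := vP k; rewrite andbT.
    by apply: integral_ge0 => x _; rewrite lee_fin sqrtr_ge0.
  - exact: cvg_cst.
  - by apply: cvg_EFin; [exact: nearW|exact: cvg_harmonic].
have [K _ KP] : \forall k \near \oo, (k.+1%:R^-1 : R) <= e.
  have /cvgrPdist_le/(_ _ e0)[K _ KP] := @cvg_harmonic R.
  exists K => // k /KP; rewrite sub0r normrN; apply: le_trans; exact: ler_norm.
apply: (@limn_einf_le _ _ _ K) => k Kk; have [_ _ h _] := vP k.
by apply: le_trans h _; rewrite leeD2l// lee_fin; exact: KP.
Unshelve. all: by end_near. Qed.

End relaxed_area_upper.

(** * Choice of a pole by averaging *)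

Section pole_selection.
Variable R : realType.
Implicit Types (x y : plane R).
Local Notation mu := (leb2 R).

Variables (Omega : set (plane R)) (u : plane R -> plane R) (G : plane R -> 'M[R]_2).
Hypotheses (oO : open Omega) (Ofin : (mu Omega < +oo)%E) (Lu : L1 Omega u)
  (wG : is_weak_grad Omega u G) (circ : forall x, Omega x -> circle (u x)).

Local Notation U := (uext Omega u).

Lemma integrable_gdens_weak : mu.-integrable Omega (EFin \o (fun x => gdens (G x))).
Proof.
have mO : measurable Omega by exact: open_measurable_plane.
have iG i j : mu.-integrable Omega (EFin \o (fun x => `|G x i j|)).
  by have [iG _] := wG i j; have := integrable_norm iG; exact.
have iS : mu.-integrable Omega (EFin \o (fun x => 1 + ((`|G x 0 0| + `|G x 0 1|) + (`|G x 1 0| + `|G x 1 1|)))).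
  apply: integrable_EFinD; [exact: mO| |].
    apply: measurable_bounded_integrable; [exact: mO|exact: Ofin|by []|].
    by exists 1; split => // M M1 x _ /=; rewrite normr1 ltW.
  by do ![apply: integrable_EFinD; first exact: mO] => //.
apply: le_integrable iS; first exact: mO.
  apply/measurable_EFinP; apply: measurable_gdens => i j.
  by have [iGij _] := wG i j; exact: integrable_measurable iGij.
move=> x _; rewrite /= lee_fin ger0_norm ?gdens_ge0//.
apply: le_trans (gdens_le_sum _) _; rewrite sum22 [leRHS]ger0_norm; last by rewrite !addr_ge0.
by rewrite !addrA.
Qed.

Variables (A E : set (plane R)) (s : R).
Hypotheses (oA : open A) (AO : A `<=` Omega) (mE : measurable E) (EA : E `<=` A)
  (s1 : s ^+ 2 = 1) (Es : forall x, E x -> 0 <= s * U 0 x).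

Let mA : measurable A. Proof. exact: open_measurable_plane. Qed.
Let mAE : measurable (A `\` E). Proof. by apply: measurableD; [exact: mA|exact: mE]. Qed.

Let P N i x := poisson (1 + N%:R^-1) (pole0 s N i) (pole1 R N i) (U 0 x) (U 1 x).

Let P_ge0 N i x : 0 <= P N i x.
Proof. by apply: poisson_ge0; rewrite lerDl invr_ge0. Qed.

Let mP N i : measurable_fun setT (P N i).
Proof. by apply: measurable_poisson; exact: measurable_uext. Qed.

Let mf : measurable_fun A (fun x => gdens (G x)).
Proof.
have := integrable_measurable integrable_gdens_weak.
by apply: measurable_funS => //; exact: open_measurable_plane.
Qed.

(** The mean of the kernels over the [N] poles is at most [4 / N] on [E] and at most [192] on the
    rest of [A], and some pole does no worse than the mean. The slack [e] makes the argument by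
    contradiction strict. *)
Lemma pole_selection N e : (0 < N)%N -> 0 < e -> exists2 i, (i < N)%N &
  (\int[mu]_(x in A) (P N i x * gdens (G x))%:E <=
   (4 / N%:R)%:E * \int[mu]_(x in E) (gdens (G x))%:E +
   192%:E * \int[mu]_(x in A `\` E) (gdens (G x))%:E + e%:E)%E.
Proof.
move=> N0 e0; have n0 : 0 < N%:R :> R by rewrite ltr0n.
have iE : mu.-integrable E (EFin \o (fun x => gdens (G x))).
  apply: integrableS integrable_gdens_weak; [exact: open_measurable_plane|exact: mE|].
  exact: subset_trans AO.
have iD : mu.-integrable (A `\` E) (EFin \o (fun x => gdens (G x))).
  apply: integrableS integrable_gdens_weak; [exact: open_measurable_plane|exact: mAE|].
  by move=> x [/AO].
have fE : (\int[mu]_(x in E) (gdens (G x))%:E \is a fin_num)%E.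
  by apply: (integrable_fin_num _ iE); exact: mE.
have fD : (\int[mu]_(x in A `\` E) (gdens (G x))%:E \is a fin_num)%E.
  by apply: (integrable_fin_num _ iD); exact: mAE.
move: fE fD.
set ID := (\int[mu]_(x in A `\` E) _)%E; set IE := (\int[mu]_(x in E) _)%E.
move=> /fineK hE /fineK hD.
pose b := 4 / N%:R * fine IE + 192 * fine ID + e.
have -> : ((4 / N%:R)%:E * IE + 192%:E * ID + e%:E = b%:E)%E.
  by rewrite -hE -hD -!EFinM -!EFinD.
apply: contrapT => no.
have big i : (i < N)%N -> (b%:E <= \int[mu]_(x in A) (P N i x * gdens (G x))%:E)%E.
  by move=> iN; rewrite leNgt; apply/negP => /ltW h; apply: no; exists i.
have f0 x : 0 <= gdens (G x) by exact: gdens_ge0.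
have mPf i : measurable_fun A (fun x => P N i x * gdens (G x)).
  by apply: measurable_funM => //; exact: measurable_funTS.
pose S x := \sum_(i < N) P N i x * gdens (G x).
have S0 x : 0 <= S x by apply: sumr_ge0 => i _; exact: mulr_ge0.
have mS : measurable_fun A S by apply: measurable_sum => i; exact: mPf.
have sumE : (\sum_(i < N) \int[mu]_(x in A) (P N i x * gdens (G x))%:E =
    \int[mu]_(x in A) (S x)%:E)%E.
  rewrite -ge0_integral_sum; first last.
  - by move=> i x _; rewrite lee_fin mulr_ge0.
  - by move=> i; apply/measurable_EFinP; exact: mPf.
  - exact: mA.
  by apply: eq_integral => x _; rewrite sumEFin.
(* If every pole failed, the sum of the integrals would be at least [N b]. Splitting [A] bounds it
   by [4] times the integral over [E] plus [192 N] times the other one, which falls short of [N b]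
   by [N e]. *)
have : ((b *+ N)%:E <= (4 * fine IE + 192 * N%:R * fine ID)%:E)%E.
  apply: (@le_trans _ _ (\sum_(i < N) b%:E)%E).
    by rewrite sumEFin sumr_const card_ord.
  apply: (@le_trans _ _ (\int[mu]_(x in A) (S x)%:E)%E).
    by rewrite -sumE; apply: lee_sum => i _; exact: big.
  have AU : A = E `|` (A `\` E) by rewrite setDUK.
  rewrite {1}AU ge0_integral_setU; first last.
  - by apply/disj_setPS => x [Ex [_ nE]].
  - by move=> x _; rewrite lee_fin.
  - by rewrite -AU; apply/measurable_EFinP.
  - exact: mAE.
  - exact: mE.
  rewrite EFinD !EFinM hE hD; apply: leeD.
    rewrite -ge0_integralZl//; [|by apply/measurable_EFinP; exact: integrable_measurable iE|
      by move=> x _; rewrite lee_fin].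
    apply: ge0_le_integral.
    + exact: mE.
    + by move=> x _; rewrite lee_fin.
    + by apply/measurable_EFinP; apply: measurable_funS mS => //; exact: mA.
    + by apply/measurable_EFinP; apply: measurable_funM => //; exact: integrable_measurable iE.
    + move=> x Ex; rewrite -EFinM lee_fin /S -mulr_suml ler_wpM2r//.
      apply: (@le_trans _ _ (\sum_(i < N) 4 / N%:R)).
        by apply: ler_sum => i _; apply: poisson_far_le => //; exact: Es.
      by rewrite sumr_const card_ord -[_ *+ N]mulr_natr divfK// gt_eqF.
  rewrite -EFinM -ge0_integralZl//; [|by apply/measurable_EFinP; exact: integrable_measurable iD|
    by move=> x _; rewrite lee_fin].
  apply: ge0_le_integral.
  + exact: mAE.
  + by move=> x _; rewrite lee_fin.
  + by apply/measurable_EFinP; apply: measurable_funS mS; [exact: mA|exact: subDsetl].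
  + by apply/measurable_EFinP; apply: measurable_funM => //; exact: integrable_measurable iD.
  + move=> x [Ax _]; rewrite -EFinM lee_fin /S -mulr_suml ler_wpM2r//.
    by apply: poisson_sum_le => //; exact: (uext_circle circ (AO Ax)).
rewrite lee_fin /b -[_ *+ N]mulr_natr.
have -> : (4 / N%:R * fine IE + 192 * fine ID + e) * N%:R =
  4 * fine IE + 192 * N%:R * fine ID + e * N%:R by field; rewrite gt_eqF.
by rewrite gerDl leNgt mulr_gt0.
Qed.

End pole_selection.

Section relaxed_area_upper.
Variable R : realType.
Implicit Types (x y : plane R).
Local Notation mu := (leb2 R).

(** The parameters are fixed in the order [t], then [N], then the pole, and the mollifier last,
    inside [reflected_approx]; each of the two errors is split into quarters of [e]. *)
Lemma relaxed_area_upper (Omega : set (plane R)) (u : plane R -> plane R)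
    (G : plane R -> 'M[R]_2) (A E : set (plane R)) (s r : R) :
  open Omega -> (mu Omega < +oo)%E -> L1 Omega u -> is_weak_grad Omega u G ->
  (forall x, Omega x -> circle (u x)) ->
  open A -> 0 < r -> A `<=` margin Omega r -> measurable E -> E `<=` A ->
  s ^+ 2 = 1 -> (forall x, E x -> 0 <= s * (u x).1) ->
  (relaxed_area u A <= \int[mu]_(x in A) (gdens (G x))%:E +
    192%:E * \int[mu]_(x in A `\` E) (gdens (G x))%:E)%E.
Proof.
move=> oO Ofin Lu wG circ oA r0 AOr mE EA s1 Es.
have mA : measurable A by exact: open_measurable_plane.
have mO : measurable Omega by exact: open_measurable_plane.
have mAE : measurable (A `\` E) by apply: measurableD; [exact: mA|exact: mE].
have AO : A `<=` Omega by apply: subset_trans AOr _; exact: margin_sub.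
have Afin : (mu A < +oo)%E := measure_margin_fin oO Ofin oA r0 AOr.
have iO := integrable_gdens_weak oO Ofin wG.
have iA : mu.-integrable A (EFin \o (fun x => gdens (G x))).
  by apply: integrableS iO; [exact: mO|exact: mA|exact: AO].
have iE : mu.-integrable E (EFin \o (fun x => gdens (G x))).
  by apply: integrableS iA; [exact: mA|exact: mE|exact: EA].
have iD : mu.-integrable (A `\` E) (EFin \o (fun x => gdens (G x))).
  by apply: integrableS iA; [exact: mA|exact: mAE|exact: subDsetl].
have fE : (\int[mu]_(x in E) (gdens (G x))%:E \is a fin_num)%E.
  by apply: (integrable_fin_num _ iE); exact: mE.
have fD : (\int[mu]_(x in A `\` E) (gdens (G x))%:E \is a fin_num)%E.
  by apply: (integrable_fin_num _ iD); exact: mAE.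
have fM : (mu A \is a fin_num)%E by rewrite ge0_fin_numE.
have f0 x : 0 <= gdens (G x) by exact: gdens_ge0.
have f1 x : 1 <= gdens (G x) by exact: gdens_ge1.
have E0 : 0 <= fine (\int[mu]_(x in E) (gdens (G x))%:E)%E.
  by rewrite fine_ge0// integral_ge0// => x _; rewrite lee_fin.
have D0 : 0 <= fine (\int[mu]_(x in A `\` E) (gdens (G x))%:E)%E.
  by rewrite fine_ge0// integral_ge0// => x _; rewrite lee_fin.
have M0 : 0 <= fine (mu A) by rewrite fine_ge0.
move: fE fD fM => /fineK hE /fineK hD /fineK hM.
apply: relaxed_area_le => e e0.
set IE := fine _ in E0 hE; set ID := fine _ in D0 hD; set m := fine _ in M0 hM.
(* A bound, independent of [N], for the integral of the selected kernel; it is established in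
   [intP]. *)
pose M := 4 * IE + 192 * ID + 1.
have M1 : 0 < M by rewrite ltr_wpDl// addr_ge0// mulr_ge0.
have m1 : 0 < m + 1 by rewrite ltr_wpDl.
pose t := e / (8 * (m + 1)).
have t0 : 0 < t by rewrite divr_gt0// mulr_gt0.
(* The first term makes the displacement [4 / (N t) * M] at most [e / 4], the second does the same
   for the loss [4 / N * IE] on [E]. *)
pose B := 16 * M / (t * e) + 16 * IE / e + 1.
have te : 0 < t * e by rewrite mulr_gt0.
have B1 : 0 <= 16 * M / (t * e) by apply: divr_ge0; apply: mulr_ge0 => //; exact: ltW.
have B2 : 0 <= 16 * IE / e by apply: divr_ge0; [exact: mulr_ge0|exact: ltW].
pose N := (Num.truncn B).+1.
have NB : B < N%:R by exact: truncnS_gt.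
have N0 : (0 < N)%N by [].
have n0 : 0 < N%:R :> R by rewrite ltr0n.
have N1 : 4 / N%:R * IE <= e / 4.
  rewrite mulrAC ler_pdivrMr// mulrAC ler_pdivlMr//.
  have : 16 * IE / e <= N%:R by apply: le_trans (ltW NB); rewrite /B; lra.
  by rewrite ler_pdivrMr//; lra.
have N2 : 4 * N%:R^-1 / t * M <= e / 4.
  have -> : 4 * N%:R^-1 / t * M = 4 * M / t / N%:R by ring.
  rewrite ler_pdivrMr// ler_pdivrMr//.
  have : 16 * M / (t * e) <= N%:R by apply: le_trans (ltW NB); rewrite /B; lra.
  by rewrite ler_pdivrMr//; lra.
have N3 : 2 * t * m <= e / 4.
  have -> : 2 * t * m = e / 4 * (m / (m + 1)) by rewrite /t; field; rewrite gt_eqF.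
  apply: ler_piMr; first by rewrite divr_ge0// ltW.
  by rewrite ler_pdivrMr// mul1r lerDl.
(* At most [1] to fit into [M], at most [e / 4] to fit into the area budget. *)
pose e1 := Num.min 1 (e / 4).
have e10 : 0 < e1 by rewrite lt_min ltr01 divr_gt0.
have e11 : e1 <= 1 by rewrite ge_min lexx.
have e12 : e1 <= e / 4 by rewrite ge_min lexx orbT.
have EsU x : E x -> 0 <= s * uext Omega u 0 x.
  by move=> Ex; rewrite /uext patchE mem_set; [exact: Es|exact: AO (EA _ Ex)].
have [i iN sel] := pole_selection oO Ofin Lu wG circ oA AO mE EA s1 EsU N0 e10.
pose d : R := N%:R^-1.
have d0 : 0 < d by rewrite invr_gt0.
have d1 : d <= 1 by rewrite invf_le1// ler1n.
have rn : 1 + d != 0 by rewrite gt_eqF// addr_gt0.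
pose q1 := pole0 s N i / (1 + d); pose q2 := pole1 R N i / (1 + d).
have q : q1 ^+ 2 + q2 ^+ 2 = 1.
  have -> : q1 ^+ 2 + q2 ^+ 2 = (pole0 s N i ^+ 2 + pole1 R N i ^+ 2) / (1 + d) ^+ 2.
    by rewrite /q1 /q2; field.
  by rewrite pole_sqr// divff// expf_neq0.
have mG j k : measurable_fun A (fun x => G x j k).
  have [iG _] := wG j k; have := integrable_measurable iG.
  by apply: measurable_funS; [exact: mO|exact: AO].
have e4 : 0 < e / 4 by rewrite divr_gt0.
have [v [Cv Lv av dv]] := reflected_approx oO Ofin Lu wG circ oA r0 AOr q d0 d1 mG t0 e4.
move: av dv; rewrite /q1 /q2 !(mulrC (1 + d)) !divfK// => av dv.
set P := fun x => poisson (1 + d) (pole0 s N i) (pole1 R N i) (uext Omega u 0 x) (uext Omega u 1 x).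
have P0 x : 0 <= P x by apply: poisson_ge0; rewrite lerDl ltW.
have mP : measurable_fun A P.
  by apply: measurable_poisson; exact: (measurable_UA oO Lu).
have mf : measurable_fun A (fun x => gdens (G x)) by exact: integrable_measurable iA.
have mPf : measurable_fun A (fun x => P x * gdens (G x)) by exact: measurable_funM.
have {}sel : (\int[mu]_(x in A) (P x * gdens (G x))%:E <= (4 / N%:R * IE + 192 * ID + e1)%:E)%E.
  by rewrite !EFinD !EFinM -EFinM hE hD.
exists v; split => //.
  apply: le_trans av _.
  rewrite [X in (X + _ <= _)%E](_ : _ = \int[mu]_(x in A) (gdens (G x))%:E +
    \int[mu]_(x in A) (P x * gdens (G x))%:E)%E; last first.
    rewrite -ge0_integral_EFinD; [|exact: mA|exact: mf|exact: mPf|by []|by move=> x; exact: mulr_ge0].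
    by apply: eq_integral => x _; rewrite mulrDl mul1r.
  rewrite -[leLHS]addeA -[leRHS]addeA leeD2l//; apply: le_trans (leeD sel (lexx (e / 4)%:E)) _.
  rewrite -hD -EFinM -!EFinD lee_fin; lra.
apply: le_trans dv _.
(* As [gdens >= 1], the weighted bound from the selection of the pole also controls the kernel
   alone, hence the displacement. *)
have intP : (\int[mu]_(x in A) (P x)%:E <= M%:E)%E.
  apply: le_trans (le_trans sel _).
    apply: ge0_le_integral.
    - exact: mA.
    - by move=> x _; rewrite lee_fin.
    - exact/measurable_EFinP.
    - exact/measurable_EFinP.
    - by move=> x _; rewrite lee_fin ler_peMr.
  rewrite lee_fin /M; have : 4 / N%:R * IE <= 4 * IE.
    by rewrite ler_wpM2r// ler_piMr.
  lra.
have c0 : 0 <= 4 * d / t by apply: divr_ge0; [apply: mulr_ge0 => //; exact: ltW|exact: ltW].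
have -> : (\int[mu]_(x in A) (2 * (t + 2 * d * P x / t))%:E =
   (2 * t * m)%:E + (4 * d / t)%:E * \int[mu]_(x in A) (P x)%:E)%E.
  rewrite -ge0_integralZl//; [|by apply/measurable_EFinP|by move=> x _; rewrite lee_fin].
  rewrite EFinM hM -integral_cst; last exact: mA.
  rewrite -ge0_integral_EFinD; [|exact: mA|by []| |by move=> x; rewrite mulr_ge0// ltW|
    by move=> x; exact: mulr_ge0].
    by apply: eq_integral => x _; congr (_%:E); ring.
  exact: measurable_funM.
apply: (@le_trans _ _ ((2 * t * m)%:E + (4 * d / t)%:E * M%:E + (e / 4)%:E)%E).
  by rewrite leeD2r// leeD2l// lee_wpmul2l// lee_fin.
rewrite -EFinM -!EFinD lee_fin; move: N2; rewrite -/d; lra.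
Qed.

End relaxed_area_upper.

(** * The envelope *)

Section circle_representative.
Variable R : realType.
Implicit Types (x y : plane R) (A Omega : set (plane R)).
Local Notation mu := (leb2 R).

Lemma bounded_measure_fin Omega : measurable Omega -> bounded_set Omega ->
  (mu Omega < +oo)%E.
Proof.
move=> mO [M [_ MO]]; pose r := `|M| + 1.
have r0 : 0 <= r by rewrite addr_ge0.
have Or : Omega `<=` ball (0 : plane R) (r + 1).
  move=> x Ox; rewrite -ball_normE /ball_/= sub0r normrN.
  apply: (@le_lt_trans _ _ r); last by rewrite ltrDl.
  by apply: (MO r) => //; rewrite (le_lt_trans (ler_norm _))// ltrDl.
apply: le_lt_trans (@leb2_ball_fin R 0 (r + 1) _); last by rewrite addr_ge0.
apply: le_measure; rewrite ?inE; [exact: mO| |exact: Or].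
exact: measurable_plane_ball.
Qed.

(** A representative that lies on the circle everywhere, as the pointwise identities demand. Within
    [Omega] the value [(1, 0)] is taken only on a null set. *)
Definition to_circle (u : plane R -> plane R) x : plane R :=
  if enorm (u x) == 1 then u x else (1, 0).

Lemma to_circleP u x : circle (to_circle u x).
Proof.
rewrite /circle/= /to_circle; case: ifPn => [/eqP//|_].
by rewrite /enorm/= expr1n expr0n addr0 sqrtr1.
Qed.

Variables (Omega : set (plane R)) (u : plane R -> plane R).
Hypotheses (oO : open Omega) (Ofin : (mu Omega < +oo)%E) (Lu : L1 Omega u)
  (circ : {ae mu, forall x, Omega x -> circle (u x)}).

Let mO : measurable Omega. Proof. exact: open_measurable_plane. Qed.

Let mu_ i : measurable_fun Omega (coord2 i \o u).
Proof. exact: integrable_measurable (Lu i). Qed.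

Lemma to_circle_ae : {ae mu, forall x, Omega x -> to_circle u x = u x}.
Proof.
apply: negligibleS circ => x /= H1 H2; apply: H1 => Ox.
by have := H2 Ox; rewrite /circle/= /to_circle => ->; rewrite eqxx.
Qed.

Lemma L1_to_circle : L1 Omega (to_circle u).
Proof.
move=> i; apply: measurable_bounded_integrable; [exact: mO|exact: Ofin| |].
  rewrite (_ : _ \o _ = (fun x => if enorm (u x) == 1 then (coord2 i \o u) x
      else coord2 i (1, 0))); last first.
    by apply/funext => x; rewrite /to_circle/=; case: ifP.
  apply: measurable_fun_if.
  - exact: mO.
  - apply: measurable_fun_eqr; last by [].
    exact: measurable_enorm (mu_ 0) (mu_ 1).
  - by apply: measurable_funS (mu_ i); [exact: mO|move=> x []].
  - by [].
exists 1; split => // M M1 x _ /=; apply: le_trans (ltW M1).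
by apply: le_trans (coord2_le_enorm i _) _; rewrite (to_circleP u x).
Qed.

Lemma measurable_partial_test (phi : plane R -> R) j : smooth phi -> measurable_fun setT (partial j phi).
Proof.
move=> sphi; apply: measurable_fun_continuous_open; first exact: openT.
by move=> x _; apply: differentiable_continuous; exact: (sphi [:: j] x).
Qed.

Lemma weak_grad_to_circle G : is_weak_grad Omega u G -> is_weak_grad Omega (to_circle u) G.
Proof.
move=> wG i j; have [iG H] := wG i j; split => // phi tphi; rewrite -H//.
have [sphi _ _] := tphi; rewrite /Rintegral; congr fine.
have mp : measurable_fun Omega (partial j phi) by apply: measurable_funTS; exact: measurable_partial_test.
apply: ae_eq_integral.
- exact: mO.
- apply/measurable_EFinP; apply: measurable_funM; last exact: mp.
  exact: integrable_measurable (L1_to_circle i).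
- by apply/measurable_EFinP; apply: measurable_funM; [exact: mu_|exact: mp].
- apply: negligibleS to_circle_ae => x /= H1 H2; apply: H1 => Ox.
  by rewrite (H2 Ox).
Qed.

(** The relaxed area sees the map only through [L^1] distances, which ignore null sets. *)
Lemma relaxed_area_to_circle A : open A -> A `<=` Omega ->
  (relaxed_area u A <= relaxed_area (to_circle u) A)%E.
Proof.
move=> oA AO; have mA : measurable A by exact: open_measurable_plane.
apply: le_ereal_inf => _ [v [Hv cv ->]]; exists v; split => //.
suff e : (fun k => \int[mu]_(x in A) (enorm (v k x - u x))%:E)%E =
    (fun k => \int[mu]_(x in A) (enorm (v k x - to_circle u x))%:E)%E.
  by rewrite /cvg_L1 e.
apply/funext => k; apply/esym.
have mw w : L1 Omega w -> measurable_fun A (EFin \o (fun x => enorm (v k x - w x))).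
  move=> Lw; apply/measurable_EFinP.
  have mc (i : 'I_2) : measurable_fun A (coord2 i \o (fun x => v k x - w x)).
    rewrite (_ : _ \o _ = (fun x => (coord2 i \o v k) x - (coord2 i \o w) x)); last first.
      by apply/funext => x; exact: coord2B.
    have [_ Lv] := Hv k; apply: measurable_funB; first exact: integrable_measurable (Lv i).
    by apply: measurable_funS (integrable_measurable (Lw i)) => //; exact: mO.
  exact: measurable_enorm (mc 0) (mc 1).
apply: ae_eq_integral; [exact: mA|exact: mw L1_to_circle|exact: mw Lu|].
apply: negligibleS to_circle_ae => x /= H1 H2; apply: H1 => Ax.
by rewrite (H2 (AO _ Ax)).
Qed.

End circle_representative.

Section envelope.
Variable R : realType.
Implicit Types (x y : plane R) (A Omega : set (plane R)).
Local Notation mu := (leb2 R).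

Lemma interior_margin_cover Omega : open Omega ->
  Omega = \bigcup_m (margin Omega m.+1%:R^-1)°.
Proof.
move=> oO; apply/seteqP; split=> [x Ox|x [m _ /interior_subset]]; last first.
  by apply: margin_sub; rewrite invr_gt0.
have /nbhs_ballP[r /= r0 rO] := open_nbhs_nbhs (conj oO Ox).
have r2 : 0 < r / 2 by rewrite divr_gt0.
have /cvgrPdist_lt/(_ _ r2)[m _ mP] := @cvg_harmonic R.
have := mP m (leqnn m); rewrite sub0r normrN /= ger0_norm// => mr.
have m0 : 0 < m.+1%:R^-1 :> R by rewrite invr_gt0.
exists m => //; apply/nbhs_ballP; exists m.+1%:R^-1 => //= y xy z yz.
by apply: rO; rewrite (splitr r); apply: (@ball_triangle _ _ y);
  apply: le_ball (ltW mr) _ _.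
Qed.

(** The cover is made disjoint before the integral is split, and each disjoint piece is then
    enlarged back. *)
Lemma integral_cover_le (f : plane R -> \bar R) (A_ : nat -> set (plane R)) Omega :
  (forall k, measurable (A_ k)) -> Omega = \bigcup_k A_ k ->
  measurable_fun Omega f -> (forall x, 0 <= f x)%E ->
  (\int[mu]_(x in Omega) f x <= \sum_(0 <= k <oo) \int[mu]_(x in A_ k) f x)%E.
Proof.
move=> mA OE; rewrite OE => mf f0.
have mS k : measurable (seqDU A_ k) by exact: seqDU_measurable.
have AO k : A_ k `<=` \bigcup_k A_ k by exact: bigcup_sup.
rewrite {1}seqDU_bigcup_eq ge0_integral_bigcup.
- apply: lee_nneseries => k _; first by move=> _; apply: integral_ge0.
  apply: ge0_subset_integral; [exact: mS|exact: mA| |by []|exact: subset_seqDU].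
  by apply: measurable_funS mf; [exact: bigcup_measurable|exact: AO].
- exact: mS.
- by rewrite -seqDU_bigcup_eq.
- by [].
- exact: trivIset_seqDU.
Qed.

Variables (Omega : set (plane R)) (u : plane R -> plane R) (G : plane R -> 'M[R]_2).
Hypotheses (oO : open Omega) (Ofin : (mu Omega < +oo)%E) (Lu : L1 Omega u)
  (wG : is_weak_grad Omega u G).

Let mO : measurable Omega. Proof. exact: open_measurable_plane. Qed.

Let mf : measurable_fun Omega (fun x => (gdens (G x))%:E).
Proof.
apply/measurable_EFinP; apply: measurable_gdens => i j.
by have [iG _] := wG i j; exact: integrable_measurable iG.
Qed.

Let f0 x : (0 <= (gdens (G x))%:E)%E.
Proof. by rewrite lee_fin gdens_ge0. Qed.

Lemma relaxed_area_ge_sub A : open A -> A `<=` Omega ->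
  (\int[mu]_(x in A) (gdens (G x))%:E <= relaxed_area u A)%E.
Proof.
move=> oA AO; have mA : measurable A by exact: open_measurable_plane.
apply: (@relaxed_area_ge _ A Omega) => //.
- by apply: le_lt_trans Ofin; apply: le_measure; rewrite ?inE; [exact: mA|exact: mO|exact: AO].
- by move=> i; apply: integrableS (Lu i); [exact: mO|exact: mA|exact: AO].
Qed.

Lemma area_envelope_ge :
  (\int[mu]_(x in Omega) (gdens (G x))%:E <= area_envelope Omega u Omega)%E.
Proof.
apply: le_ereal_inf_tmp => _ [A [HA cA ->]].
have oA k : open (A k) by have [] := HA k.
have AO k : A k `<=` Omega by have [] := HA k.
have OE : Omega = \bigcup_k A k.
  by apply/seteqP; split=> // x [k _ /AO].
have mA k : measurable (A k) by exact: open_measurable_plane.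
apply: le_trans (integral_cover_le mA OE mf f0) _.
apply: lee_nneseries => k _; first by move=> _; exact: integral_ge0.
exact: relaxed_area_ge_sub.
Qed.

Hypothesis circ : forall x, Omega x -> circle (u x).

Let D m := (margin Omega m.+1%:R^-1)°.
Let S b : set (plane R) := if b then [set x | uext Omega u 0 x < 0]
  else [set x | 0 <= uext Omega u 0 x].
(** The index [k] codes a pair: [k./2] is the level of the margin and [odd k] the sign of the first
    coordinate, so a single sequence runs through both halves of every level. *)
Let T k := D k./2 `&` S (odd k).
Let E := seqDU T.

Let oD m : open (D m). Proof. exact: open_interior. Qed.
Let mD m : measurable (D m). Proof. exact: open_measurable_plane. Qed.
Let DO m : D m `<=` Omega.
Proof.
by move=> x /interior_subset; apply: margin_sub; rewrite invr_gt0.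
Qed.

Let mS b : measurable (S b).
Proof.
have mU := measurable_uext oO Lu 0.
rewrite /S; case: b.
  rewrite -[X in measurable X]setTI (_ : [set x | _] = uext Omega u 0 @^-1` `]-oo, 0[%classic).
    by apply: mU.
  by apply/seteqP; split => x /=; rewrite in_itv.
rewrite -[X in measurable X]setTI (_ : [set x | _] = uext Omega u 0 @^-1` `[0, +oo[%classic).
  by apply: mU.
by apply/seteqP; split => x /=; rewrite in_itv/= andbT.
Qed.

Let mT k : measurable (T k).
Proof. by apply: measurableI; [exact: mD|exact: mS]. Qed.

Let mE k : measurable (E k). Proof. exact: seqDU_measurable. Qed.

Let cover_E : Omega = \bigcup_k E k.
Proof.
rewrite -seqDU_bigcup_eq; apply/seteqP; split=> [x|x [k _ [/DO]]//].
rewrite {1}(interior_margin_cover oO) => -[m _ Dx].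
have [xs|xs] := ltP (uext Omega u 0 x) 0.
  by exists m.*2.+1 => //; split; rewrite /= ?uphalf_double ?odd_double.
by exists m.*2 => //; split; rewrite /= ?doubleK ?odd_double.
Qed.

(** To be applied with [v] the given map and [u] its representative on the circle: only the latter
    satisfies [circ], while the envelope concerns the former. *)
Lemma area_envelope_le (v : plane R -> plane R) :
  (forall A, open A -> A `<=` Omega -> (relaxed_area v A <= relaxed_area u A)%E) ->
  (forall A, open A -> A `<=` Omega -> (0 <= relaxed_area v A)%E) ->
  (area_envelope Omega v Omega <= \int[mu]_(x in Omega) (gdens (G x))%:E)%E.
Proof.
move=> vu v0; apply/lee_addgt0Pr => e e0.
pose w x := (((fun x => gdens (G x)) \_ Omega) x)%:E.
have iw : mu.-integrable setT w.
  exact: (integrable_ext0 mO (integrable_gdens_weak oO Ofin wG)).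
have w0 x : (0 <= w x)%E.
  by rewrite lee_fin patchE; case: ifP => // _; exact: gdens_ge0.
have wfin : (\int[mu]_x w x < +oo)%E.
  have /integrableP[_] := iw; apply: le_lt_trans; apply: ge0_le_integral => //.
  - exact: measurable_int iw.
  - by apply: measurableT_comp => //; exact: measurable_int iw.
  - by move=> x _; exact: lee_abs.
(* The excess over [A k \ E k] is counted once in the integral over [A k] and [192] times in the
   upper bound, hence the divisor [193]. *)
have ek k : 0 < e / 193 / (2 ^ k.+1)%:R by rewrite !divr_gt0// ltr0n expn_gt0.
have /choice[V VP] : forall k, exists V, [/\ open V, E k `<=` V &
    (\int[mu]_(x in V `\` E k) w x <= (e / 193 / (2 ^ k.+1)%:R)%:E)%E].
  move=> k; apply: (outer_regular_weight _ w0 wfin _ (ek k)); last exact: mE.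
  exact: measurable_int iw.
(* The cut with [D k./2] keeps the neighbourhood inside a fixed margin of [Omega] and still contains
   [E k]. *)
pose A k := V k `&` D k./2.
have oA k : open (A k) by apply: openI; [have [] := VP k|exact: oD].
have AO k : A k `<=` Omega by move=> x [_ /DO].
have EA k : E k `<=` A k.
  move=> x Ex; split; first by have [_ h _] := VP k; exact: h.
  by have [] := subset_seqDU Ex.
have mA k : measurable (A k) by exact: open_measurable_plane.
have mAE k : measurable (A k `\` E k) by apply: measurableD; [exact: mA|exact: mE].
have small k : (\int[mu]_(x in A k `\` E k) (gdens (G x))%:E <=
    (e / 193 / (2 ^ k.+1)%:R)%:E)%E.
  have [oV _ h] := VP k; apply: le_trans h.
  rewrite (@eq_integral _ _ _ mu (A k `\` E k) w); last first.
    by move=> x; rewrite inE => -[/AO Ox _]; rewrite /w patchE mem_set.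
  apply: ge0_subset_integral; [exact: mAE| | |by []|].
  - by apply: measurableD; [exact: open_measurable_plane|exact: mE].
  - by apply: measurable_funTS; exact: measurable_int iw.
  - by move=> x [[]].
have upper k : (relaxed_area v (A k) <= \int[mu]_(x in E k) (gdens (G x))%:E +
    (e / (2 ^ k.+1)%:R)%:E)%E.
  apply: le_trans (vu _ (oA k) (AO k)) _.
  have m0 : 0 < (k./2).+1%:R^-1 :> R by rewrite invr_gt0.
  have Am : A k `<=` margin Omega (k./2).+1%:R^-1.
    by move=> x [_ /interior_subset].
  have s1 : ((-1) ^+ odd k : R) ^+ 2 = 1 by rewrite sqrr_sign.
  have Es x : E k x -> 0 <= (-1) ^+ odd k * (u x).1.
    move=> Ex; have Ox := AO _ _ (EA _ _ Ex).
    have [_] := subset_seqDU Ex; rewrite /S.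
    case: (odd k) => /=; rewrite /uext patchE mem_set//= /coord2/=.
      by rewrite expr1 mulN1r oppr_ge0 => /ltW.
    by rewrite expr0 mul1r.
  apply: le_trans (relaxed_area_upper oO Ofin Lu wG circ (oA k) m0 Am (mE k) (EA k) s1 Es) _.
  have AU : A k = E k `|` (A k `\` E k) by rewrite setDUK.
  have mfA : measurable_fun (A k) (fun x => (gdens (G x))%:E).
    by apply: measurable_funS mf; [exact: mO|exact: AO].
  rewrite {1}AU ge0_integral_setU; first last.
  - by apply/disj_setPS => x [Ex [_ nE]].
  - by move=> x _; exact: f0.
  - by rewrite -AU.
  - exact: mAE.
  - exact: mE.
  rewrite -[leLHS]addeA leeD2l//.
  apply: (@le_trans _ _ ((e / 193 / (2 ^ k.+1)%:R)%:E +
      192%:E * (e / 193 / (2 ^ k.+1)%:R)%:E)%E).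
    by apply: leeD => //; rewrite lee_wpmul2l// lee_fin.
  rewrite -EFinM -EFinD lee_fin le_eqVlt; apply/orP; left; apply/eqP; field.
  by rewrite pnatr_eq0 expn_eq0.
apply: (@le_trans _ _ (\sum_(0 <= k <oo) relaxed_area v (A k))%E).
  apply: ereal_inf_lbound; exists A; split => //.
  by rewrite {1}cover_E; apply: subset_bigcup => k _; exact: EA.
apply: (@le_trans _ _ (\sum_(0 <= k <oo) (\int[mu]_(x in E k) (gdens (G x))%:E +
    (e / (2 ^ k.+1)%:R)%:E))%E).
  by apply: lee_nneseries => k _; [move=> _; exact: v0|exact: upper].
apply: le_trans (epsilon_trick _ _ (ltW e0)) _.
  by move=> k; apply: integral_ge0 => x _; exact: f0.
rewrite leeD2r// {1}cover_E ge0_integral_bigcup//.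
- by rewrite -cover_E.
- exact: trivIset_seqDU.
Qed.

End envelope.

Theorem proposition7p1 (R : realType) (Omega : set (plane R))
    (u : plane R -> plane R)
    (Omega_open : open Omega) (Omega_connected : connected Omega)
    (Omega_bounded : bounded_set Omega)
    (Omega_lipschitz : lipschitz_boundary Omega)
    (hu : W11_circle Omega u) :
  area_envelope Omega u Omega =
  (\int[leb2 R]_(x in Omega)
     (Num.sqrt (1 + frobenius (weak_grad Omega u x) ^+ 2))%:E)%E.
Proof.
have [[Lu exG] circ] := hu.
(* [weak_grad] is a choice; [hu] provides a weak gradient, so the default value does not occur. *)
have wG : is_weak_grad Omega u (weak_grad Omega u) by exact: xgetPex exG.
have mO : measurable Omega by exact: open_measurable_plane.
have Ofin := bounded_measure_fin mO Omega_bounded.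
apply/le_anti/andP; split; last exact: area_envelope_ge wG.
(* The representative on the circle has the same weak gradient, so the bound refers to the same
   integral. *)
apply: (area_envelope_le Omega_open Ofin (L1_to_circle Omega_open Ofin Lu)
  (weak_grad_to_circle Omega_open Ofin Lu circ wG)).
- by move=> x _; exact: to_circleP.
- by move=> A oA AO; exact: (relaxed_area_to_circle Omega_open Ofin Lu circ).
(* The nonnegativity required for comparing the series follows from the lower bound. *)
- move=> A oA AO; apply: le_trans (relaxed_area_ge_sub Omega_open Ofin Lu wG oA AO).
  by apply: integral_ge0 => x _; rewrite lee_fin gdens_ge0.
Qed.
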